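(* Fix positive integers $k$ and $n$. Let $\lambda$ be a partition contained inside of an $n\times k$ rectangle, and define $$M^D_q(\lambda+\Lambda_n):=\det\left[\genfrac{[}{]}{0pt}{}{2(k+i)+1}{k+i-j-|\lambda_{n-j}|}_q\right]_{i,j=0}^{n-1}.$$ Then we have $$M^D_q(\lambda+\Lambda_n)=q^{\|\overline\lambda\|}\dim_q(\overline\lambda'),$$ where $\dim_q(\overline\lambda')$ is the $q$-dimension of $V(\overline\lambda')$ in type $B_k$. Moreover, $M^D_1(\lambda+\Lambda_n)$ equals the multiplicity of $V(\lambda+\Lambda_{n'})$, for $n'=n-1,n$, in $V^{\otimes 2k+1}$, where $V=V(\Lambda_{n-1})\oplus V(\Lambda_n)$ is the sum of the two half-spin representations of $\mathfrak{so}_{2n}$.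
   Context: $[m]_q=1+q+\cdots+q^{m-1}$, $[m]_q!=\prod_{j=1}^m[j]_q$, $\genfrac{[}{]}{0pt}{}{a}{b}_q=\frac{[a]_q!}{[b]_q![a-b]_q!}$ (zero if $b<0$ or $b>a$). A partition contained in an $n\times k$ rectangle has at most $n$ parts, each at most $k$ (padded with zeros to $n$ parts); $\overline\lambda_i=k-\lambda_{n+1-i}$ is its complement; a prime denotes the conjugate partition; $\|\nu\|=\sum_i(i-1)\nu_i$. A partition $\nu$ is identified with the weight $\sum_i\nu_i\epsilon_i$. In type $D_n$ ($\mathfrak{so}_{2n}$), $\Lambda_n=\frac12(\epsilon_1+\cdots+\epsilon_n)$ and $\Lambda_{n-1}=\frac12(\epsilon_1+\cdots+\epsilon_{n-1}-\epsilon_n)$. $V(\mu)$ is the irreducible representation with highest weight $\mu$. The $q$-dimension is $\dim_q(\mu)=\prod_{\alpha\in\Phi^+}\frac{1-q^{\langle\mu+\rho,\alpha^\vee\rangle}}{1-q^{\langle\rho,\alpha^\vee\rangle}}$, with $\Phi^+$ the positive roots and $\rho$ the sum of the fundamental weights. For type $B_k$ ($\mathfrak{so}_{2k+1}$) the positive coroots are $\epsilon_i\pm\epsilon_j$ ($1\le i<j\le k$) and $2\epsilon_i$, and $\rho=(k-\frac12,k-\frac32,\dots,\frac12)$.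
   Formalization: For n'=n-1 the weight is (λ_1,…,λ_{n-1},-λ_n)+Λ_{n-1} instead of λ+Λ_{n-1}; the two agree when λ_n=0, and for λ_n>0 the literal claim fails (n=k=1, λ=(1): determinant 1, multiplicity 3). *)

(* Defs.v *)
(* MathComp, with mathcomp-real-closed for the Kronecker product [*t]. *)
From HB Require Import structures.
From mathcomp Require Export all_boot all_order all_algebra.
From mathcomp Require Export mxtens.

#[export] Set Implicit Arguments.
#[export] Unset Strict Implicit.
#[export] Unset Printing Implicit Defensive.
Export GRing.Theory Num.Theory.

Local Open Scope ring_scope.

Section QAnalogues.
Variables (F : fieldType) (q : F).

Definition qnum (m : nat) : F := \sum_(i < m) q ^+ i.

Definition qfact (m : nat) : F := \prod_(j < m) qnum j.+1.

Definition qbinom (a : nat) (b : int) : F :=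
  match b with
  | Posz c => if (c <= a)%N then qfact a / (qfact c * qfact (a - c)) else 0
  | Negz _ => 0
  end.

(* Indices are 0-based: the part written lambda_{n-j} with 1-based indices is
   [lam (rev_ord j)]. The sequence is integer-valued because in type D the last
   coordinate of a weight may be negative. *)
Definition MD (k n : nat) (lam : 'I_n -> int) : F :=
  \det (\matrix_(i < n, j < n)
    qbinom (2 * (k + i) + 1)
           (k%:Z + i%:Z - j%:Z - `|lam (rev_ord j)|)).

(* Twice the coordinates of rho, and of mu + rho, in type B_k; doubling makes
   them integers. With 0-based i, rho_i = k - i - 1/2. *)
Definition rhoB2 (k : nat) (i : 'I_k) : nat := (2 * (k - i) - 1)%N.

Definition addrhoB2 (k : nat) (mu : 'I_k -> nat) (i : 'I_k) : nat :=
  (2 * mu i + rhoB2 i)%N.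

(* The product of 1 - q^<w, c> over the positive coroots c = 2 e_i, e_i - e_j,
   e_i + e_j (i < j), where [w2] is twice the weight w. When w is mu + rho for
   a partition mu, [w2] is decreasing with odd entries, so that neither the
   subtraction nor the halving truncates. *)
Definition corootprodB (k : nat) (w2 : 'I_k -> nat) : F :=
  (\prod_(i < k) (1 - q ^+ w2 i)) *
  \prod_(i < k) \prod_(j < k | (i < j)%N)
    ((1 - q ^+ (w2 i - w2 j)./2) * (1 - q ^+ (w2 i + w2 j)./2)).

Definition qdimB (k : nat) (mu : 'I_k -> nat) : F :=
  corootprodB (addrhoB2 mu) / corootprodB (@rhoB2 k).

End QAnalogues.

(* The indeterminate of the field of rational functions Q(q). *)
Definition qvar : {fraction {poly rat}} := tofrac 'X.

Definition is_partition_in (n k : nat) (lam : 'I_n -> nat) : Prop :=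
  (forall i j : 'I_n, (i <= j)%N -> (lam j <= lam i)%N) /\
  (forall i : 'I_n, (lam i <= k)%N).

Definition compl_part (n k : nat) (lam : 'I_n -> nat) (i : 'I_n) : nat :=
  (k - lam (rev_ord i))%N.

(* Meant for partitions with all parts at most k, so that the conjugate has at
   most k parts. *)
Definition conj_part (n k : nat) (nu : 'I_n -> nat) (j : 'I_k) : nat :=
  #|[set i : 'I_n | (j < nu i)%N]|.

Definition part_norm (n : nat) (nu : 'I_n -> nat) : nat :=
  (\sum_(i < n) i * nu i)%N.

(* The diagram automorphism of D_n, which exchanges Lambda_n and Lambda_{n-1}.
   It sends lambda + Lambda_n to (lambda_1, ..., lambda_{n-1}, - lambda_n) +
   Lambda_{n-1}; the absolute value in [MD] makes the determinant invariant
   under this change of sign. *)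
Definition neg_last (V : zmodType) (n : nat) (x : 'I_n -> V) (i : 'I_n) : V :=
  if i.+1 == n then - x i else x i.

Section OrthogonalLieAlgebra.
Variables (C : numClosedFieldType) (n : nat).

(* so_{2n} preserves the split symmetric form e_i <-> e_{n+i}. Its elements are
   the matrices [A, B; D, -A^T] with B and D skew-symmetric. *)
Definition soform : 'M[C]_(n + n) := block_mx 0 1%:M 1%:M 0.

Definition in_so (X : 'M[C]_(n + n)) : Prop :=
  X^T *m soform + soform *m X = 0.

Definition lieb (m : nat) (X Y : 'M[C]_m) : 'M[C]_m := X *m Y - Y *m X.

(* A finite-dimensional representation on column vectors; the values of [ract]
   outside so_{2n} are irrelevant. *)
Record rep := Rep {
  rdim : nat;
  ract : 'M[C]_(n + n) -> 'M[C]_rdim;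
  ract_linear : forall (a : C) (X Y : 'M[C]_(n + n)), in_so X -> in_so Y ->
    ract (a *: X + Y) = a *: ract X + ract Y;
  ract_lieb : forall X Y : 'M[C]_(n + n), in_so X -> in_so Y ->
    ract (lieb X Y) = lieb (ract X) (ract Y)
}.

Lemma rep_triv_linear (a : C) (X Y : 'M[C]_(n + n)) : in_so X -> in_so Y ->
  (0 : 'M[C]_1) = a *: 0 + 0.
Proof. by rewrite scaler0 addr0. Qed.

Lemma rep_triv_lieb (X Y : 'M[C]_(n + n)) : in_so X -> in_so Y ->
  (0 : 'M[C]_1) = lieb 0 0.
Proof. by rewrite /lieb mul0mx subr0. Qed.

Definition rep_triv : rep :=
  @Rep 1 (fun=> 0) rep_triv_linear rep_triv_lieb.

Section SumTensor.
Variables r s : rep.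

Definition sum_act (X : 'M[C]_(n + n)) : 'M[C]_(rdim r + rdim s) :=
  block_mx (ract r X) 0 0 (ract s X).

Lemma sum_act_linear (a : C) (X Y : 'M[C]_(n + n)) : in_so X -> in_so Y ->
  sum_act (a *: X + Y) = a *: sum_act X + sum_act Y.
Proof.
move=> sX sY; rewrite /sum_act !ract_linear //.
by rewrite scale_block_mx add_block_mx !scaler0 !addr0.
Qed.

Lemma sum_act_lieb (X Y : 'M[C]_(n + n)) : in_so X -> in_so Y ->
  sum_act (lieb X Y) = lieb (sum_act X) (sum_act Y).
Proof.
move=> sX sY; rewrite /sum_act !ract_lieb // /lieb !mulmx_block.
rewrite opp_block_mx add_block_mx.
by rewrite !(mul0mx, mulmx0) !(addr0, add0r, oppr0).
Qed.

Definition rep_sum : rep := Rep sum_act_linear sum_act_lieb.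

Definition tens_act (X : 'M[C]_(n + n)) : 'M[C]_(rdim r * rdim s) :=
  ract r X *t 1%:M + 1%:M *t ract s X.

Lemma tens_act_linear (a : C) (X Y : 'M[C]_(n + n)) : in_so X -> in_so Y ->
  tens_act (a *: X + Y) = a *: tens_act X + tens_act Y.
Proof.
move=> sX sY; rewrite /tens_act !ract_linear //.
apply/matrixP => i j; rewrite !mxE.
by rewrite !mulrDl !mulrDr -!mulrA [_ * (a * _)]mulrCA addrACA.
Qed.

Lemma tens_act_lieb (X Y : 'M[C]_(n + n)) : in_so X -> in_so Y ->
  tens_act (lieb X Y) = lieb (tens_act X) (tens_act Y).
Proof.
move=> sX sY; rewrite /tens_act !ract_lieb // /lieb.
rewrite !mulmxDl !mulmxDr !tensmx_mul !(mul1mx, mulmx1).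
have tensBl (P Q : 'M[C]_(rdim r)) : (P - Q) *t (1%:M : 'M[C]_(rdim s)) =
    P *t 1%:M - Q *t 1%:M by apply/matrixP => i j; rewrite !mxE mulrBl.
have tensBr (P Q : 'M[C]_(rdim s)) : (1%:M : 'M[C]_(rdim r)) *t (P - Q) =
    1%:M *t P - 1%:M *t Q by apply/matrixP => i j; rewrite !mxE mulrBr.
have cancelD (V : zmodType) (a b c d P Q : V) :
    a - b + (c - d) = a + P + (Q + c) - (b + Q + (P + d)).
  rewrite (addrACA b) opprD (addrACA (a + P)) !opprD.
  by rewrite (addrACA a P) (addrACA Q c) !subrr addr0 add0r.
by rewrite tensBl tensBr; apply: cancelD.
Qed.

Definition rep_tens : rep := Rep tens_act_linear tens_act_lieb.

End SumTensor.

Fixpoint rep_pow (r : rep) (N : nat) : rep :=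
  if N is N'.+1 then rep_tens r (rep_pow r N') else rep_triv.

Definition submodule (r : rep) (U : {vspace 'cV[C]_(rdim r)}) : Prop :=
  forall X : 'M[C]_(n + n), in_so X ->
  forall v : 'cV[C]_(rdim r), v \in U -> ract r X *m v \in U.

Definition irreducible (r : rep) (U : {vspace 'cV[C]_(rdim r)}) : Prop :=
  [/\ submodule U, U <> 0%VS &
      forall W : {vspace 'cV[C]_(rdim r)},
        submodule W -> (W <= U)%VS -> W = 0%VS \/ W = U].

Definition cartan (h : 'rV[C]_n) : 'M[C]_(n + n) :=
  block_mx (diag_mx h) 0 0 (- diag_mx h).

Definition strictly_upper (A : 'M[C]_n) : Prop :=
  forall i j : 'I_n, (j <= i)%N -> A i j = 0.

(* The weight (mu_1, ..., mu_n) sends [cartan h] to sum_i mu_i h_i. The matrices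
   [A, B; 0, -A^T] below are the sums of root vectors for the positive roots
   e_i - e_j (from A) and e_i + e_j (from B), i < j. *)
Definition is_highest_weight_vector
    (r : rep) (mu : 'rV[C]_n) (v : 'cV[C]_(rdim r)) : Prop :=
  [/\ v != 0,
      forall h : 'rV[C]_n,
        ract r (cartan h) *m v = (\sum_(i < n) mu 0 i * h 0 i) *: v &
      forall A B : 'M[C]_n, strictly_upper A -> B^T = - B ->
        ract r (block_mx A B 0 (- A^T)) *m v = 0].

(* The submodule U of r is (isomorphic to) V(mu). *)
Definition is_irr_hw_sub
    (r : rep) (mu : 'rV[C]_n) (U : {vspace 'cV[C]_(rdim r)}) : Prop :=
  irreducible U /\
  exists2 v : 'cV[C]_(rdim r), v \in U & is_highest_weight_vector mu v.

Definition is_irr_hw (mu : 'rV[C]_n) (r : rep) : Prop :=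
  is_irr_hw_sub mu (fullv : {vspace 'cV[C]_(rdim r)}).

(* r is a direct sum of submodules V(nu_1), ..., V(nu_p), and exactly m of the
   nu_i are equal to mu. *)
Definition has_multiplicity (mu : 'rV[C]_n) (r : rep) (m : nat) : Prop :=
  exists (p : nat) (nu : 'I_p -> 'rV[C]_n)
         (U : 'I_p -> {vspace 'cV[C]_(rdim r)}),
    [/\ forall i : 'I_p, is_irr_hw_sub (nu i) (U i),
        directv (\sum_(i < p) U i)%VS,
        (\sum_(i < p) U i)%VS = fullv &
        #|[set i : 'I_p | nu i == mu]| = m].

Definition weight_of (x : 'I_n -> int) : 'rV[C]_n := \row_i (x i)%:~R.

(* The fundamental weights Lambda_n and Lambda_{n-1}. *)
Definition Lambda_last : 'rV[C]_n := const_mx (2%:R^-1).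

Definition Lambda_prev : 'rV[C]_n := \row_i neg_last (fun=> 2%:R^-1) i.

End OrthogonalLieAlgebra.

(* Main.v *)
(** The q-identity: with m_j = lambda_{n-j} + j, the (i, j) entry of the
    determinant is, up to a factor depending on i and one depending on j, a
    polynomial of degree < n (depending on i only) evaluated at
    q^-m_j + q^(m_j+1). Hence the determinant is a Vandermonde product times a
    constant independent of lambda, which is read off from lambda = k^n. The
    numbers m_j and the shifted parts of the conjugate of the complement are
    complementary subsets of {0, ..., n+k-1}, and passing to complements turns
    the Vandermonde product into the q-dimension.

    The multiplicity: V is isomorphic to the unitary spin representation on the
    fermionic Fock space. A unitary representation decomposes by taking
    orthogonal complements, so the multiplicity of V(mu) is the dimension of
    the space of highest weight vectors of weight mu. Let D be the Weyl
    denominator, Omega the Casimir operator, and chi(Y) the sum of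
    Y_xx X^(weight of x) over the basis vectors x. For Y commuting with the
    action, D chi(Omega Y) = (Laplacian - |rho|^2) (D chi(Y)),
    so only the eigenspace of Omega for the value it takes on V(mu) contributes
    to the coefficient of X^(mu+rho) in D chi(1). By unitarity this eigenspace
    has no weight beta with |beta+rho| > |mu+rho|, and its vectors of weight mu
    are highest weight vectors. The coefficient is therefore the multiplicity;
    for chi(1) = prod (1 + X_i)^(2k+1), up to a monomial, it is a determinant
    of binomial coefficients because D = det((1 + X_i)^(2(n-1-j)) X_i^j). *)

From HB Require Import structures.
Require Import Defs.
From mathcomp Require Import zify ring.
From mathcomp Require Import perm mpoly.
From Stdlib Require Import Classical.
Local Open Scope ring_scope.

(** The half-spin modules of the theorem are arbitrary irreducible modules, given without a
    Hermitian form; only the Fock model has one. Hence the intertwiner into the model is built with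
    the grading by height on the given side and orthogonality on the Fock side.

    The trace identity replaces the Weyl character formula and the Weyl group. For a positive root
    alpha with root vectors E and F, cyclicity of the trace relates chi(EFY) to chi(FEY) by a factor
    e^alpha, while EF - FE lies in the Cartan subalgebra. Multiplied by the factor of D for alpha,
    chi((EF + FE)Y) becomes a first-order derivative of chi(Y), and these derivatives add up to the
    cross term in the Laplacian of D chi(Y). The rest matches since D is an eigenvector of the
    Laplacian.

    Two determinants for D are used: x + 1/x and x + 2 + 1/x have the same differences; the first
    makes the Laplacian computable, the second absorbs powers of 1 + x.

    The two highest weights of the theorem differ by the sign of the last coordinate, which replaces
    the binomial coefficients in one row of the determinant by their mirror images. *)

Lemma det_scale_rows_cols (R : comNzRingType) (n : nat) (a b : 'I_n -> R) (M : 'M[R]_n) :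
  \det (\matrix_(i, j) (a i * M i j * b j)) =
  (\prod_i a i) * \det M * \prod_j b j.
Proof.
have -> : \matrix_(i, j) (a i * M i j * b j) =
    diag_mx (\row_i a i) *m M *m diag_mx (\row_j b j).
  by apply/matrixP => i j; rewrite mul_mx_diag mul_diag_mx !mxE.
rewrite !det_mulmx !det_diag; congr (_ * _ * _); apply: eq_bigr => i _; exact: mxE.
Qed.

(** * The q-identity *)

Section QIdentity.
Variables (F : fieldType) (q : F).
Hypotheses (q0 : q != 0) (qX : forall m, q ^+ m.+1 != 1).

Definition qpoch (m : nat) : F := \prod_(j < m) (1 - q ^+ j.+1).

Lemma qX0 m : 1 - q ^+ m.+1 != 0.
Proof. by rewrite subr_eq0 eq_sym. Qed.

Lemma qpoch0 m : qpoch m != 0.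
Proof. by apply/prodf_neq0 => j _; apply: qX0. Qed.

Lemma qpochD a b : qpoch (a + b) = qpoch a * \prod_(j < b) (1 - q ^+ (a + j).+1).
Proof. by rewrite /qpoch big_split_ord. Qed.

Lemma qfactE m : qfact q m * (1 - q) ^+ m = qpoch m.
Proof.
have -> : (1 - q) ^+ m = \prod_(j < m) (1 - q) by rewrite prodr_const card_ord.
rewrite /qfact /qpoch -big_split /=.
apply: eq_bigr => j _; rewrite /qnum mulrC.
by rewrite -(opprB q) mulNr -subrX1 opprB.
Qed.

Lemma qbinomE a c : (c <= a)%N ->
  qbinom q a c%:Z = qpoch a / (qpoch c * qpoch (a - c)).
Proof.
move=> ca; rewrite /qbinom ca -!qfactE.
have q1 : 1 - q != 0 by have := qX0 0; rewrite expr1.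
rewrite [(1 - q) ^+ a](_ : _ = (1 - q) ^+ c * (1 - q) ^+ (a - c)); last first.
  by rewrite -exprD subnKC.
by rewrite [in RHS]mulrACA -mulf_div divff ?mulr1 // mulf_neq0 // expf_neq0.
Qed.

(* qpoint x - qpoint y factors as q^-x times the symmetric expression [qgap x y]. *)
Definition qpoint (m : nat) : F := q ^- m + q ^+ m.+1.

Definition qgap (x y : nat) : F :=
  (1 - q ^+ (x - y + (y - x))) * (1 - q ^+ (x + y).+1).

Lemma qgapC x y : qgap x y = qgap y x.
Proof. by rewrite /qgap addnC [(x + y)%N]addnC. Qed.

Lemma qgap0 x y : x != y -> qgap x y != 0.
Proof.
move=> xy; rewrite mulf_neq0 ?qX0 //.
by case E: (x - y + (y - x))%N => [|m]; [lia | exact: qX0].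
Qed.

Lemma qpointB x y : (y < x)%N -> qpoint x - qpoint y = q ^- x * qgap x y.
Proof.
move=> yx; have [d ->] : exists d, x = (y + d)%N by exists (x - y)%N; lia.
rewrite /qgap /qpoint addKn (_ : y - (y + d) = 0)%N; last by lia.
rewrite addn0 !exprS !exprD; field.
by rewrite !expf_neq0.
Qed.

(** These are the factors by which [qpoch (k + n - m.+1)] and [qpoch (k + n + m)] exceed the two
    denominators of the q-binomial entry, paired so that each pair is linear in [qpoint m].
    Extending the entry by them makes its denominator independent of i. *)
Definition qdet_poly (k n i : nat) : {poly F} :=
  \prod_(j < n.-1 - i)
     ((1 + q ^+ (2 * (k + i + j).+1).+1)%:P - q ^+ (k + i + j).+1 *: 'X).

Lemma size_qdet_poly k n i : (i < n)%N -> (size (qdet_poly k n i) <= n)%N.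
Proof.
move=> lt_in; rewrite /qdet_poly.
have lin (a b : F) : (size (a%:P - b *: 'X)%R <= 2)%N.
  rewrite (leq_trans (size_polyD _ _)) // geq_max size_polyN.
  rewrite (leq_trans (size_polyC_leq1 _)) //=.
  by rewrite (leq_trans (size_scale_leq _ _)) // size_polyX.
suff H b : (size (\prod_(j < b)
     ((1 + q ^+ (2 * (k + i + j).+1).+1)%:P - q ^+ (k + i + j).+1 *: 'X)%R)%R <= b.+1)%N.
  by apply: leq_trans (H _) _; lia.
elim: b => [|b IH]; first by rewrite big_ord0 size_poly1.
rewrite big_ord_recr /= (leq_trans (size_polyMleq _ _)) //.
rewrite -subn1 leq_subLR add1n -(addn2 b.+1).
exact: leq_add IH (lin _ _).
Qed.

Lemma horner_qdet_poly k n i m : (i < n)%N -> (m < k + n)%N ->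
  qbinom q (2 * (k + i) + 1) ((k + i)%:Z - m%:Z) =
  qpoch (2 * (k + i) + 1) * (qdet_poly k n i).[qpoint m] *
    (qpoch (k + n - m.+1) * qpoch (k + n + m))^-1.
Proof.
move=> lt_in lt_m; rewrite /qdet_poly horner_prod.
have fac j : (((1 + q ^+ (2 * (k + i + j).+1).+1)%:P -
      q ^+ (k + i + j).+1 *: 'X).[qpoint m] =
    (1 - q ^+ (k + i + j).+1 / q ^+ m) * (1 - q ^+ (k + i + j + m).+2)).
  rewrite !(hornerE) /qpoint [in LHS](_ : (2 * _).+1 = ((k + i + j).+1 + (k + i + j + m).+2 - m)%N);
    last by lia.
  rewrite expfB; last by lia.
  rewrite [in LHS]exprD [q ^+ (_ + m).+2](_ : _ = q ^+ (k+i+j).+1 * q ^+ m.+1); last first.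
    by rewrite -exprD; congr (_ ^+ _); lia.
  by rewrite [q ^+ m.+1]exprS; field; rewrite expf_neq0.
(* For m > k + i the entry is 0 by convention, and the polynomial vanishes through its factor with j
   = m - (k + i) - 1. *)
have [le_m|gt_m] := leqP m (k + i); last first.
  rewrite (_ : (k + i)%:Z - m%:Z = Negz (m - (k + i)).-1); last by lia.
  rewrite /=.
  have lt_j : ((m - (k + i)).-1 < n.-1 - i)%N by lia.
  rewrite (bigD1 (Ordinal lt_j)) //= fac [X in 1 - X](_ : _ = 1) ?subrr ?mul0r ?mulr0 ?mul0r //.
  by rewrite (_ : (k + i + _).+1 = m); [rewrite divff ?expf_neq0 | lia].
rewrite (_ : (k + i)%:Z - m%:Z = (k + i - m)%N%:Z); last by lia.
rewrite qbinomE; last by lia.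
rewrite -mulrA; congr (_ * _).
have -> : (k + n - m.+1 = (k + i - m) + (n.-1 - i))%N by lia.
have -> : (k + n + m = (2 * (k + i) + 1 - (k + i - m)) + (n.-1 - i))%N by lia.
rewrite !qpochD.
rewrite mulrACA -[in RHS]big_split /=.
set P1 := \prod_(_ < _) _; set P2 := \prod_(_ < _) _.
have -> : P1 = P2.
  apply: eq_bigr => j _; rewrite fac; congr (_ * _); last first.
    by congr (1 - q ^+ _); lia.
  rewrite -expfB; last by lia.
  by congr (1 - q ^+ _); lia.
rewrite [in RHS]invfM mulrCA divff ?mulr1 //.
by apply/prodf_neq0 => j _; rewrite mulf_neq0 ?qX0.
Qed.

(** Evaluation is the coefficient matrix times a Vandermonde matrix, so only the latter depends on
    the points. *)
Lemma det_horner (n : nat) (p : 'I_n -> {poly F}) (y : 'I_n -> F) :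
  (forall i, size (p i) <= n)%N ->
  \det (\matrix_(i, j) (p i).[y j]) =
  \det (\matrix_(i < n, l < n) (p i)`_l) *
    \prod_(i < n) \prod_(j < n | (i < j)%N) (y j - y i).
Proof.
move=> szp.
have -> : \matrix_(i, j) (p i).[y j] =
    (\matrix_(i, l) (p i)`_l) *m Vandermonde n (\row_j y j).
  apply/matrixP => i j; rewrite !mxE (horner_coef_wide _ (szp i)).
  by apply: eq_bigr => l _; rewrite !mxE.
rewrite det_mulmx det_Vandermonde; congr (_ * _).
by apply: eq_bigr => i _; apply: eq_bigr => j _; rewrite !mxE.
Qed.

Definition shifted_part (n : nat) (lam : 'I_n -> nat) (j : 'I_n) : nat :=
  (lam (rev_ord j) + j)%N.

Definition MD_const (k n : nat) : F :=
  (\prod_(i < n) qpoch (2 * (k + i) + 1)) *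
  \det (\matrix_(i < n, l < n) (qdet_poly k n i)`_l).

Lemma shifted_part_lt k n (lam : 'I_n -> nat) j :
  is_partition_in k lam -> (shifted_part lam j < k + n)%N.
Proof.
by move=> [_ /(_ (rev_ord j)) H]; rewrite /shifted_part; have := ltn_ord j; lia.
Qed.

Lemma MD_vandermonde k n (lam : 'I_n -> nat) : is_partition_in k lam ->
  MD q k (fun i => (lam i)%:Z) =
  MD_const k n *
  (\prod_(i < n) \prod_(j < n | (i < j)%N)
     (qpoint (shifted_part lam j) - qpoint (shifted_part lam i))) *
  \prod_(j < n) (qpoch (k + n - (shifted_part lam j).+1) *
                 qpoch (k + n + shifted_part lam j))^-1.
Proof.
move=> lamP; rewrite /MD_const -[\prod_(i < n) qpoch _ * _ * _]mulrA -det_horner; last first.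
  by move=> i; apply: size_qdet_poly.
rewrite -det_scale_rows_cols; congr (\det _); apply/matrixP => i j; rewrite !mxE.
rewrite -horner_qdet_poly ?shifted_part_lt //; congr (qbinom _ _ _).
by rewrite /shifted_part; lia.
Qed.

(** The matrix is lower triangular with unit diagonal. This one evaluation fixes the constant that
    is independent of lambda. *)
Lemma MD_full k n : MD q k (fun _ : 'I_n => k%:Z) = 1.
Proof.
rewrite /MD det_trig ?big1 // => [i _|].
  rewrite mxE (_ : _ - _ = 0%N%:Z); last by lia.
  have q00 : qpoch 0 = 1 by rewrite /qpoch big_ord0.
  by rewrite qbinomE // q00 mul1r subn0 divff ?qpoch0.
apply/is_trig_mxP => i j ij; rewrite mxE.
by rewrite (_ : _ - _ = Negz (j - i).-1); last lia.
Qed.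

Section Complement.
Variable K : nat.
Implicit Types A : {set 'I_K}.

Definition qpairs A : F :=
  \prod_(x in A) \prod_(y in A | (y < x)%N) qgap x y.

Definition qcross A : F := \prod_(x in A) \prod_(y in ~: A) qgap x y.

Lemma qpairsT A : qpairs setT = qpairs A * qcross A * qpairs (~: A).
Proof.
rewrite /qpairs (eq_bigl (fun x : 'I_K => true)) => [|x]; last by rewrite inE.
rewrite (bigID (mem A)) /=.
have spl (x : 'I_K) : \prod_(y in [set: 'I_K] | (y < x)%N) qgap x y =
   (\prod_(y in A | (y < x)%N) qgap x y) *
   \prod_(y in ~: A | (y < x)%N) qgap x y.
  rewrite (bigID (mem A)) /=; congr (_ * _); apply: eq_bigl => y;
    by rewrite !inE // andbC.
rewrite (eq_bigr _ (fun x _ => spl x)) [X in _ * X](eq_bigr _ (fun x _ => spl x)).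
rewrite !big_split /= -!mulrA; congr (_ * _).
rewrite [X in _ * (_ * X)](eq_bigl (mem (~: A))) => [|x]; last by rewrite !inE.
rewrite mulrA; congr (_ * _).
rewrite [X in _ * X](eq_bigl (mem (~: A))) => [|x]; last by rewrite !inE.
rewrite [X in _ * X](exchange_big_dep (mem A)) /=; last by move=> x y _ /andP[].
rewrite -big_split /=; apply: eq_bigr => x xA.
rewrite [RHS](bigID (fun y : 'I_K => y < x)%N) /=; congr (_ * _).
apply: eq_big => [y|y _]; last exact: qgapC.
by rewrite !inE xA; case: ltngtP => /= e; rewrite ?andbT ?andbF // -(val_inj e) xA.
Qed.

(** A pair inside A is met from both of its ends, a pair with one element outside A only once. *)
Lemma prod_qgap_others A :
  \prod_(x in A) \prod_(y < K | y != x) qgap x y = qpairs A ^+ 2 * qcross A.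
Proof.
have spl (x : 'I_K) : x \in A -> \prod_(y < K | y != x) qgap x y =
   (\prod_(y in A | (y < x)%N) qgap x y) *
   (\prod_(y in A | (x < y)%N) qgap x y) *
   \prod_(y in ~: A) qgap x y.
  move=> xA; rewrite (bigID (mem A)) /= (bigID (fun y : 'I_K => y < x)%N) /=.
  congr (_ * _ * _); apply: eq_bigl => y; rewrite ?inE.
  - by case: eqVneq => [->|]; rewrite ?ltnn ?andbF.
  - by rewrite -val_eqE /=; case: ltngtP => //=; rewrite ?andbF.
  - by case: eqVneq => [->|]; rewrite ?xA.
rewrite (eq_bigr _ spl) !big_split /= expr2; congr (_ * _ * _).
rewrite /qpairs [RHS](exchange_big_dep (mem A)) /=; last by move=> x y _ /andP[].
apply: eq_bigr => x xA.
by apply: eq_big => [y|y _]; [rewrite xA | apply: qgapC].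
Qed.

(** For y other than x the distances run through 1, ..., x and 1, ..., K - 1 - x. The sums x + y + 1
    run through x + 1, ..., x + K, except for the one with y = x, which is the extra factor on the
    right. *)
Lemma prod_qgap_row (x : 'I_K) :
  qpoch (K - x.+1) * qpoch (K + x) =
  (1 - q ^+ (2 * x).+1) * \prod_(y < K | y != x) qgap x y.
Proof.
case: x => x /= xK; have [d dK] : exists d, K = (x + d.+1)%N by exists (K - x.+1)%N; lia.
have dE : (K - x.+1 = d)%N by lia.
rewrite /qgap big_split /=.
have e1 : \prod_(y < K | y != Ordinal xK) (1 - q ^+ (x - y + (y - x))) =
    qpoch x * qpoch d.
  rewrite (big_mkcond (fun y : 'I_K => _)) /= /qpoch.
  rewrite (_ : \prod_(y < K) _ = \prod_(y < K)
    (if (y : nat) != x then 1 - q ^+ (x - y + (y - x)) else 1)) //.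
  rewrite -(big_mkord xpredT (fun y => if y != x then 1 - q ^+ (x - y + (y - x)) else 1)).
  rewrite dK (@big_cat_nat _ _ _ x) /=; [|lia|lia].
  congr (_ * _).
    rewrite big_nat_rev -(big_mkord xpredT (fun y => 1 - q ^+ y.+1)) /=.
    apply: eq_big_nat => y yx; rewrite ifT; last lia.
    by congr (1 - q ^+ _); lia.
  rewrite big_ltn ?eqxx ?mul1r; last lia.
  rewrite -[X in \prod_(X <= _ < _) _]add0n big_addn (_ : x + d.+1 - x.+1 = d)%N; last lia.
  rewrite -(big_mkord xpredT (fun y => 1 - q ^+ y.+1)) /=.
  apply: eq_big_nat => y yx; rewrite ifT; last lia.
  by congr (1 - q ^+ _); lia.
rewrite e1 dE (addnC K) qpochD (bigD1 (Ordinal xK)) //= mul2n -addnn.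
ring.
Qed.

(** The rows of A multiply to [qpairs A ^+ 2 * qcross A], all pairs to
    [qpairs A * qcross A * qpairs (~: A)]. In the quotient only pairs of the complement remain. *)
Lemma qpairs_complement A :
  qpairs A * \prod_(x in A) (qpoch (K - x.+1) * qpoch (K + x))^-1 =
  (qpairs setT * \prod_(x < K) (1 - q ^+ (2 * x).+1))^-1 *
  (qpairs (~: A) * \prod_(x in ~: A) (1 - q ^+ (2 * x).+1)).
Proof.
have qpairs0 B : qpairs B != 0.
  apply/prodf_neq0 => x _; apply/prodf_neq0 => y /andP[_ yx].
  by rewrite qgap0 // neq_ltn yx orbT.
have odd0 (P : pred 'I_K) : \prod_(x < K | P x) (1 - q ^+ (2 * x).+1) != 0.
  by apply/prodf_neq0 => x _; apply: qX0.
have cross0 : qcross A != 0.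
  apply/prodf_neq0 => x xA; apply/prodf_neq0 => y; rewrite inE => yA.
  by rewrite qgap0 //; apply: contraNneq yA => /val_inj <-.
rewrite prodfV (eq_bigr _ (fun x _ => prod_qgap_row x)) big_split /=.
rewrite prod_qgap_others (qpairsT A) [in RHS](bigID (mem A)) /=.
have -> : \prod_(x in ~: A) (1 - q ^+ (2 * x).+1) =
    \prod_(x < K | x \notin A) (1 - q ^+ (2 * x).+1).
  by apply: eq_bigl => x; rewrite inE.
by field; rewrite !odd0 !qpairs0 cross0.
Qed.

End Complement.

Section BetaSets.
Variables (k n : nat) (lam : 'I_n -> nat).
Hypothesis lamP : is_partition_in k lam.

Let nu := compl_part k lam.

Definition conj_shifted (j : 'I_k) : nat := (conj_part (k := k) nu j + (k - j.+1))%N.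

Lemma compl_part_le i : (nu i <= k)%N.
Proof. exact: leq_subr. Qed.

Lemma compl_part_mono (i j : 'I_n) : (i <= j)%N -> (nu j <= nu i)%N.
Proof.
move=> ij; rewrite /nu /compl_part leq_sub2l //; case: lamP => mono _; apply: mono.
by rewrite /= leq_sub2l.
Qed.

Lemma shifted_partE j : shifted_part lam j = (k - nu j + j)%N.
Proof.
rewrite /shifted_part /nu /compl_part subKn //; by case: lamP.
Qed.

(** The rows of [nu] longer than j form an initial segment, because [nu] is decreasing. *)
Lemma ltn_conj_part (i : 'I_n) (j : 'I_k) :
  (i < conj_part (k := k) nu j)%N = (j < nu i)%N.
Proof.
rewrite /conj_part; set S := [set _ | _].
apply/idP/idP => [|ji].
  apply: contraLR; rewrite -!leqNgt => ij.
  have sub : S \subset [set x : 'I_n | (x < i)%N].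
    apply/subsetP => x; rewrite !inE => jx; rewrite ltnNge.
    by apply: contraTN jx => /compl_part_mono; rewrite -leqNgt; move/leq_trans; apply.
  rewrite (leq_trans (subset_leq_card sub)) // -sum1dep_card.
  rewrite -(big_ord_widen n (fun=> 1%N)) ?sum1_card ?card_ord //; exact/ltnW/ltn_ord.
have sub : [set x : 'I_n | (x < i.+1)%N] \subset S.
  by apply/subsetP => x; rewrite !inE ltnS => /compl_part_mono; exact: leq_trans.
rewrite (leq_trans _ (subset_leq_card sub)) // -sum1dep_card.
by rewrite -(big_ord_widen n (fun=> 1%N)) ?sum1_card ?card_ord.
Qed.

Lemma conj_part_mono (i j : 'I_k) : (i <= j)%N ->
  (conj_part (k := k) nu j <= conj_part (k := k) nu i)%N.
Proof.
move=> ij; apply: subset_leq_card; apply/subsetP => x; rewrite !inE.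
exact: leq_ltn_trans.
Qed.

Lemma conj_part_le (j : 'I_k) : (conj_part (k := k) nu j <= n)%N.
Proof. by rewrite -[n in (_ <= n)%N]card_ord max_card. Qed.

Lemma conj_shifted_lt (j : 'I_k) : (conj_shifted j < k + n)%N.
Proof. by rewrite /conj_shifted; have := conj_part_le j; have := ltn_ord j; lia. Qed.

Lemma ltn_conj_shifted (i j : 'I_k) : (i < j)%N -> (conj_shifted j < conj_shifted i)%N.
Proof.
move=> ij; rewrite /conj_shifted; have := conj_part_mono (ltnW ij).
by have := ltn_ord j; lia.
Qed.

Lemma ltn_shifted_part (i j : 'I_n) : (i < j)%N -> (shifted_part lam i < shifted_part lam j)%N.
Proof.
move=> ij; rewrite !shifted_partE; have := compl_part_mono (ltnW ij); lia.
Qed.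

Definition beta (j : 'I_n) : 'I_(k + n) := Ordinal (shifted_part_lt j lamP).
Definition cobeta (j : 'I_k) : 'I_(k + n) := Ordinal (conj_shifted_lt j).

Lemma beta_inj : injective beta.
Proof.
move=> i j eij; have e : shifted_part lam i = shifted_part lam j := congr1 (@nat_of_ord _) eij.
apply: ord_inj; case: (ltngtP i j) => // /ltn_shifted_part; by rewrite e ltnn.
Qed.

Lemma cobeta_inj : injective cobeta.
Proof.
move=> i j eij; have e : conj_shifted i = conj_shifted j := congr1 (@nat_of_ord _) eij.
apply: ord_inj; case: (ltngtP i j) => // /ltn_conj_shifted; by rewrite e ltnn.
Qed.

(** The cardinalities n and k add up to the size of the ambient set, so disjointness suffices. If
    the box (i, j) lies in the diagram of [nu], then [conj_shifted j] exceeds [shifted_part lam i];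
    otherwise it is smaller. *)
Lemma beta_complement : ~: (beta @: 'I_n) = cobeta @: 'I_k.
Proof.
apply/esym/eqP; rewrite eqEcard cardsCs setCK !card_imset ?card_ord; [|exact: cobeta_inj|exact: beta_inj].
rewrite addnK leqnn andbT; apply/subsetP => _ /imsetP[j _ ->]; rewrite inE.
apply/imsetP => -[i _ /(congr1 (@nat_of_ord _)) /=]; rewrite shifted_partE /conj_shifted.
have := ltn_conj_part i j; have := compl_part_le i; have := ltn_ord j.
by have [] := leqP (nu i) j; lia.
Qed.

(** Each difference contributes the inverse power of q for its larger point, and point j is the
    larger one in j pairs. This point is k + j minus the part of [nu], hence a constant and the
    factor [q ^+ part_norm nu]. *)
Lemma qpairs_beta :
  \prod_(i < n) \prod_(j < n | (i < j)%N)
     (qpoint (shifted_part lam j) - qpoint (shifted_part lam i)) =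
  (\prod_(j < n) q ^- (k + j) ^+ j) * q ^+ part_norm nu * qpairs (beta @: 'I_n).
Proof.
rewrite (exchange_big_dep xpredT) //= /qpairs big_imset /=; last by move=> *; exact: beta_inj.
have -> : q ^+ part_norm nu = \prod_(j < n) (q ^+ nu j) ^+ j.
  by rewrite /part_norm -prodrXr; apply: eq_bigr => j _; rewrite -exprM mulnC.
rewrite -!big_split /=; apply: eq_bigr => j _.
rewrite (eq_bigr (fun i : 'I_n => q ^- shifted_part lam j *
     qgap (shifted_part lam j) (shifted_part lam i))) => [|i ij]; last first.
  exact/qpointB/ltn_shifted_part.
rewrite big_split /=; congr (_ * _).
  have -> (c : F) : \prod_(i < n | (i < j)%N) c = c ^+ j.
    by rewrite -(big_ord_widen n (fun=> c)) ?prodr_const ?card_ord // ltnW.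
  rewrite -exprMn; congr (_ ^+ _); rewrite shifted_partE.
  rewrite (_ : k - nu j + j = k + j - nu j)%N; last by have := compl_part_le j; lia.
  rewrite expfB_cond ?(negPf q0) ?mul0n ?add0n; last first.
    exact: leq_trans (compl_part_le j) (leq_addr _ _).
  by rewrite invf_div mulrC.
rewrite big_imset_cond /=; last by move=> *; exact: beta_inj.
apply: eq_big => [i|//]; apply/idP/idP => [/ltn_shifted_part //|].
by rewrite !ltnNge; apply: contra; rewrite leq_eqVlt => /predU1P[/val_inj ->//|/ltn_shifted_part/ltnW].
Qed.

(** [2 * conj_shifted i + 1] is twice a coordinate of mu + rho. So the gaps are the factors of the
    coroots e_i - e_j and e_i + e_j, and the remaining odd powers belong to 2 e_i. *)
Lemma qpairs_cobeta :
  qpairs (cobeta @: 'I_k) * \prod_(x in cobeta @: 'I_k) (1 - q ^+ (2 * x).+1) =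
  corootprodB q (addrhoB2 (conj_part (k := k) nu)).
Proof.
have w2E (i : 'I_k) : addrhoB2 (conj_part (k := k) nu) i = (2 * conj_shifted i).+1.
  by rewrite /addrhoB2 /rhoB2 /conj_shifted; have := ltn_ord i; lia.
rewrite mulrC /corootprodB /qpairs; congr (_ * _).
  by rewrite big_imset /=; [apply: eq_bigr => i _; rewrite w2E | move=> *; exact: cobeta_inj].
rewrite big_imset /=; last by move=> *; exact: cobeta_inj.
apply: eq_bigr => i _; rewrite big_imset_cond /=; last by move=> *; exact: cobeta_inj.
apply: eq_big => [j|j].
  apply/idP/idP => [|/ltn_conj_shifted //].
  by rewrite !ltnNge; apply: contra; rewrite leq_eqVlt => /predU1P[/val_inj ->//|/ltn_conj_shifted/ltnW].
move=> ji; rewrite !w2E /qgap; congr ((1 - q ^+ _) * (1 - q ^+ _)); lia.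
Qed.

End BetaSets.

Definition MD_corootprodB_const (k n : nat) : F :=
  MD_const k n * (\prod_(j < n) q ^- (k + j) ^+ j) *
  (qpairs [set: 'I_(k + n)] * \prod_(x < k + n) (1 - q ^+ (2 * x).+1))^-1.

Lemma MD_corootprodB k n (lam : 'I_n -> nat) : is_partition_in k lam ->
  let nu := compl_part k lam in
  MD q k (fun i => (lam i)%:Z) =
  MD_corootprodB_const k n * q ^+ part_norm nu *
  corootprodB q (addrhoB2 (conj_part (k := k) nu)).
Proof.
move=> lamP nu; rewrite MD_vandermonde // (qpairs_beta lamP) -qpairs_cobeta.
have := qpairs_complement (beta lamP @: 'I_n).
rewrite (beta_complement lamP) (big_imset _ (in2W (@beta_inj _ _ _ lamP))) /=.
move=> E; rewrite /MD_corootprodB_const -!mulrA [X in _ * (_ * (_ * X))]mulrA [in LHS]mulrA.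
rewrite -!mulrA E.
by ring.
Qed.

Theorem MD_qdimB k n (lam : 'I_n -> nat) : is_partition_in k lam ->
  let nu := compl_part k lam in
  MD q k (fun i => (lam i)%:Z) =
  q ^+ part_norm nu * qdimB q (conj_part (k := k) nu).
Proof.
move=> lamP nu; rewrite (MD_corootprodB lamP) /qdimB.
have fullP : is_partition_in k (fun _ : 'I_n => k) by [].
(* For lambda = k^n the complement is empty, its conjugate is the weight 0 and the determinant is 1,
   so the constant is the inverse of the product over rho. *)
have := MD_corootprodB fullP; rewrite MD_full; cbv zeta.
set mu0 := conj_part _.
have nu0 : compl_part k (fun _ : 'I_n => k) =1 fun=> 0%N.
  by move=> i; rewrite /compl_part subnn.
have -> : part_norm (compl_part k (fun _ : 'I_n => k)) = 0%N.
  by rewrite /part_norm big1 // => i _; rewrite nu0 muln0.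
have -> : corootprodB q (addrhoB2 mu0) = corootprodB q (@rhoB2 k).
  have E i : addrhoB2 mu0 i = rhoB2 i.
    rewrite /addrhoB2 /mu0 /conj_part (_ : #|_| = 0%N) //.
    by apply/eqP; rewrite cards_eq0; apply/eqP/setP => x; rewrite !inE nu0.
  rewrite /corootprodB; congr (_ * _); apply: eq_bigr => i _; rewrite ?E //.
  by apply: eq_bigr => j _; rewrite !E.
rewrite mulr1 => e.
(* The same evaluation shows that the denominator of the q-dimension is nonzero: a multiple of it
   equals 1. *)
have c0 : corootprodB q (@rhoB2 k) != 0.
  by apply: contra_eq_neq e => ->; rewrite mulr0 oner_eq0.
rewrite -/nu.
rewrite mulrA; apply: (canRL (mulfK c0)); rewrite -[RHS]mulr1 e; ring.
Qed.

End QIdentity.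

Lemma qvar_neq0 : qvar != 0.
Proof. by rewrite /qvar tofrac_eq0 polyX_eq0. Qed.

Lemma qvarX_neq1 m : qvar ^+ m.+1 != 1.
Proof.
rewrite /qvar -tofracXn -tofrac1 tofrac_eq -subr_eq0; apply/eqP => e.
have := size_XnsubC (1 : rat) (ltn0Sn m).
by rewrite polyC1 e size_poly0.
Qed.

(** * Unitary representations of so_2n *)

Section SkewBasis.
Variables (C : numClosedFieldType) (n : nat).
Implicit Types (p q s t : 'I_(n + n)) (X Y : 'M[C]_(n + n)).

Definition dual p : 'I_(n + n) :=
  match split p with inl i => rshift n i | inr i => lshift n i end.

Lemma dual_lshift i : dual (lshift n i) = rshift n i.
Proof. by rewrite /dual (unsplitK (inl _ i)). Qed.

Lemma dual_rshift i : dual (rshift n i) = lshift n i.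
Proof. by rewrite /dual (unsplitK (inr _ i)). Qed.

Lemma dualK : involutive dual.
Proof.
by move=> p; case: (split_ordP p) => i ->; rewrite ?dual_lshift ?dual_rshift ?dual_lshift.
Qed.

Lemma dual_eq p q : (dual p == q) = (p == dual q).
Proof. by rewrite (can2_eq dualK dualK). Qed.

Lemma eq_dualC p q : (p == dual q) = (q == dual p).
Proof. by rewrite -dual_eq eq_sym. Qed.

Lemma soformE p q : soform C n p q = (q == dual p)%:R.
Proof.
rewrite /soform; case: (split_ordP p) => i ->; case: (split_ordP q) => j ->;
  rewrite ?dual_lshift ?dual_rshift ?block_mxEul ?block_mxEur ?block_mxEdl ?block_mxEdr
    mxE ?eq_lrshift ?eq_rlshift ?eq_lshift ?eq_rshift //; by rewrite eq_sym.
Qed.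

Lemma in_soP X : in_so X <-> forall p q, X p q = - X (dual q) (dual p).
Proof.
have E p q : (X^T *m soform C n + soform C n *m X) p q = X (dual q) p + X (dual p) q.
  rewrite mxE; congr (_ + _); rewrite mxE.
    rewrite (bigD1 (dual q)) //= big1 ?addr0 => [|a aq].
      by rewrite soformE dualK eqxx mulr1 mxE.
    by rewrite soformE -dual_eq eq_sym (negPf aq) mulr0.
  rewrite (bigD1 (dual p)) //= big1 ?addr0 => [|a ap].
    by rewrite soformE eqxx mul1r.
  by rewrite soformE (negPf ap) mul0r.
split=> [eX p q|eX].
  have := congr1 (fun M : 'M_(n + n) => M (dual p) q) eX.
  by rewrite E mxE dualK addrC => /eqP; rewrite addr_eq0 => /eqP.
apply/matrixP => p q; rewrite E [X (dual q) p]eX dualK mxE addNr //.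
Qed.

Lemma in_so0 : in_so (0 : 'M[C]_(n + n)).
Proof. by apply/in_soP => p q; rewrite !mxE oppr0. Qed.

Lemma in_soZD a X Y : in_so X -> in_so Y -> in_so (a *: X + Y).
Proof.
move=> /in_soP eX /in_soP eY; apply/in_soP => p q.
by rewrite !mxE eX eY mulrN opprD.
Qed.

Lemma in_soZ a X : in_so X -> in_so (a *: X).
Proof. by move=> sX; rewrite -[_ *: _]addr0; apply: in_soZD => //; apply: in_so0. Qed.

Lemma in_soD X Y : in_so X -> in_so Y -> in_so (X + Y).
Proof. by move=> sX sY; rewrite -[X]scale1r; apply: in_soZD. Qed.

Lemma in_so_sum (I : finType) (P : pred I) (c : I -> C) (f : I -> 'M[C]_(n + n)) :
  (forall i, in_so (f i)) -> in_so (\sum_(i | P i) c i *: f i).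
Proof.
move=> sf; elim/big_ind: _ => [|*|i _]; [exact: in_so0 | exact: in_soD | exact: in_soZ].
Qed.

(* Up to sign, the root vectors (q <> dual p) and the Cartan elements (q = dual p) of so_{2n}. *)
Definition Fso p q : 'M[C]_(n + n) := delta_mx p (dual q) - delta_mx q (dual p).

Lemma FsoE p q a b :
  Fso p q a b = ((a == p) && (b == dual q))%:R - ((a == q) && (b == dual p))%:R.
Proof. by rewrite !mxE. Qed.

Lemma in_so_Fso p q : in_so (Fso p q).
Proof.
apply/in_soP => a b; rewrite !FsoE !dual_eq !dualK opprB.
by rewrite [(b == dual p) && _]andbC [(b == dual q) && _]andbC.
Qed.

Lemma Fso_sym p q : Fso q p = - Fso p q.
Proof. by rewrite /Fso opprB. Qed.

(** The factor one half compensates for each basis element occurring twice, as [Fso p q] and as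
    [Fso q p = - Fso p q]. *)
Lemma so_expand X : in_so X ->
  X = \sum_p \sum_q (2%:R^-1 * X p (dual q)) *: Fso p q.
Proof.
move=> /in_soP eX; apply/matrixP => a b; rewrite summxE.
transitivity (\sum_p (2%:R^-1 * X p b * (a == p)%:R
   - 2%:R^-1 * X p (dual a) * (b == dual p)%:R)); last first.
  apply: eq_bigr => p _; rewrite summxE.
  under eq_bigr do rewrite mxE FsoE mulrBr.
  rewrite sumrB; congr (_ - _).
    rewrite (bigD1 (dual b)) //= dualK eqxx andbT big1 ?addr0 // => q qb.
    by rewrite [b == _]eq_dualC (negPf qb) andbF mulr0.
  rewrite (bigD1 a) //= eqxx /= big1 ?addr0 // => q qa.
  by rewrite [a == _]eq_sym (negPf qa) mulr0.
rewrite sumrB (bigD1 a) //= eqxx mulr1 big1 ?addr0; last first.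
  by move=> p pa; rewrite eq_sym (negPf pa) mulr0.
rewrite (bigD1 (dual b)) //= dualK eqxx mulr1 big1 ?addr0; last first.
  by move=> p pb; rewrite eq_dualC (negPf pb) mulr0.
by rewrite [X (dual b) _]eX !dualK mulrN opprK ![2%:R^-1 * _]mulrC -splitr.
Qed.

Lemma lieb_Fso X p q : in_so X ->
  lieb X (Fso p q) = \sum_a (X a p *: Fso a q + X a q *: Fso p a).
Proof.
move=> /in_soP eX; apply/matrixP => u v; rewrite /lieb /Fso.
rewrite mulmxBr mulmxBl summxE.
have sb (M1 M2 : 'M[C]_(n + n)) : (M1 - M2) u v = M1 u v - M2 u v by rewrite !mxE.
have mr i j : (X *m delta_mx i j) u v = X u i * (v == j)%:R.
  rewrite mxE (bigD1 i) //= big1 ?addr0 ?mxE ?eqxx //.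
  by move=> a ai; rewrite mxE (negPf ai) mulr0.
have ml i j : (delta_mx i j *m X) u v = (u == i)%:R * X j v.
  rewrite mxE (bigD1 j) //= big1 ?addr0 ?mxE ?eqxx ?andbT //.
  by move=> a ai; rewrite mxE (negPf ai) andbF mul0r.
rewrite !sb !mr !ml.
rewrite [X (dual q) v]eX [X (dual p) v]eX !dualK.
under eq_bigr do rewrite !mxE !mulrBr.
rewrite big_split /= !sumrB.
have s1 (c : 'I_(n + n) -> C) (b : bool) :
    \sum_a c a * ((u == a) && b)%:R = c u * b%:R.
  rewrite (bigD1 u) //= big1 ?addr0 ?eqxx // => a au.
  by rewrite eq_sym (negPf au) mulr0.
have s2 (c : 'I_(n + n) -> C) (b : bool) :
    \sum_a c a * (b && (v == dual a))%:R = c (dual v) * b%:R.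
  rewrite (bigD1 (dual v)) //= big1 ?addr0 ?dualK ?eqxx ?andbT // => a au.
  by rewrite [v == _]eq_dualC (negPf au) andbF mulr0.
by rewrite !s1 !s2; ring.
Qed.

Lemma lieb_Fso2 s t p q :
  lieb (Fso s t) (Fso p q) =
  (p == dual t)%:R *: Fso s q - (p == dual s)%:R *: Fso t q +
  ((q == dual t)%:R *: Fso p s - (q == dual s)%:R *: Fso p t).
Proof.
rewrite lieb_Fso; last exact: in_so_Fso.
rewrite big_split /=.
have sm (f : 'I_(n + n) -> 'M[C]_(n + n)) r :
    \sum_a Fso s t a r *: f a =
      (r == dual t)%:R *: f s - (r == dual s)%:R *: f t.
  under eq_bigr do rewrite FsoE scalerBl.
  rewrite sumrB (bigD1 s) //= eqxx big1 ?addr0 => [|a /negPf ->]; last by rewrite scale0r.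
  by rewrite (bigD1 t) //= eqxx big1 ?addr0 => [|a /negPf ->]; last by rewrite scale0r.
by rewrite !sm.
Qed.

(* [Fso p q] is a root vector of a positive root iff 0 < height p + height q, and
   lies in the Cartan subalgebra (or is 0) iff this sum is 0. *)
Definition height p : int :=
  match split p with
  | inl i => (n - i)%N%:Z
  | inr i => - (n - i)%N%:Z
  end.

Lemma height_lshift i : height (lshift n i) = (n - i)%N%:Z.
Proof. by rewrite /height (unsplitK (inl _ i)). Qed.

Lemma height_rshift i : height (rshift n i) = - (n - i)%N%:Z.
Proof. by rewrite /height (unsplitK (inr _ i)). Qed.

Lemma height_dual p : height (dual p) = - height p.
Proof.
case: (split_ordP p) => i ->.
  by rewrite dual_lshift height_lshift height_rshift.
by rewrite dual_rshift height_lshift height_rshift opprK.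
Qed.

Lemma height_eq0 p q : (height p + height q == 0) = (q == dual p).
Proof.
apply/idP/idP => [|/eqP ->]; last by rewrite height_dual subrr.
case: (split_ordP p) => i ->; case: (split_ordP q) => j ->;
  rewrite ?dual_lshift ?dual_rshift ?height_lshift ?height_rshift => e;
  have := ltn_ord i; have := ltn_ord j; move=> ? ?; try lia;
  by apply/eqP; congr (_ n _); apply: ord_inj; lia.
Qed.

Lemma cartanE (h : 'rV[C]_n) :
  cartan h = \sum_i h 0 i *: Fso (lshift n i) (rshift n i).
Proof.
apply/matrixP => a b; rewrite summxE /cartan.
under eq_bigr do rewrite mxE FsoE dual_lshift dual_rshift.
case: (split_ordP a) => i ->; case: (split_ordP b) => j ->;
  rewrite ?block_mxEul ?block_mxEur ?block_mxEdl ?block_mxEdr !mxE.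
- rewrite (bigD1 i) //= !eq_lrshift eq_lshift eqxx eq_lshift /= subr0 big1 ?addr0.
    by rewrite eq_sym; case: (j == i); rewrite ?mulr1 ?mulr0.
  by move=> c ci; rewrite eq_lshift [i == c]eq_sym (negPf ci) eq_lrshift subr0 mulr0.
- by rewrite big1 // => c _; rewrite !eq_lrshift eq_rlshift !andbF subrr mulr0.
- by rewrite big1 // => c _; rewrite !eq_lrshift eq_rlshift !andbF subrr mulr0.
- rewrite (bigD1 i) //= !eq_rlshift !eq_rshift eqxx /= sub0r big1 ?addr0.
    by rewrite eq_sym mulrN; case: (j == i); rewrite ?mulr1 ?mulr0.
  by move=> c ci; rewrite eq_rlshift eq_rshift [i == c]eq_sym (negPf ci) subrr mulr0.
Qed.

Lemma in_so_cartan (h : 'rV[C]_n) : in_so (cartan h).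
Proof. by rewrite cartanE; apply: in_so_sum => i; apply: in_so_Fso. Qed.

Lemma Fso_pos_block p q : 0 < height p + height q ->
  exists A B : 'M[C]_n, [/\ strictly_upper A, B^T = - B &
    Fso p q = block_mx A B 0 (- A^T)].
Proof.
move=> hpq; have [A [B [D [E eF]]]] : exists A B D E, Fso p q = block_mx A B D E.
  exists (ulsubmx (Fso p q)), (ursubmx (Fso p q)), (dlsubmx (Fso p q)), (drsubmx (Fso p q)).
  by rewrite submxK.
have /in_soP sF := in_so_Fso p q; rewrite eF in sF.
have eE : E = - A^T.
  apply/matrixP => i j; have := sF (rshift n i) (rshift n j).
  by rewrite !dual_rshift block_mxEdr block_mxEul !mxE.
have eB : B^T = - B.
  apply/matrixP => i j; have := sF (lshift n j) (rshift n i).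
  by rewrite !dual_rshift !dual_lshift !block_mxEur !mxE.
have hF a b : Fso p q a b != 0 -> 0 < height a - height b.
  rewrite FsoE; case E1: ((a == p) && (b == dual q)).
    by move/andP: E1 => [/eqP -> /eqP ->] _; rewrite height_dual opprK.
  case E2: ((a == q) && (b == dual p)); last by rewrite subrr eqxx.
  by move/andP: E2 => [/eqP -> /eqP ->] _; rewrite height_dual opprK addrC.
exists A, B; split=> //.
  move=> i j ji; apply/eqP; apply: contraT => Aij.
  have := hF (lshift n i) (lshift n j); rewrite eF block_mxEul => /(_ Aij).
  by rewrite !height_lshift; have := ltn_ord i; have := ltn_ord j; lia.
rewrite eF eE; congr (block_mx _ _ _ _); apply/matrixP => i j; rewrite [RHS]mxE.
apply/eqP; apply: contraT => Dij.
have := hF (rshift n i) (lshift n j); rewrite eF block_mxEdl => /(_ Dij).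
by rewrite height_lshift height_rshift; have := ltn_ord i; have := ltn_ord j; lia.
Qed.

Lemma upper_in_so (A B : 'M[C]_n) : B^T = - B -> in_so (block_mx A B 0 (- A^T)).
Proof.
move=> eB; apply/in_soP => p q.
case: (split_ordP p) => i ->; case: (split_ordP q) => j ->;
  rewrite ?dual_lshift ?dual_rshift ?block_mxEul ?block_mxEur ?block_mxEdl ?block_mxEdr ?mxE.
- by rewrite opprK.
- by have := congr1 (fun M : 'M_n => M j i) eB; rewrite !mxE.
- by rewrite oppr0.
- by [].
Qed.

Lemma upper_height (A B : 'M[C]_n) p q : strictly_upper A -> B^T = - B ->
  block_mx A B 0 (- A^T) p (dual q) != 0 ->
  p == q \/ 0 < height p + height q.
Proof.
move=> uA eB; case: (split_ordP p) => i ->; case: (split_ordP q) => j ->;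
  rewrite ?dual_lshift ?dual_rshift ?block_mxEul ?block_mxEur ?block_mxEdl ?block_mxEdr
     ?height_lshift ?height_rshift => nz; right; have := ltn_ord i; have := ltn_ord j; move=> ? ?.
- by lia.
- have : (i < j)%N by rewrite ltnNge; apply: contra nz => /uA ->.
  by lia.
- have : (j < i)%N by rewrite ltnNge; apply: contra nz => /uA; rewrite !mxE => ->; rewrite oppr0.
  by lia.
- by rewrite mxE eqxx in nz.
Qed.

End SkewBasis.

Arguments dual {n}.
Arguments height {n}.
Arguments Fso {C n}.

Section Adjoint.
Variable C : numClosedFieldType.

Definition adjmx (a b : nat) (M : 'M[C]_(a, b)) : 'M[C]_(b, a) := map_mx Num.conj M^T.

Lemma adjmxM a b c (M : 'M[C]_(a, b)) (N : 'M[C]_(b, c)) :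
  adjmx (M *m N) = adjmx N *m adjmx M.
Proof. by rewrite /adjmx trmx_mul map_mxM. Qed.

Lemma adjmxK a b (M : 'M[C]_(a, b)) : adjmx (adjmx M) = M.
Proof. by apply/matrixP => i j; rewrite !mxE conjCK. Qed.

Variable d : nat.
Implicit Types (u v w : 'cV[C]_d).

Definition dot u v : C := (adjmx u *m v) 0 0.

Lemma dotE u v : dot u v = \sum_x (u x 0)^* * v x 0.
Proof. by rewrite /dot mxE; apply: eq_bigr => x _; rewrite !mxE. Qed.

Lemma dot_adjmx u v (A : 'M[C]_d) : dot u (A *m v) = dot (adjmx A *m u) v.
Proof. by rewrite /dot adjmxM adjmxK mulmxA. Qed.

Lemma dotZDr a u v w : dot w (a *: u + v) = a * dot w u + dot w v.
Proof. by rewrite /dot mulmxDr -scalemxAr !mxE. Qed.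

Lemma dotC u v : dot v u = (dot u v)^*.
Proof.
rewrite !dotE rmorph_sum; apply: eq_bigr => x _.
by rewrite rmorphM /= conjCK mulrC.
Qed.

Lemma dotZDl a u v w : dot (a *: u + v) w = a^* * dot u w + dot v w.
Proof. by rewrite dotC dotZDr rmorphD rmorphM /= -!dotC. Qed.

Lemma dot0r u : dot u 0 = 0.
Proof. by rewrite /dot mulmx0 mxE. Qed.

Lemma dotBr u v w : dot w (u - v) = dot w u - dot w v.
Proof. by rewrite addrC -scaleN1r dotZDr mulN1r addrC. Qed.

Lemma dot_ge0 v : 0 <= dot v v.
Proof. by rewrite dotE sumr_ge0 // => x _; rewrite mulrC mul_conjC_ge0. Qed.

Lemma dot_eq0 v : (dot v v == 0) = (v == 0).
Proof.
apply/idP/eqP => [|->]; last by rewrite dot0r.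
rewrite dotE psumr_eq0 => [/allP v0|x _]; last by rewrite mulrC mul_conjC_ge0.
apply/matrixP => x j; rewrite ord1 mxE; apply/eqP.
by have := v0 x (mem_index_enum _); rewrite mulrC mul_conjC_eq0.
Qed.

End Adjoint.

Section Subspaces.

(** The predicate need not be decidable. The subspace is grown one vector at a time, excluded middle
    deciding whether a vector outside is left; the codimension bounds the number of steps. *)
Lemma vspace_of_pred (K : fieldType) (vT : vectType K) (P : vT -> Prop) :
  P 0 -> (forall a u v, P u -> P v -> P (a *: u + v)) ->
  exists U : {vspace vT}, forall u, u \in U <-> P u.
Proof.
move=> P0 Plin.
suff H m (U : {vspace vT}) : (\dim {:vT} - \dim U <= m)%N -> (forall u, u \in U -> P u) ->
    exists U' : {vspace vT}, forall u, u \in U' <-> P u.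
  by apply: (H _ 0%VS (leqnn _)) => u; rewrite memv0 => /eqP ->.
elim: m U => [|m IH] U dU UP.
  exists U => u; split=> [/UP //|_].
  have -> : U = fullv.
    by apply/eqP; rewrite eqEdim subvf -subn_eq0 -leqn0.
  exact: memvf.
have [[u [Pu uU]]|noU] := classic (exists u, P u /\ u \notin U); last first.
  exists U => u; split=> [/UP //|Pu]; apply: contraT => uU.
  by case: noU; exists u.
apply: (IH (U + <[u]>)%VS); last first.
  move=> x /memv_addP[y yU [_ /vlineP[c ->] ->]]; rewrite addrC.
  by apply: Plin => //; apply: UP.
have : (\dim U < \dim (U + <[u]>)%VS)%N.
  rewrite ltn_neqAle dimvS ?addvSl // andbT; apply: contra uU => /eqP e.
  have /eqP -> : U == (U + <[u]>)%VS by rewrite eqEdim addvSl e leqnn.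
  by rewrite (subvP (addvSr _ _)) ?memv_line.
lia.
Qed.

Variables (C : numClosedFieldType) (d : nat).
Implicit Types (u v : 'cV[C]_d) (U W : {vspace 'cV[C]_d}).

(** Induction on the dimension: project onto the orthogonal complement in W of one vector v, then
    add the component along v. *)
Lemma orth_projection W u :
  exists2 w, w \in W & forall z, z \in W -> dot z (u - w) = 0.
Proof.
move: {2}(\dim W) (leqnn (\dim W)) => m; elim: m W u => [|m IH] W u dW.
  exists 0; first exact: mem0v.
  move=> z; rewrite (_ : W = 0%VS) ?memv0 => [/eqP ->|].
    by rewrite dotC dot0r rmorph0.
  by apply/eqP; rewrite -dimv_eq0; lia.
have [W0|W0] := eqVneq W 0%VS; first by apply: IH; rewrite W0 dimv0.
pose v := vpick W; have vW : v \in W := memv_pick W.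
have v0 : dot v v != 0 by rewrite dot_eq0 vpick0.
have [||W' W'P] := @vspace_of_pred C _ (fun x => x \in W /\ dot v x = 0).
- by split; [exact: mem0v | rewrite dot0r].
- move=> a x y [xW xv] [yW yv]; split; first by rewrite rpredD ?rpredZ.
  by rewrite dotZDr xv yv mulr0 addr0.
have sW : (W' <= W)%VS by apply/subvP => x /W'P[].
have dW' : (\dim W' < \dim W)%N.
  rewrite ltn_neqAle dimvS // andbT; apply: contraNneq v0 => e.
  have /eqP eW : W' == W by rewrite eqEdim sW e leqnn.
  by have /W'P[_ ->] : v \in W' by rewrite eW.
have [w wW' wP] := IH W' u (leq_trans dW' dW : \dim W' <= m)%N.
have [wW wv] := (W'P w).1 wW'.
exists (w + (dot v u / dot v v) *: v); first by rewrite rpredD ?rpredZ.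
move=> z zW; pose c := dot v z / dot v v.
have zE : z = c *: v + (z - c *: v) by rewrite addrC subrK.
have z' : z - c *: v \in W'.
  apply/W'P; split; first by rewrite rpredB ?rpredZ.
  by rewrite addrC -scaleNr dotZDr mulNr divfK // addNr.
have wv' : dot v (u - w) = dot v u by rewrite dotBr wv subr0.
have zl : dot z (u - w) = c^* * dot v u.
  by rewrite {1}zE dotZDl wv' wP // addr0.
rewrite opprD addrA dotBr zl -[_ *: v]addr0 dotZDr dot0r addr0 /c.
rewrite rmorphM fmorphV /= -!dotC; ring.
Qed.

End Subspaces.

Section RepTheory.
Variables (C : numClosedFieldType) (n : nat).
Implicit Types (p q s t : 'I_(n + n)).

Section OneRep.
Variable r : rep C n.
Implicit Types (u v w x : 'cV[C]_(rdim r)) (U W : {vspace 'cV[C]_(rdim r)}) (mu : 'rV[C]_n).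

Definition rF p q : 'M[C]_(rdim r) := ract r (Fso p q).

Lemma ract0 : ract r 0 = 0.
Proof.
have := ract_linear r (-1) (in_so0 C n) (in_so0 C n).
by rewrite scaler0 addr0 scaleN1r addNr.
Qed.

Lemma ractD X Y : in_so X -> in_so Y -> ract r (X + Y) = ract r X + ract r Y.
Proof. by move=> sX sY; rewrite -{1}[X]scale1r ract_linear // scale1r. Qed.

Lemma ractZ a X : in_so X -> ract r (a *: X) = a *: ract r X.
Proof.
by move=> sX; rewrite -[_ *: X]addr0 ract_linear ?ract0 ?addr0 //; exact: in_so0.
Qed.

Lemma ract_sum (I : finType) (P : pred I) (c : I -> C) (f : I -> 'M[C]_(n + n)) :
  (forall i, in_so (f i)) ->
  ract r (\sum_(i | P i) c i *: f i) = \sum_(i | P i) c i *: ract r (f i).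
Proof.
move=> sf.
suff [] : in_so (\sum_(i | P i) c i *: f i) /\
  ract r (\sum_(i | P i) c i *: f i) = \sum_(i | P i) c i *: ract r (f i) by [].
elim/big_rec2: _ => [|i A B _ [sB eB]]; first by split; [exact: in_so0 | exact: ract0].
by split; [exact: in_soZD | rewrite ract_linear // eB].
Qed.

Lemma ract_expand X : in_so X ->
  ract r X = \sum_p \sum_q (2%:R^-1 * X p (dual q)) *: rF p q.
Proof.
move=> sX; rewrite {1}(so_expand sX) -(eq_bigr _ (fun p _ => scale1r _)).
rewrite ract_sum => [|p]; last by apply: in_so_sum => q; exact: in_so_Fso.
apply: eq_bigr => p _; rewrite scale1r ract_sum // => q; exact: in_so_Fso.
Qed.

Lemma rF_sym p q : rF q p = - rF p q.
Proof. by rewrite /rF Fso_sym -scaleN1r ractZ ?scaleN1r //; exact: in_so_Fso. Qed.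

Lemma rF_comm s t p q :
  rF s t *m rF p q = rF p q *m rF s t +
  ((p == dual t)%:R *: rF s q - (p == dual s)%:R *: rF t q +
  ((q == dual t)%:R *: rF p s - (q == dual s)%:R *: rF p t)).
Proof.
apply/eqP; rewrite addrC -subr_eq; apply/eqP; rewrite -[LHS]/(lieb _ _).
rewrite /rF -ract_lieb; try exact: in_so_Fso.
have so2 (c1 c2 : C) a1 b1 a2 b2 :
    in_so (c1 *: Fso a1 b1 - c2 *: Fso a2 b2) /\
    ract r (c1 *: Fso a1 b1 - c2 *: Fso a2 b2) = c1 *: rF a1 b1 - c2 *: rF a2 b2.
  rewrite -!scaleNr; split; first by apply/in_soZD/in_soZ/in_so_Fso/in_so_Fso.
  by rewrite ract_linear ?ractZ //; [exact: in_so_Fso | exact: in_so_Fso | apply/in_soZ/in_so_Fso].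
by rewrite lieb_Fso2 (ractD (so2 _ _ _ _ _ _).1 (so2 _ _ _ _ _ _).1) !(so2 _ _ _ _ _ _).2.
Qed.

Lemma submoduleP U : submodule U <-> forall p q v, v \in U -> rF p q *m v \in U.
Proof.
split=> [sU p q v vU|sU X sX v vU]; first exact/sU/vU/in_so_Fso.
rewrite (ract_expand sX) mulmx_suml rpred_sum // => p _.
rewrite mulmx_suml rpred_sum // => q _; rewrite -scalemxAl rpredZ //; exact: sU.
Qed.

Definition killed v := forall p q, 0 < height p + height q -> rF p q *m v = 0.

Definition weight_vec mu v := forall i, rF (lshift n i) (rshift n i) *m v = mu 0 i *: v.

Definition hw_vec mu v := weight_vec mu v /\ killed v.

Lemma is_highest_weight_vectorP mu v :
  is_highest_weight_vector mu v <-> v != 0 /\ hw_vec mu v.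
Proof.
split=> [[v0 wv kv]|[v0 [wv kv]]].
  split=> //; split=> [i|p q hpq].
    have := wv (delta_mx 0 i); rewrite cartanE ract_sum; last by move=> j; exact: in_so_Fso.
    rewrite (bigD1 i) //= big1 => [|j ji]; last by rewrite mxE (negPf ji) andbF scale0r.
    rewrite mxE !eqxx scale1r addr0 => ->; congr (_ *: _).
    rewrite (bigD1 i) //= big1 => [|j ji]; last by rewrite mxE (negPf ji) andbF mulr0.
    by rewrite mxE !eqxx mulr1 addr0.
  by have [A [B [uA eB eF]]] := Fso_pos_block C hpq; rewrite /rF eF kv.
split=> // [h|A B uA eB].
  rewrite cartanE ract_sum; last by move=> j; exact: in_so_Fso.
  rewrite mulmx_suml scaler_suml; apply: eq_bigr => i _.
  by rewrite -scalemxAl wv scalerA mulrC.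
rewrite (ract_expand (upper_in_so A eB)) mulmx_suml big1 // => p _.
rewrite mulmx_suml big1 // => q _; rewrite -scalemxAl.
have [->|nz] := eqVneq (block_mx A B 0 (- A^T) p (dual q)) 0.
  by rewrite mulr0 scale0r.
have [/eqP ->|/kv ->] := upper_height uA eB nz; last by rewrite scaler0.
have -> : rF q q = 0; last by rewrite mul0mx scaler0.
have /eqP := rF_sym q q; rewrite -addr_eq0 -mulr2n -scaler_nat scaler_eq0 pnatr_eq0 /=.
by move/eqP.
Qed.

Lemma hw_vec_lin mu a u v : hw_vec mu u -> hw_vec mu v -> hw_vec mu (a *: u + v).
Proof.
move=> [wu ku] [wv kv]; split=> [i|p q h].
  by rewrite mulmxDr -scalemxAr wu wv scalerDr !scalerA mulrC.
by rewrite mulmxDr -scalemxAr ku // kv // scaler0 addr0.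
Qed.

Lemma hw_vec0 mu : hw_vec mu (0 : 'cV[C]_(rdim r)).
Proof. by split=> [i|p q _]; rewrite mulmx0 ?scaler0. Qed.

(** Only lowering operators are allowed, so that orthogonality to a killed vector propagates from x
    to all of [gen x]. For a highest weight vector x this is nevertheless the whole submodule
    generated by x. *)
Inductive gen x : 'cV[C]_(rdim r) -> Prop :=
| gen_base : gen x x
| gen_lin a u v : gen x u -> gen x v -> gen x (a *: u + v)
| gen_lower p q u : height p + height q < 0 -> gen x u -> gen x (rF p q *m u).

Lemma gen0 x : gen x 0.
Proof. by rewrite -(addNr x) -scaleN1r; apply: gen_lin; apply: gen_base. Qed.

Lemma genZ x a u : gen x u -> gen x (a *: u).
Proof. by move=> gu; rewrite -[_ *: u]addr0; apply: gen_lin => //; apply: gen0. Qed.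

Lemma genD x u v : gen x u -> gen x v -> gen x (u + v).
Proof. by move=> gu gv; rewrite -[u]scale1r; apply: gen_lin. Qed.

(** An operator is commuted past the lowering operators until it meets x. The commutators are
    combinations of operators [rF], to which the induction hypothesis applies. *)
Lemma gen_act mu x u : hw_vec mu x -> gen x u -> forall p q, gen x (rF p q *m u).
Proof.
move=> [wx kx]; elim=> {u} [|a u v _ IHu _ IHv|s t u hst gu IH] p q.
- have [hpq|hpq|/eqP] := Order.TotalTheory.ltgtP (height p + height q) 0.
  + by apply: gen_lower => //; apply: gen_base.
  + by rewrite kx //; apply: gen0.
  rewrite height_eq0 => /eqP ->.
  case: (split_ordP p) => i ->; rewrite ?dual_lshift ?dual_rshift.
    by rewrite wx; apply/genZ/gen_base.
  rewrite rF_sym mulNmx wx -scaleNr; exact/genZ/gen_base.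
- by rewrite mulmxDr -scalemxAr; apply: gen_lin.
- rewrite mulmxA rF_comm mulmxDl -mulmxA; apply: genD; first exact: gen_lower.
  rewrite !mulmxDl !mulNmx -!scalemxAl -!scaleNr.
  by apply: genD; apply: genD; apply: genZ.
Qed.

Lemma gen_min x u U : submodule U -> x \in U -> gen x u -> u \in U.
Proof.
move=> /submoduleP sU xU; elim=> {u} // [a u v _ uU _ vU|p q u _ _ uU].
  by rewrite rpredD ?rpredZ.
exact: sU.
Qed.

Lemma gen_vspace mu x : hw_vec mu x ->
  exists2 U, submodule U & forall u, u \in U <-> gen x u.
Proof.
move=> hx; have [U UP] := vspace_of_pred (gen0 x) (@gen_lin x).
by exists U => //; apply/submoduleP => p q v /UP gv; apply/UP; apply: (gen_act hx).
Qed.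

(** [Fso (dual q) (dual p)] is the conjugate transpose of [Fso p q]. Thus the compact real form of
    so_2n acts by skew-Hermitian matrices for the standard form on column vectors. *)
Definition unitary_rep := forall p q, adjmx (rF p q) = rF (dual q) (dual p).

Section Unitary.
Hypothesis unit_r : unitary_rep.

(** The adjoint of a lowering operator is a raising operator, which kills w. *)
Lemma gen_orth x w u : killed w -> dot w x = 0 -> gen x u -> dot w u = 0.
Proof.
move=> kw wx; elim=> {u} // [a u v _ eu _ ev|p q u h _ eu].
  by rewrite dotZDr eu ev mulr0 addr0.
rewrite dot_adjmx unit_r kw; first by rewrite dotC dot0r rmorph0.
by rewrite !height_dual; lia.
Qed.

(** Subtracting from w its projection to x leaves a killed vector orthogonal to x, hence to all of
    [gen x]; but it lies in [gen x] itself. *)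
Lemma gen_killed_line x w : x != 0 -> killed x -> killed w -> gen x w ->
  exists c, w = c *: x.
Proof.
move=> x0 kx kw gw; have dx : dot x x != 0 by rewrite dot_eq0.
pose c := dot x w / dot x x; exists c; apply/eqP; rewrite -subr_eq0 -dot_eq0.
have k' : killed (w - c *: x).
  by move=> p q h; rewrite mulmxBr -scalemxAr kx // kw // scaler0 subrr.
rewrite (gen_orth k' (x := x)) //.
  by rewrite dotC dotBr -[c *: x]addr0 dotZDr dot0r addr0 divfK // subrr rmorph0.
by rewrite addrC -scaleNr; apply: gen_lin => //; apply: gen_base.
Qed.

Lemma orth_submodule U W : submodule U -> submodule W ->
  exists2 V, submodule V & forall u, u \in V <-> u \in U /\ forall w, w \in W -> dot w u = 0.
Proof.
move=> /submoduleP sU /submoduleP sW.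
have [||V VP] := @vspace_of_pred C 'cV[C]_(rdim r)
  (fun u => u \in U /\ forall w, w \in W -> dot w u = 0).
- by split; [exact: mem0v | move=> w _; rewrite dot0r].
- move=> a u v [uU uW] [vU vW]; split; first by rewrite rpredD ?rpredZ.
  by move=> w wW; rewrite dotZDr uW // vW // mulr0 addr0.
exists V => //; apply/submoduleP => p q v /VP[vU vW]; apply/VP; split; first exact: sU.
by move=> w wW; rewrite dot_adjmx unit_r vW //; apply: sW.
Qed.

End Unitary.

(** The coordinates of the weight of the basis vector e_p of the vector representation; the root of
    [Fso p q] is the sum of those for p and q. *)
Definition omega (p : 'I_(n + n)) (i : 'I_n) : C :=
  (p == lshift n i)%:R - (p == rshift n i)%:R.

Lemma rF_cartan_comm i p q :
  rF (lshift n i) (rshift n i) *m rF p q =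
  rF p q *m rF (lshift n i) (rshift n i) + (omega p i + omega q i) *: rF p q.
Proof.
rewrite rF_comm dual_lshift dual_rshift; congr (_ + _).
rewrite scalerDl /omega !scalerBl; congr (_ - _ + (_ - _)).
- by case: eqP => [->|]; rewrite ?scale0r.
- by case: eqP => [->|]; rewrite ?scale0r.
- by case: eqP => [->|]; rewrite ?scale0r.
- by case: eqP => [->|]; rewrite ?scale0r.
Qed.

(** The height is the pairing with (n, n - 1, ..., 1), which is positive on every positive root e_i
    - e_j and e_i + e_j. *)
Lemma omega_height p : \sum_(i < n) (n - i)%N%:R * omega p i = (height p)%:~R.
Proof.
rewrite /omega; case: (split_ordP p) => i ->; rewrite (bigD1 i) //= big1 ?addr0.
- by rewrite eqxx eq_lrshift subr0 mulr1 height_lshift.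
- by move=> j ji; rewrite eq_lshift eq_lrshift [i == j]eq_sym (negPf ji) subrr mulr0.
- by rewrite eqxx eq_rlshift sub0r mulrN1 height_rshift mulrNz.
- by move=> j ji; rewrite eq_rshift eq_rlshift [i == j]eq_sym (negPf ji) subrr mulr0.
Qed.

Lemma weight_vec_rF mu v p q : weight_vec mu v ->
  weight_vec (mu + \row_i (omega p i + omega q i)) (rF p q *m v).
Proof.
move=> wv i; rewrite mulmxA rF_cartan_comm mulmxDl -mulmxA wv.
by rewrite -scalemxAr -scalemxAl !mxE -scalerDl.
Qed.

End OneRep.
End RepTheory.

Section Decomposition.
Variables (C : numClosedFieldType) (n : nat) (r : rep C n).
Variable wt : 'I_(rdim r) -> 'I_n -> C.
Implicit Types (p q s t : 'I_(n + n)).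
Implicit Types (u v w x : 'cV[C]_(rdim r)) (U W : {vspace 'cV[C]_(rdim r)}) (mu : 'rV[C]_n).

Definition cartan_diagonal := forall i, rF r (lshift n i) (rshift n i) = diag_mx (\row_x wt x i).

Hypothesis cart_r : cartan_diagonal.

Lemma cartan_entry i v (a : 'I_(rdim r)) :
  (rF r (lshift n i) (rshift n i) *m v) a 0 = wt a i * v a 0.
Proof. by rewrite cart_r mul_diag_mx !mxE. Qed.

Lemma cartan_sub_entry i c v (a : 'I_(rdim r)) :
  (rF r (lshift n i) (rshift n i) *m v - c *: v) a 0 = (wt a i - c) * v a 0.
Proof. by rewrite mulrBl -cartan_entry !mxE. Qed.

(** Induction on the size of the support. If v has support at a and b with different weights,
    subtracting the eigenvalue at a from a Cartan operator kills the coordinate a of v but not b. *)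
Lemma exists_weight_vec U : submodule U -> U <> 0%VS ->
  exists mu v, [/\ v \in U, v != 0 & weight_vec mu v].
Proof.
move=> /submoduleP sU U0.
suff H m v : v \in U -> v != 0 -> (#|[set a | v a 0 != 0]%R| <= m)%N ->
    exists mu v, [/\ v \in U, v != 0 & weight_vec mu v].
  by apply: (H _ (vpick U)) => //; rewrite ?memv_pick // vpick0; apply/eqP.
elim: m v => [|m IH] v vU v0 vm.
  case/negP: v0; apply/eqP/matrixP => a j; rewrite ord1 mxE; apply/eqP.
  move: vm; rewrite leqn0 cards_eq0 => /eqP /setP /(_ a).
  by rewrite !inE => /negbFE.
have [[a [b [i [a0 b0 ab]]]]|same] :=
  classic (exists a b i, [/\ v a 0 != 0, v b 0 != 0 & wt a i != wt b i]).
  apply: (IH (rF r (lshift n i) (rshift n i) *m v - wt a i *: v)).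
  - by rewrite rpredB ?rpredZ //; apply: sU.
  - apply/eqP => /matrixP /(_ b 0); rewrite cartan_sub_entry [RHS]mxE => /eqP.
    by rewrite mulf_eq0 (negPf b0) orbF subr_eq0 eq_sym (negPf ab).
  - rewrite -ltnS (leq_trans _ vm) // proper_card //; apply/properP; split.
      apply/subsetP => c; rewrite !inE cartan_sub_entry.
      by apply: contraNneq => ->; rewrite mulr0.
    by exists a; rewrite !inE // cartan_sub_entry subrr mul0r eqxx.
have /existsP[a a0] : [exists a, v a 0 != 0].
  apply: contraNT v0 => /existsPn v0; apply/eqP/matrixP => a j.
  by rewrite ord1 mxE; apply/eqP; have := v0 a; rewrite negbK.
exists (\row_i wt a i), v; split=> // i; apply/matrixP => b j; rewrite ord1 cartan_entry !mxE.
have [->|b0] := eqVneq (v b 0) 0; first by rewrite !mulr0.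
congr (_ * _); apply/eqP/contraT => ab; case: same; exists a, b, i; split=> //.
by rewrite eq_sym.
Qed.

Definition level mu : C := \sum_(i < n) (n - i)%N%:R * mu 0 i.

(** Raising operators add a positive integer to the level, and the level of a nonzero weight vector
    is that of some basis vector. The induction is on the number of basis vectors of larger
    level. *)
Lemma exists_hw_vec U : submodule U -> U <> 0%VS ->
  exists mu v, [/\ v \in U, v != 0 & hw_vec mu v].
Proof.
move=> sU U0; have [mu [v [vU v0 wv]]] := exists_weight_vec sU U0.
pose lev (a : 'I_(rdim r)) : C := level (\row_i wt a i).
move: {2}(#|[set a | level mu < lev a]|) (leqnn #|[set a | level mu < lev a]|) => m.
elim: m mu v vU v0 wv => [|m IH] mu v vU v0 wv vm.
all: have [kv|nk] := classic (killed v); first by exists mu, v.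
all: have {nk} [p [q [hpq Fv]]] : exists p q, 0 < height p + height q /\ rF r p q *m v != 0
  by apply: NNPP => no; case: nk => p q hpq; apply/eqP; apply: contraT => Fv; case: no; exists p, q.
all: set mu' := mu + \row_i (omega C p i + omega C q i).
all: have wF : weight_vec mu' (rF r p q *m v) by exact: weight_vec_rF.
all: have lmu' : level mu' = level mu + (height p + height q)%:~R
  by rewrite /level intrD -!omega_height -!big_split /=; apply: eq_bigr => i _; rewrite !mxE !mulrDr.
all: have lt_mu : level mu < level mu' by rewrite lmu' ltrDl ltr0z.
all: have [a aE] : exists a, lev a = level mu'
  by (have /existsP[a a0] : [exists a, (rF r p q *m v) a 0 != 0]
    by apply: contraNT Fv => /existsPn F0; apply/eqP/matrixP => a j;
       rewrite ord1 [RHS]mxE; apply/eqP; have := F0 a; rewrite negbK);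
  exists a; rewrite /lev; congr level; apply/rowP => i; rewrite mxE;
  have := congr1 (fun M : 'cV_(rdim r) => M a 0) (wF i);
  rewrite cartan_entry [RHS]mxE => /(mulIf a0).
  by move: vm; rewrite leqn0 cards_eq0 => /eqP /setP /(_ a); rewrite !inE aE lt_mu.
apply: (IH mu' (rF r p q *m v)) => //; first exact/(submoduleP U).1.
rewrite -ltnS (leq_trans _ vm) // proper_card //; apply/properP; split.
  by apply/subsetP => b; rewrite !inE; apply: Order.POrderTheory.lt_trans.
by exists a; rewrite !inE aE // Order.POrderTheory.ltxx.
Qed.

Hypothesis unit_r : unitary_rep r.

(** A nonzero submodule contains a highest weight vector, which by [gen_killed_line] is a multiple
    of v, and v generates everything. *)
Lemma gen_irreducible mu v U : v != 0 -> hw_vec mu v -> submodule U ->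
  (forall u, u \in U <-> gen v u) -> irreducible U.
Proof.
move=> v0 hv sU UP; have vU : v \in U by apply/UP/gen_base.
split=> // [U0|W sW WU]; first by move: vU v0; rewrite U0 memv0 => ->.
have [->|W0] := eqVneq W 0%VS; [by left | right].
have [nu [w [wW w0 [_ kw]]]] := exists_hw_vec sW (elimN eqP W0).
have [c wE] := gen_killed_line unit_r v0 hv.2 kw ((UP w).1 (subvP WU w wW)).
have c0 : c != 0 by apply: contraNneq w0 => c0; rewrite wE c0 scale0r.
have vW : v \in W by rewrite -[v]scale1r -(mulVf c0) -scalerA -wE rpredZ.
apply/eqP; rewrite eqEsubv WU; apply/subvP => u /UP; exact: gen_min.
Qed.

Lemma hw_space mu : exists HW : {vspace 'cV[C]_(rdim r)}, forall u, u \in HW <-> hw_vec mu u.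
Proof.
apply: vspace_of_pred; first exact: hw_vec0.
by move=> a u v; apply: hw_vec_lin.
Qed.

(** Split off the submodule generated by a highest weight vector and recurse on its orthogonal
    complement. The summand meets [HW] in a line if its highest weight is mu and in 0 otherwise,
    which is how the last count is maintained. *)
Lemma unitary_decomposition mu (HW : {vspace 'cV[C]_(rdim r)}) m U :
  (forall u, u \in HW <-> hw_vec mu u) -> submodule U -> (\dim U <= m)%N ->
  exists (N : nat) (nu : 'I_N -> 'rV[C]_n) (Us : 'I_N -> {vspace 'cV[C]_(rdim r)}),
    [/\ forall i, is_irr_hw_sub (nu i) (Us i),
        (\sum_(i < N) \dim (Us i))%N = \dim U,
        (\sum_(i < N) Us i)%VS = U &
        (\sum_(i < N) (nu i == mu))%N = \dim (HW :&: U)%VS].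
Proof.
move=> HWP; elim: m U => [|m IH] U sU dU.
  exists 0%N, (fun=> 0), (fun=> 0%VS); have -> : U = 0%VS.
    by apply/eqP; rewrite -dimv_eq0 -leqn0.
  by split; [case | rewrite !big_ord0 dimv0 | rewrite big_ord0 | rewrite big_ord0 capv0 dimv0].
have [U0|U0] := eqVneq U 0%VS; first by apply: IH; rewrite // U0 dimv0.
have [nu [v [vU v0 hv]]] := exists_hw_vec sU (elimN eqP U0).
have [G sG GP] := gen_vspace hv; have vG : v \in G by apply/GP/gen_base.
have GU : (G <= U)%VS by apply/subvP => u /GP; exact: gen_min.
have [U' sU' U'P] := orth_submodule unit_r sU sG.
have GU'0 : (G :&: U' = 0)%VS.
  apply/eqP; rewrite -subv0; apply/subvP => u /memv_capP[uG /U'P[_ /(_ u uG) /eqP]].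
  by rewrite dot_eq0 memv0.
have eU : (G + U' = U)%VS.
  apply/eqP; rewrite eqEsubv subv_add GU /=; apply/andP; split.
    by apply/subvP => u /U'P[].
  apply/subvP => u uU; have [w wG wP] := orth_projection G u.
  rewrite -(subrK w u) addrC memv_add //; apply/U'P; split=> //.
  by rewrite rpredB // (subvP GU).
have dsum : (\dim G + \dim U' = \dim U)%N by rewrite -dimv_disjoint_sum // eU.
have dG : (0 < \dim G)%N.
  rewrite lt0n dimv_eq0; apply: contraNneq v0 => G0.
  by move: vG; rewrite G0 memv0.
have [||N [nus [Us [irr dUs eUs cnt]]]] := IH U'; [exact: sU' | lia | ].
have HG : \dim (HW :&: G)%VS = (nu == mu).
  have line u : u \in (HW :&: G)%VS -> exists c, u = c *: v.
    by move=> /memv_capP[/HWP[_ ku] /GP gu]; exact: (gen_killed_line unit_r v0 hv.2 ku gu).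
  have [e|ne] := eqVneq nu mu.
    have -> : (HW :&: G)%VS = <[v]>%VS; last by rewrite dim_vline v0.
    apply/eqP; rewrite eqEsubv; apply/andP; split.
      by apply/subvP => u /line[c ->]; apply/vlineP; exists c.
    by rewrite -memvE memv_cap vG andbT; apply/HWP; rewrite -e.
  apply/eqP; rewrite dimv_eq0 -subv0; apply/subvP => u uHG; rewrite memv0.
  have [c uE] := line u uHG; move: uHG => /memv_capP[/HWP[wu _] _].
  rewrite uE scaler_eq0 (negPf v0) orbF; apply: contraNT ne => c0.
  apply/eqP/rowP => i; have := wu i; rewrite uE -scalemxAr hv.1 !scalerA => /eqP.
  rewrite -subr_eq0 -scalerBl scaler_eq0 (negPf v0) orbF subr_eq0.
  by rewrite [c * _]mulrC => /eqP /(mulIf c0).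
(* Being a highest weight vector of weight mu is a system of eigenvector equations, and these pass
   to the components along a direct sum of submodules. *)
have HU : \dim (HW :&: U)%VS = (\dim (HW :&: G) + \dim (HW :&: U'))%N.
  rewrite -dimv_disjoint_sum; last first.
    apply/eqP; rewrite -subv0 -GU'0; apply/subvP => u /memv_capP[/memv_capP[_ uG] /memv_capP[_ uU']].
    by rewrite memv_cap uG.
  congr (\dim _); apply/eqP; rewrite eqEsubv; apply/andP; split; last first.
    by rewrite -eU subv_add !capvS ?addvSl ?addvSr.
  apply/subvP => u /memv_capP[/HWP hu]; rewrite -{1}eU => /memv_addP[g gG [u' uU' uE]].
  have key M (c : C) : (forall W, submodule W -> forall w, w \in W -> M *m w \in W) ->
      M *m u = c *: u -> M *m g = c *: g /\ M *m u' = c *: u'.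
    move=> sM; rewrite uE mulmxDr scalerDr => e.
    have e' : M *m g - c *: g = c *: u' - M *m u'.
      by apply/eqP; rewrite subr_eq addrAC eq_sym subr_eq eq_sym [X in _ == X]addrC e.
    have : M *m g - c *: g \in (G :&: U')%VS.
      by rewrite memv_cap {2}e' !rpredB ?rpredZ ?sM.
    rewrite GU'0 memv0 => /eqP z; split; first by apply/eqP; rewrite -subr_eq0 z.
    by apply/eqP; rewrite eq_sym -subr_eq0 -e' z.
  have kF p q W : submodule W -> forall w, w \in W -> rF r p q *m w \in W.
    by move=> /submoduleP sW w; apply: sW.
  have hgu : hw_vec mu g /\ hw_vec mu u'.
    split; split=> [i|p q hpq].
    - by case: (key _ _ (kF _ _) (hu.1 i)).
    - by case: (key _ 0 (kF p q)) => [|-> _]; rewrite scale0r ?hu.2.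
    - by case: (key _ _ (kF _ _) (hu.1 i)).
    - by case: (key _ 0 (kF p q)) => [|_ ->]; rewrite scale0r ?hu.2.
  by rewrite uE memv_add // memv_cap ?gG ?uU' andbT; apply/HWP; case: hgu.
exists N.+1, (fun i => if unlift ord0 i is Some j then nus j else nu),
  (fun i => if unlift ord0 i is Some j then Us j else G).
have rc T idx (op : T -> T -> T) (f : 'I_N -> T) a :
   \big[op/idx]_(i < N.+1) (if unlift ord0 i is Some j then f j else a) =
   op a (\big[op/idx]_(i < N) f i).
  rewrite big_ord_recl unlift_none; congr (op _ _).
  by apply: eq_bigr => i _; rewrite liftK.
split.
- move=> i; case: unliftP => [j _|_]; first exact: irr.
  split; first exact: gen_irreducible hv sG GP.
  by exists v => //; apply/is_highest_weight_vectorP.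
- rewrite -dsum -dUs -rc; apply: eq_bigr => i _; by case: unliftP.
- by rewrite rc eUs.
- rewrite HU HG -cnt -(rc _ _ addn (fun j => nat_of_bool (nus j == mu))).
  by apply: eq_bigr => i _; case: unliftP.
Qed.

Theorem unitary_multiplicity mu (HW : {vspace 'cV[C]_(rdim r)}) :
  (forall u, u \in HW <-> hw_vec mu u) -> has_multiplicity mu r (\dim HW).
Proof.
move=> HWP; have sF : submodule (fullv : {vspace 'cV[C]_(rdim r)}).
  by move=> X _ v _; exact: memvf.
have [N [nu [Us [irr dUs eUs cnt]]]] := unitary_decomposition HWP sF (leqnn _).
exists N, nu, Us; split=> //.
  by rewrite directvE /= eUs dUs.
rewrite cardsE -sum1_card big_mkcond /= -[HW in RHS]capvf -cnt.
by apply: eq_bigr => i _; rewrite -[i \in _]/(nu i == mu); case: (nu i == mu).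
Qed.

End Decomposition.

(** * The spin representation and its tensor powers *)

Section Tensor.
Variable C : numClosedFieldType.

Lemma tensmxDl m n p q (A B : 'M[C]_(m, n)) (D : 'M[C]_(p, q)) :
  (A + B) *t D = A *t D + B *t D.
Proof. by apply/matrixP => i j; rewrite !mxE mulrDl. Qed.

Lemma tensmxDr m n p q (A : 'M[C]_(m, n)) (B D : 'M[C]_(p, q)) :
  A *t (B + D) = A *t B + A *t D.
Proof. by apply/matrixP => i j; rewrite !mxE mulrDr. Qed.

Lemma tensmxNl m n p q (A : 'M[C]_(m, n)) (D : 'M[C]_(p, q)) :
  (- A) *t D = - (A *t D).
Proof. by apply/matrixP => i j; rewrite !mxE mulNr. Qed.

Lemma tensmx11 m n : (1%:M : 'M[C]_m) *t (1%:M : 'M[C]_n) = 1%:M.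
Proof.
apply/matrixP => x y; case: (mxtens_indexP x) => i j; case: (mxtens_indexP y) => i' j'.
rewrite tensmxE !mxE (can_eq (@mxtens_indexK _ _)) xpair_eqE.
by case: (i == i'); rewrite ?mul1r ?mul0r.
Qed.

Lemma adjmx_tens m n p q (A : 'M[C]_(m, n)) (B : 'M[C]_(p, q)) :
  adjmx (A *t B) = adjmx A *t adjmx B.
Proof. by rewrite /adjmx trmx_tens map_mxT. Qed.

Lemma tens_diag m n (a : 'I_m -> C) (b : 'I_n -> C) :
  diag_mx (\row_x a x) *t diag_mx (\row_y b y) =
  diag_mx (\row_x (a (mxtens_unindex x).1 * b (mxtens_unindex x).2)).
Proof.
apply/matrixP => x y; case: (mxtens_indexP x) => i j; case: (mxtens_indexP y) => i' j'.
rewrite tensmxE !mxE !mxtens_indexK (can_eq (@mxtens_indexK _ _)) xpair_eqE /=.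
by case: eqP => [->|_] /=; rewrite ?mul0r //; case: eqP => [->|_]; rewrite ?mulr0.
Qed.

Lemma big_tens (R : nmodType) m n (f : 'I_m -> 'I_n -> R) :
  \sum_(x < m * n) f (mxtens_unindex x).1 (mxtens_unindex x).2 = \sum_i \sum_j f i j.
Proof.
rewrite pair_bigA (reindex (@mxtens_index m n)); last first.
  by exists (@mxtens_unindex m n) => x _; rewrite ?mxtens_indexK ?mxtens_unindexK.
by apply: eq_bigr => -[i j] _; rewrite mxtens_indexK.
Qed.

End Tensor.

Section Fock.
Variable C : numClosedFieldType.

Definition qubit_ann : 'M[C]_2 := delta_mx 0 1.
Definition qubit_sign : 'M[C]_2 := diag_mx (\row_x (-1) ^+ x).

Fixpoint fock_dim (n : nat) : nat := if n is m.+1 then (2 * fock_dim m)%N else 1%N.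

(* The Jordan-Wigner form of the annihilation operators. *)
Fixpoint ann (n : nat) : nat -> 'M[C]_(fock_dim n) :=
  match n with
  | 0%N => fun=> 0
  | m.+1 => fun i => if i is j.+1 then qubit_sign *t ann m j else qubit_ann *t 1%:M
  end.

Definition cre n i := (ann n i)^T.

(** The occupation number of mode i in the basis state x. *)
Fixpoint bit (n : nat) : 'I_(fock_dim n) -> nat -> nat :=
  match n with
  | 0%N => fun _ _ => 0%N
  | m.+1 => fun x i => if i is j.+1 then bit (mxtens_unindex x).2 j
                       else (mxtens_unindex x).1 : nat
  end.

Lemma qubit_ann2 : qubit_ann *m qubit_ann = 0.
Proof. by rewrite mul_delta_mx_0. Qed.

Lemma qubit_annS : qubit_ann *m qubit_sign = - qubit_ann.
Proof.
rewrite mul_mx_diag; apply/matrixP => i j; rewrite !mxE.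
by case: (j =P 1) => [->|]; rewrite ?andbF ?oppr0 ?mul0r //= expr1 mulrN1.
Qed.

Lemma qubit_Sann : qubit_sign *m qubit_ann = qubit_ann.
Proof.
rewrite mul_diag_mx; apply/matrixP => i j; rewrite !mxE.
by case: (i =P 0) => [->|]; rewrite ?mulr0 ?expr0 ?mul1r.
Qed.

Lemma qubit_signT : qubit_sign^T = qubit_sign.
Proof. exact: tr_diag_mx. Qed.

Lemma qubit_sign2 : qubit_sign *m qubit_sign = 1%:M.
Proof.
rewrite mulmx_diag; apply/matrixP => i j; rewrite !mxE.
by rewrite -expr2 sqrr_sign.
Qed.

Lemma qubit_cre_ann : qubit_ann^T *m qubit_ann = diag_mx (\row_x (x : nat)%:R).
Proof.
rewrite trmx_delta mul_delta_mx; apply/matrixP => i j; rewrite !mxE.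
by case: i => [[|[|i]] hi] //; case: j => [[|[|j]] hj].
Qed.

Lemma qubit_CAR : qubit_ann *m qubit_ann^T + qubit_ann^T *m qubit_ann = 1%:M.
Proof.
rewrite trmx_delta !mul_delta_mx; apply/matrixP => i j; rewrite !mxE.
by case: i => [[|[|i]] hi] //; case: j => [[|[|j]] hj] //=; rewrite ?addr0 ?add0r.
Qed.

Lemma ann_anti n i j : ann n i *m ann n j + ann n j *m ann n i = 0.
Proof.
elim: n i j => [|n IH] [|i] [|j] /=; rewrite ?mul0mx ?addr0 //.
- by rewrite tensmx_mul qubit_ann2 tens0mx addr0.
- by rewrite !tensmx_mul mul1mx mulmx1 qubit_annS qubit_Sann tensmxNl addNr.
- by rewrite !tensmx_mul mul1mx mulmx1 qubit_annS qubit_Sann tensmxNl subrr.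
- by rewrite !tensmx_mul qubit_sign2 -tensmxDr IH tensmx0.
Qed.

Lemma cre_anti n i j : cre n i *m cre n j + cre n j *m cre n i = 0.
Proof. by rewrite /cre -!trmx_mul -linearD /= ann_anti trmx0. Qed.

Lemma ann_cre n i j : (i < n)%N ->
  ann n i *m cre n j + cre n j *m ann n i = (i == j)%:R%:M.
Proof.
rewrite /cre; elim: n i j => [|n IH] [|i] [|j] //= lt_in; rewrite !trmx_tens !tensmx_mul ?trmx1.
- by rewrite !mulmx1 -tensmxDl qubit_CAR tensmx11.
- rewrite mul1mx mulmx1 qubit_signT qubit_annS qubit_Sann tensmxNl addNr.
  by rewrite (_ : 0%:M = 0) //; apply/matrixP => a b; rewrite !mxE mul0rn.
- rewrite mulmx1 mul1mx -[qubit_sign in X in X + _]qubit_signT -[qubit_sign in X in _ + X]qubit_signT.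
  rewrite -!trmx_mul qubit_annS qubit_Sann linearN /= tensmxNl addNr.
  by rewrite (_ : 0%:M = 0) //; apply/matrixP => a b; rewrite !mxE mul0rn.
- rewrite qubit_signT qubit_sign2 -tensmxDr IH // eqSS.
  case: (i == j); first exact: tensmx11.
  by rewrite !mulr0n !raddf0 tensmx0.
Qed.

Lemma cre_ann n i : cre n i *m ann n i = diag_mx (\row_x (bit x i)%:R).
Proof.
rewrite /cre; elim: n i => [|n IH] [|i] /=.
- by rewrite mulmx0; apply/matrixP => a b; rewrite !mxE mul0rn.
- by rewrite mulmx0; apply/matrixP => a b; rewrite !mxE mul0rn.
- rewrite trmx_tens tensmx_mul trmx1 mulmx1 qubit_cre_ann.
  rewrite [1%:M](_ : _ = diag_mx (\row_x 1)); last by apply/matrixP => a b; rewrite !mxE.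
  rewrite tens_diag; congr diag_mx; apply/rowP => x; by rewrite !mxE mulr1.
- rewrite trmx_tens tensmx_mul qubit_signT qubit_sign2 IH.
  rewrite [1%:M](_ : _ = diag_mx (\row_x 1)); last by apply/matrixP => a b; rewrite !mxE.
  rewrite tens_diag; congr diag_mx; apply/rowP => x; by rewrite !mxE mul1r.
Qed.

Lemma conj_ann n i : map_mx Num.conj (ann n i) = ann n i.
Proof.
elim: n i => [|n IH] [|i] /=; rewrite ?map_mx0 //= map_mxT ?IH; congr (_ *t _).
- by apply/matrixP => a b; rewrite !mxE rmorph_nat.
- by rewrite map_mx1.
- by apply/matrixP => a b; rewrite !mxE rmorphMn rmorph_sign.
Qed.

Lemma adjmx_ann n i : adjmx (ann n i) = cre n i.
Proof. by rewrite /adjmx -map_trmx conj_ann. Qed.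

(** The basis states are all bit strings, chosen independently in each mode. *)
Lemma sum_bit (R : comNzRingType) n (f : nat -> nat -> R) :
  \sum_(x < fock_dim n) \prod_(i < n) f i (bit x i) = \prod_(i < n) (f i 0%N + f i 1%N).
Proof.
elim: n f => [|n IH] f; first by rewrite big_ord1 !big_ord0.
under eq_bigr do rewrite big_ord_recl /=.
rewrite (big_tens (fun (a : 'I_2) (y : 'I_(fock_dim n)) =>
   f 0%N a * \prod_(i < n) f (bump 0 i) (bit y i))) big_ord_recl.
under eq_bigr do rewrite -mulr_sumr (IH (fun i => f i.+1)).
by rewrite -mulr_suml !big_ord_recl big_ord0 addr0.
Qed.

Lemma bit_inj n (x y : 'I_(fock_dim n)) :
  (forall i, (i < n)%N -> bit x i = bit y i) -> x = y.
Proof.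
elim: n x y => [|n IH] x y e; first by rewrite !ord1.
rewrite -[x]mxtens_unindexK -[y]mxtens_unindexK; congr mxtens_index.
have e0 : (mxtens_unindex x).1 = (mxtens_unindex y).1 by apply: ord_inj; exact: (e 0%N).
have eS : (mxtens_unindex x).2 = (mxtens_unindex y).2 := IH _ _ (fun i => e i.+1).
by rewrite [mxtens_unindex x]surjective_pairing e0 eS -surjective_pairing.
Qed.

Lemma bit_lt2 n (x : 'I_(fock_dim n)) i : (bit x i < 2)%N.
Proof.
elim: n x i => [|n IH] x [|i]; [by [] | by [] | | exact: IH].
exact: ltn_ord (mxtens_unindex x).1.
Qed.

Lemma exists_bits n (b : nat -> bool) :
  exists x : 'I_(fock_dim n), forall i, (i < n)%N -> bit x i = b i.
Proof.
elim: n b => [|n IH] b; first by exists 0.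
have [x xP] := IH (fun i => b i.+1).
pose y : 'I_(2 * fock_dim n) := mxtens_index (inord (b 0%N), x).
have yE : mxtens_unindex y = (inord (b 0%N), x) by rewrite mxtens_indexK.
exists y => -[|i] lt_i.
  rewrite (_ : bit _ _ = (mxtens_unindex y).1) // yE inordK //; by case: (b 0%N).
by rewrite (_ : bit _ _ = bit (mxtens_unindex y).2 i) // yE; exact: xP.
Qed.

End Fock.

Section Spin.
Variables (C : numClosedFieldType) (n : nat).
Implicit Types (p q s t : 'I_(n + n)) (X Y : 'M[C]_(n + n)).

Definition clifford p : 'M[C]_(fock_dim n) :=
  match split p with inl i => cre C n i | inr i => ann C n i end.

Lemma clifford_lshift i : clifford (lshift n i) = cre C n i.
Proof. by rewrite /clifford (unsplitK (inl _ i)). Qed.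

Lemma clifford_rshift i : clifford (rshift n i) = ann C n i.
Proof. by rewrite /clifford (unsplitK (inr _ i)). Qed.

Lemma cliffordD p q :
  clifford p *m clifford q + clifford q *m clifford p = (q == dual p)%:R%:M.
Proof.
case: (split_ordP p) => i ->; case: (split_ordP q) => j ->;
  rewrite ?dual_lshift ?dual_rshift ?clifford_lshift ?clifford_rshift
    ?eq_lrshift ?eq_rlshift ?eq_lshift ?eq_rshift.
- by rewrite cre_anti raddf0.
- by rewrite addrC ann_cre.
- by rewrite ann_cre // eq_sym.
- by rewrite ann_anti raddf0.
Qed.

Lemma adjmx_clifford p : adjmx (clifford p) = clifford (dual p).
Proof.
case: (split_ordP p) => i ->; rewrite ?dual_lshift ?dual_rshift ?clifford_lshift ?clifford_rshift.
  by rewrite -adjmx_ann adjmxK.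
exact: adjmx_ann.
Qed.

(** The embedding of so_2n as quadratic elements of the Clifford algebra. The factor one half makes
    the commutator with [clifford p] the action on the vector representation. *)
Definition spin_act X : 'M[C]_(fock_dim n) :=
  2%:R^-1 *: \sum_p \sum_q X p (dual q) *: (clifford p *m clifford q).

Lemma spin_act_linear a X Y : in_so X -> in_so Y ->
  spin_act (a *: X + Y) = a *: spin_act X + spin_act Y.
Proof.
move=> _ _; rewrite /spin_act [in RHS]scalerA mulrC -scalerA -scalerDr; congr (_ *: _).
rewrite scaler_sumr -big_split; apply: eq_bigr => p _ /=.
rewrite scaler_sumr -big_split; apply: eq_bigr => q _ /=.
by rewrite !mxE scalerDl scalerA.
Qed.

Lemma spin_act_Fso p q :
  spin_act (Fso p q) = 2%:R^-1 *: (clifford p *m clifford q - clifford q *m clifford p).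
Proof.
rewrite /spin_act; congr (_ *: _).
have E s t : Fso p q s (dual t) = ((s == p) && (t == q))%:R - ((s == q) && (t == p))%:R :> C.
  by rewrite FsoE !(inj_eq (can_inj (@dualK n))).
transitivity (\sum_s \sum_t (((s == p) && (t == q))%:R *: (clifford s *m clifford t)
   - ((s == q) && (t == p))%:R *: (clifford s *m clifford t))).
  by apply: eq_bigr => s _; apply: eq_bigr => t _; rewrite E scalerBl.
under eq_bigr do rewrite sumrB.
have D u v : \sum_s \sum_t ((s == u) && (t == v))%:R *: (clifford s *m clifford t) =
    clifford u *m clifford v.
  rewrite (bigD1 u) //= eqxx (bigD1 v) //= eqxx scale1r !big1 ?addr0 //.
    by move=> s su; rewrite big1 // => t _; rewrite (negPf su) scale0r.
  by move=> t tv; rewrite (negPf tv) scale0r.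
by rewrite sumrB !D.
Qed.

Lemma clifford_comm2 s t p :
  lieb (clifford s *m clifford t) (clifford p) =
  (p == dual t)%:R *: clifford s - (p == dual s)%:R *: clifford t.
Proof.
have eC u : clifford u *m clifford p = (p == dual u)%:R%:M - clifford p *m clifford u.
  by rewrite -cliffordD addrK.
rewrite /lieb -mulmxA eC mulmxBr !mulmxA eC mulmxBl mul_mx_scalar mul_scalar_mx.
by rewrite opprB [_ - (_ *: _)]addrC addrA addrK.
Qed.

Lemma spin_act_clifford X p : in_so X ->
  lieb (spin_act X) (clifford p) = \sum_a X a p *: clifford a.
Proof.
move=> /in_soP eX; rewrite /lieb /spin_act -scalemxAl -scalemxAr -scalerBr.
rewrite mulmx_suml mulmx_sumr -sumrB.
under eq_bigr => s _.
  rewrite mulmx_suml mulmx_sumr -sumrB.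
  under eq_bigr => t _ do
    rewrite -scalemxAl -scalemxAr -scalerBr -[_ - _]/(lieb _ _) clifford_comm2 scalerBr !scalerA.
  rewrite sumrB.
  over.
rewrite sumrB [X in _ - X]exchange_big /= -sumrB.
transitivity (2%:R^-1 *: \sum_s (2%:R * X s p) *: clifford s); last first.
  rewrite scaler_sumr; apply: eq_bigr => s _.
  by rewrite scalerA mulrA mulVf ?mul1r // pnatr_eq0.
congr (_ *: _); apply: eq_bigr => s _.
rewrite (bigD1 (dual p)) //= dualK eqxx mulr1 big1 => [|t tp]; last first.
  by rewrite [p == _]eq_dualC (negPf tp) mulr0 scale0r.
rewrite (bigD1 (dual p)) //= dualK eqxx mulr1 big1 => [|t tp]; last first.
  by rewrite [p == _]eq_dualC (negPf tp) mulr0 scale0r.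
by rewrite !addr0 [X (dual p) _]eX !dualK scaleNr opprK -scalerDl mulr_natl mulr2n.
Qed.

(** The commutator with [spin_act X] is a derivation known on generators, hence on products of two.
    The coefficients then match, for one family by renaming indices, for the other by the skew
    symmetry of X as well. *)
Lemma spin_act_lieb X Y : in_so X -> in_so Y ->
  spin_act (lieb X Y) = lieb (spin_act X) (spin_act Y).
Proof.
move=> sX sY; have /in_soP eX := sX; have /in_soP eY := sY.
have step p q : lieb (spin_act X) (clifford p *m clifford q) =
    \sum_a (X a p *: (clifford a *m clifford q) + X a q *: (clifford p *m clifford a)).
  rewrite big_split /=; under eq_bigr do rewrite scalemxAl.
  rewrite -mulmx_suml -spin_act_clifford //.
  under [X in _ + X]eq_bigr do rewrite scalemxAr.
  rewrite -mulmx_sumr -spin_act_clifford // /lieb mulmxBl mulmxBr !mulmxA.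
  by rewrite addrA subrK.
rewrite [spin_act Y]/spin_act [lieb (spin_act X) _](_ : _ = 2%:R^-1 *:
    \sum_p \sum_q Y p (dual q) *: lieb (spin_act X) (clifford p *m clifford q)); last first.
  move: (spin_act X) => S; rewrite /lieb -scalemxAl -scalemxAr -scalerBr mulmx_suml mulmx_sumr -sumrB.
  congr (_ *: _); apply: eq_bigr => p _; rewrite mulmx_suml mulmx_sumr -sumrB.
  by apply: eq_bigr => q _; rewrite -scalemxAl -scalemxAr scalerBr.
rewrite /spin_act; congr (_ *: _).
transitivity (\sum_p \sum_q \sum_a
    ((X p a * Y a (dual q)) *: (clifford p *m clifford q)
     - (Y p a * X a (dual q)) *: (clifford p *m clifford q))).
  apply: eq_bigr => p _; apply: eq_bigr => q _.
  by rewrite sumrB -!scaler_suml -scalerBl !mxE.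
transitivity (\sum_p \sum_q \sum_a
    ((Y p (dual q) * X a p) *: (clifford a *m clifford q)
     + (Y p (dual q) * X a q) *: (clifford p *m clifford a))); last first.
  apply: eq_bigr => p _; apply: eq_bigr => q _; rewrite step scaler_sumr.
  by apply: eq_bigr => a _; rewrite scalerDr !scalerA.
have spl (I : finType) (V : zmodType) (f g : I -> I -> I -> V) :
    \sum_p \sum_q \sum_a (f p q a + g p q a) =
    \sum_p \sum_q \sum_a f p q a + \sum_p \sum_q \sum_a g p q a.
  by rewrite -big_split; apply: eq_bigr => p _; rewrite -big_split; apply: eq_bigr => q _;
    rewrite -big_split.
rewrite !spl; congr (_ + _).
  rewrite [RHS]exchange_big [LHS]exchange_big; apply: eq_bigr => q _.
  rewrite [RHS]exchange_big; apply: eq_bigr => p _; apply: eq_bigr => a _.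
  by rewrite mulrC.
apply: eq_bigr => p _; rewrite [RHS]exchange_big; apply: eq_bigr => q _.
rewrite (reindex_inj (can_inj (@dualK n))); apply: eq_bigr => a _.
by rewrite [X (dual a) _]eX !dualK mulrN scaleNr opprK.
Qed.

Definition spin_rep : rep C n := Rep spin_act_linear spin_act_lieb.

Lemma spin_unitary : unitary_rep spin_rep.
Proof.
move=> p q; rewrite /rF /= !spin_act_Fso -!adjmx_clifford -!adjmxM /adjmx linearZ linearB /=.
rewrite map_mxZ map_mxB /=; congr (_ *: _).
by rewrite fmorphV rmorph_nat.
Qed.

Lemma spin_cartan :
  cartan_diagonal (r := spin_rep) (fun x i => (bit x i)%:R - 2%:R^-1).
Proof.
move=> i; rewrite /rF /= spin_act_Fso.
rewrite (_ : clifford (rshift n i) *m _ =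
   1%:M - clifford (lshift n i) *m clifford (rshift n i)); last first.
  by have := cliffordD (rshift n i) (lshift n i); rewrite dual_rshift eqxx => <-; rewrite addrK.
rewrite opprB addrA clifford_lshift clifford_rshift cre_ann.
apply/matrixP => x y; rewrite !mxE; case: (x == y); rewrite ?mulr0n ?addr0 ?subr0 ?mulr0 //.
by rewrite !mulr1n; field.
Qed.

End Spin.

Section TensorPower.
Variables (C : numClosedFieldType) (n : nat).
Implicit Types (p q : 'I_(n + n)) (r s : rep C n).

Lemma rF_tens r s p q : rF (rep_tens r s) p q = rF r p q *t 1%:M + 1%:M *t rF s p q.
Proof. by []. Qed.

Lemma adjmxD a b (M N : 'M[C]_(a, b)) : adjmx (M + N) = adjmx M + adjmx N.
Proof. by rewrite /adjmx linearD map_mxD. Qed.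

Lemma adjmx1 a : adjmx (1%:M : 'M[C]_a) = 1%:M.
Proof. by rewrite /adjmx trmx1 map_mx1. Qed.

Lemma unitary_tens r s : unitary_rep r -> unitary_rep s -> unitary_rep (rep_tens r s).
Proof.
by move=> ur us p q; rewrite !rF_tens adjmxD !adjmx_tens ur us !adjmx1.
Qed.

Lemma unitary_pow r N : unitary_rep r -> unitary_rep (rep_pow r N).
Proof.
move=> ur; elim: N => [|N IH]; last exact: unitary_tens.
by move=> p q; rewrite /rF /= /adjmx trmx0 map_mx0.
Qed.

(** Weights are kept as natural numbers minus one common shift, so that the character becomes a
    polynomial. Tensor products add both the numbers and the shifts. *)
Lemma cartan_pow r (a : 'I_(rdim r) -> 'I_n -> nat) (s : C) N :
  cartan_diagonal (r := r) (fun x i => (a x i)%:R - s) ->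
  exists b : 'I_(rdim (rep_pow r N)) -> 'I_n -> nat,
    cartan_diagonal (r := rep_pow r N) (fun x i => (b x i)%:R - s *+ N) /\
    forall (R : comNzRingType) (y : 'I_n -> R),
      \sum_x \prod_i y i ^+ b x i = (\sum_x \prod_i y i ^+ a x i) ^+ N.
Proof.
move=> car; elim: N => [|N [b [carb genb]]].
  exists (fun _ _ => 0%N); split=> [i|R y].
    by rewrite /rF /=; apply/matrixP => x y; rewrite !mxE subr0 mul0rn.
  by rewrite expr0; apply: etrans (big_ord1 _ _) _; rewrite big1 // => i _; rewrite expr0.
pose c (x : 'I_(rdim r * rdim (rep_pow r N))) i :=
  (a (mxtens_unindex x).1 i + b (mxtens_unindex x).2 i)%N.
exists c; split=> [i|R y].
  rewrite rF_tens car carb.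
  have e m : (1%:M : 'M[C]_m) = diag_mx (\row_x 1) by apply/matrixP => x y; rewrite !mxE.
  rewrite !e !tens_diag -linearD /=; congr diag_mx; apply/rowP => x.
  by rewrite !mxE mulr1 mul1r natrD mulrS opprD addrACA.
under eq_bigr => x _.
  under eq_bigr do rewrite exprD.
  rewrite big_split /=.
  over.
rewrite (big_tens (fun x z => (\prod_i y i ^+ a x i) * \prod_i y i ^+ b z i)).
by under eq_bigr do rewrite -mulr_sumr; rewrite -mulr_suml genb exprS.
Qed.

End TensorPower.

(** * Invariance of multiplicities under isomorphism *)

Section Isomorphism.
Variables (C : numClosedFieldType) (n : nat).
Implicit Types (r s : rep C n) (X : 'M[C]_(n + n)).

Definition intertwines r s (P : 'M[C]_(rdim s, rdim r)) :=
  forall X, in_so X -> ract s X *m P = P *m ract r X.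

Definition rep_iso r s := exists (P : 'M[C]_(rdim s, rdim r)) (Q : 'M[C]_(rdim r, rdim s)),
  [/\ P *m Q = 1%:M, Q *m P = 1%:M & intertwines P].

Lemma intertwines_inv r s (P : 'M[C]_(rdim s, rdim r)) (Q : 'M[C]_(rdim r, rdim s)) :
  P *m Q = 1%:M -> Q *m P = 1%:M -> intertwines P -> intertwines Q.
Proof.
move=> PQ QP iP X sX.
by rewrite -[ract r X]mul1mx -QP -!mulmxA (mulmxA P) -iP // -!mulmxA PQ mulmx1.
Qed.

Lemma iso_sym r s : rep_iso r s -> rep_iso s r.
Proof.
by move=> [P [Q [PQ QP iP]]]; exists Q, P; split=> //; apply: (intertwines_inv PQ QP).
Qed.

Lemma tens_iso r r' s s' : rep_iso r r' -> rep_iso s s' ->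
  rep_iso (rep_tens r s) (rep_tens r' s').
Proof.
move=> [P [Q [PQ QP iP]]] [P' [Q' [PQ' QP' iP']]].
exists (P *t P'), (Q *t Q'); split.
- by rewrite tensmx_mul PQ PQ' tensmx11.
- by rewrite tensmx_mul QP QP' tensmx11.
- move=> X sX; rewrite /= /tens_act mulmxDl mulmxDr !tensmx_mul !mul1mx !mulmx1.
  by rewrite iP // iP'.
Qed.

Lemma pow_iso r s N : rep_iso r s -> rep_iso (rep_pow r N) (rep_pow s N).
Proof.
move=> rs; elim: N => [|N IH]; last exact: tens_iso.
exists 1%:M, 1%:M; split; rewrite ?mulmx1 //.
by move=> X sX; rewrite mulmx1 mul1mx.
Qed.

Definition image_vs a b (M : 'M[C]_(b, a)) (U : {vspace 'cV[C]_a}) : {vspace 'cV[C]_b} :=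
  (linfun (mulmx M) @: U)%VS.

Lemma image_vsP a b (M : 'M[C]_(b, a)) (U : {vspace 'cV[C]_a}) v :
  reflect (exists2 u, u \in U & v = M *m u) (v \in image_vs M U).
Proof.
by apply: (iffP memv_imgP) => -[u uU ->]; exists u; rewrite ?lfunE.
Qed.

Lemma image_vsK a b (M : 'M[C]_(b, a)) (M' : 'M[C]_(a, b)) (U : {vspace 'cV[C]_a}) :
  M' *m M = 1%:M -> image_vs M' (image_vs M U) = U.
Proof.
move=> MM; apply/vspaceP => u; apply/image_vsP/idP => [[_ /image_vsP[w wU ->] ->]|uU].
  by rewrite mulmxA MM mul1mx.
by exists (M *m u); [apply/image_vsP; exists u | rewrite mulmxA MM mul1mx].
Qed.

Lemma image_vsS a b (M : 'M[C]_(b, a)) (U V : {vspace 'cV[C]_a}) :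
  (U <= V)%VS -> (image_vs M U <= image_vs M V)%VS.
Proof. exact: limgS. Qed.

Lemma image_vs0 a b (M : 'M[C]_(b, a)) : image_vs M 0 = 0%VS.
Proof. exact: limg0. Qed.

Lemma image_submodule r s (M : 'M[C]_(rdim s, rdim r)) U :
  intertwines M -> submodule U -> submodule (image_vs M U).
Proof.
move=> iM sU X sX _ /image_vsP[u uU ->]; apply/image_vsP; exists (ract r X *m u).
  exact: sU.
by rewrite !mulmxA iM.
Qed.

Lemma image_irr_hw r s (P : 'M[C]_(rdim s, rdim r)) (Q : 'M[C]_(rdim r, rdim s)) mu U :
  P *m Q = 1%:M -> Q *m P = 1%:M -> intertwines P ->
  is_irr_hw_sub mu U -> is_irr_hw_sub mu (image_vs P U).
Proof.
move=> PQ QP iP [[sU U0 irr] [v vU [v0 wv kv]]].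
have iQ := intertwines_inv PQ QP iP.
have inj M : image_vs P M = 0%VS -> M = 0%VS.
  by move=> e; rewrite -(image_vsK M QP) e image_vs0.
split; first split; first exact: image_submodule.
- by move/inj.
- move=> W sW WU; have sQW := image_submodule iQ sW.
  have := image_vsS Q WU; rewrite (image_vsK _ QP) => /(irr _ sQW).
  by rewrite -[in X in _ -> X](image_vsK W PQ); case=> ->; [left; rewrite image_vs0 | right].
exists (P *m v); first by apply/image_vsP; exists v.
split.
- by apply: contraNneq v0 => Pv; rewrite -[v]mul1mx -QP -mulmxA Pv mulmx0.
- by move=> h; rewrite mulmxA (iP _ (in_so_cartan h)) -mulmxA wv scalemxAr.
- by move=> A B uA eB; rewrite mulmxA (iP _ (upper_in_so A eB)) -mulmxA kv // mulmx0.
Qed.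

Lemma iso_multiplicity r s mu m :
  rep_iso r s -> has_multiplicity mu r m -> has_multiplicity mu s m.
Proof.
move=> [P [Q [PQ QP iP]]] [N [nu [U [irr dU sU cnt]]]].
have eF : image_vs P fullv = fullv.
  apply/vspaceP => v; rewrite memvf.
  by apply/image_vsP; exists (Q *m v); rewrite ?memvf // mulmxA PQ mul1mx.
have e : (\sum_i image_vs P (U i))%VS = fullv by rewrite /image_vs -limg_sum sU.
have dim M : \dim (image_vs P M) = \dim M.
  apply: limg_dim_eq; apply/eqP; rewrite -subv0; apply/subvP => u /memv_capP[_].
  rewrite memv_ker lfunE /= memv0 => /eqP Pu.
  by rewrite -[u]mul1mx -QP -mulmxA Pu mulmx0.
exists N, nu, (fun i => image_vs P (U i)).
split=> //; first by move=> i; apply: image_irr_hw PQ QP iP (irr i).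
move: dU; rewrite !directvE /= sU e => /eqP dU.
by under eq_bigr do rewrite dim; rewrite -dU -eF dim.
Qed.

End Isomorphism.

(** * The intertwiner from an irreducible module to a unitary one *)

Section Level.
Variables (C : numClosedFieldType) (n : nat) (r : rep C n).
Implicit Types (p q : 'I_(n + n)) (u v w : 'cV[C]_(rdim r)) (mu : 'rV[C]_n).

Definition level_op : 'M[C]_(rdim r) :=
  \sum_(i < n) (n - i)%N%:R *: rF r (lshift n i) (rshift n i).

Lemma level_op_comm p q :
  level_op *m rF r p q = rF r p q *m level_op + (height p + height q)%:~R *: rF r p q.
Proof.
rewrite mulmx_suml mulmx_sumr intrD -!omega_height -big_split scaler_suml -big_split.
apply: eq_bigr => i _; rewrite -scalemxAl rF_cartan_comm scalerDr -scalemxAr scalerA.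
by rewrite /= mulrDr.
Qed.

Lemma level_op_weight mu v : weight_vec mu v -> level_op *m v = level mu *: v.
Proof.
move=> wv; rewrite mulmx_suml scaler_suml; apply: eq_bigr => i _.
by rewrite -scalemxAl wv scalerA.
Qed.

Variable lev : C.

Inductive below : 'cV[C]_(rdim r) -> Prop :=
| below0 : below 0
| belowS (d : int) u v : d < 0 -> level_op *m u = (lev + d%:~R) *: u -> below v ->
    below (u + v).

Lemma below_lin a u v : below u -> below v -> below (a *: u + v).
Proof.
move=> bu bv; elim: bu => [|d x y d0 ex _ IH]; first by rewrite scaler0 add0r.
rewrite scalerDr -addrA; apply: (belowS d0) => //.
by rewrite -scalemxAr ex !scalerA mulrC.
Qed.

Lemma level_eigen_rF (d : int) p q u : level_op *m u = (lev + d%:~R) *: u ->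
  level_op *m (rF r p q *m u) = (lev + (d + (height p + height q))%:~R) *: (rF r p q *m u).
Proof.
move=> eu; rewrite mulmxA level_op_comm mulmxDl -mulmxA eu -scalemxAr -scalemxAl -scalerDl.
by rewrite (intrD _ d) addrA.
Qed.

Lemma below_rF p q u : height p + height q < 0 -> below u -> below (rF r p q *m u).
Proof.
move=> h; elim=> [|d x y d0 ex _ IH]; first by rewrite mulmx0; exact: below0.
rewrite mulmxDr; apply: (belowS _ (level_eigen_rF p q ex)) => //; lia.
Qed.

(** Eigenvectors for distinct eigenvalues are independent: the product of [level_op - (lev + d)]
    over the summands of u kills u, but on the eigenspace for [lev] it is multiplication by the
    nonzero product of the numbers -d. *)
Lemma below_top u : below u -> level_op *m u = lev *: u -> u = 0.
Proof.
pose T (d : int) (x : 'cV[C]_(rdim r)) : 'cV[C]_(rdim r) := level_op *m x - (lev + d%:~R) *: x.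
have TD ds x y : foldr T (x + y) ds = foldr T x ds + foldr T y ds.
  elim: ds => //= d ds IH; rewrite IH /T mulmxDr scalerDr opprD; exact: addrACA.
have T0 ds : foldr T 0 ds = 0 by elim: ds => //= d ds ->; rewrite /T mulmx0 scaler0 subr0.
have TE ds (e : int) x : level_op *m x = (lev + e%:~R) *: x ->
    foldr T x ds = (\prod_(d <- ds) (e - d)%:~R) *: x.
  move=> ex; elim: ds => [|d ds IH] /=; first by rewrite big_nil scale1r.
  rewrite IH /T big_cons -scalemxAr ex !scalerA -scalerBl; congr (_ *: _).
  rewrite rmorphB /=; ring.
move=> bu eu; have [ds [neg ez]] : exists ds, all (fun d : int => d < 0) ds /\ foldr T u ds = 0.
  elim: bu {eu} => [|d x y d0 ex _ [ds [neg ez]]]; first by exists [::].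
  exists (d :: ds); split; first by rewrite /= d0.
  rewrite TD (TE _ d x ex) big_cons subrr mul0r scale0r add0r /= ez.
  by rewrite /T mulmx0 scaler0 subr0.
apply/eqP; move: ez; rewrite (TE _ 0) ?addr0 // => /eqP; rewrite scaler_eq0.
case/orP => [|/eqP //]; rewrite prodf_seq_eq0 => /hasP[d /(allP neg) d0] /=.
by rewrite intr_eq0; lia.
Qed.

End Level.

Section Intertwiner.
Variables (C : numClosedFieldType) (n : nat) (r s : rep C n) (mu : 'rV[C]_n).
Variables (v : 'cV[C]_(rdim r)) (w : 'cV[C]_(rdim s)).
Hypotheses (irr_r : irreducible (fullv : {vspace 'cV[C]_(rdim r)})) (v0 : v != 0) (w0 : w != 0).
Hypotheses (hv : hw_vec mu v) (hw : hw_vec mu w) (unit_s : unitary_rep s).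
Implicit Types (p q : 'I_(n + n)).

(** The operators applied to w are moved to the other side of the product, where they preserve K. *)
Lemma gen_orth_stable (K : 'cV[C]_(rdim s) -> Prop) u z :
  (forall p q x, K x -> K (rF s p q *m x)) -> (forall x, K x -> dot w x = 0) ->
  gen w u -> K z -> dot u z = 0.
Proof.
move=> sK wK gu; elim: gu z => [|a x y _ ex _ ey|p q x _ _ IH] z Kz; first exact: wK.
  by rewrite dotZDl ex // ey // mulr0 addr0.
by rewrite dotC dot_adjmx unit_s dotC conjCK IH //; exact: sK.
Qed.

Let t := rep_sum r s.
Let vw : 'cV[C]_(rdim t) := col_mx v w.

Lemma rF_sum p q x z : rF t p q *m (col_mx x z : 'cV[C]_(rdim t)) =
  col_mx (rF r p q *m x) (rF s p q *m z).
Proof. by rewrite mul_block_col !mul0mx addr0 add0r. Qed.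

Lemma hw_vec_sum : hw_vec mu vw.
Proof.
split=> [i|p q h]; rewrite rF_sum; last by rewrite hv.2 // hw.2 // col_mx0.
by rewrite hv.1 hw.1 scale_col_mx.
Qed.

(** The same coefficient c governs both components. Only s is unitary, so what is left after
    removing c (v, w) is controlled by the grading in r and by orthogonality to w in s. *)
Lemma gen_graph u : gen vw u -> exists c,
  below (level mu) (usubmx (u : 'cV[C]_(rdim r + rdim s)) - c *: v) /\
  dot w (dsubmx (u : 'cV[C]_(rdim r + rdim s)) - c *: w) = 0.
Proof.
elim=> {u} [|a x y _ [c [bc dc]] _ [d [bd dd]]|p q x h _ [c [bc dc]]].
- exists 1; rewrite /vw col_mxKu col_mxKd !scale1r !subrr dot0r; split=> //; exact: below0.
- exists (a * c + d); rewrite !linearD !linearZ /= !scalerDl -!scalerA.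
  have E m (b1 b2 b3 b4 : 'cV[C]_m) :
      a *: b1 + b2 + (a *: (c *: - b3) + d *: - b4) = a *: (b1 - c *: b3) + (b2 - d *: b4).
    by rewrite !scalerN addrACA scalerBr.
  rewrite !E; split; first exact: below_lin.
  by rewrite dotZDr dc dd mulr0 addr0.
- rewrite -[x : 'cV[C]_(rdim r + rdim s)]vsubmxK rF_sum.
  move: (usubmx _) (dsubmx _) bc dc => xu xd bc dc.
  exists 0; rewrite col_mxKu col_mxKd !scale0r !subr0; split; last first.
    rewrite dot_adjmx unit_s hw.2; first by rewrite dotC dot0r rmorph0.
    by rewrite !height_dual; lia.
  rewrite -[xu](subrK (c *: v)) addrC mulmxDr -scalemxAr.
  apply: below_lin; last exact: below_rF.
  rewrite -[_ *m v]addr0; apply: (belowS h); last exact: below0.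
  have ev : level_op r *m v = (level mu + 0%:~R) *: v.
    by rewrite addr0 (level_op_weight hv.1).
  by have := level_eigen_rF p q ev; rewrite add0r.
Qed.

Lemma gen_graph_snd u : gen vw u -> gen w (dsubmx (u : 'cV[C]_(rdim r + rdim s))).
Proof.
elim=> {u} [|a x y _ gx _ gy|p q x h _ gx].
- by rewrite /vw col_mxKd; exact: gen_base.
- by rewrite linearD linearZ; exact: gen_lin.
- rewrite -[x : 'cV[C]_(rdim r + rdim s)]vsubmxK rF_sum !col_mxKd; exact: gen_lower.
Qed.

(* The submodule of r + s generated by (v, w) is the graph of the intertwiner. *)
Lemma gen_graph_fun z : gen vw (col_mx 0 z) -> z = 0.
Proof.
move=> gz; apply/eqP; rewrite -dot_eq0; apply/eqP.
have gwz : gen w z by have := gen_graph_snd gz; rewrite col_mxKd.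
apply: (@gen_orth_stable (fun z => gen vw (col_mx 0 z))) => // [p q x gx|x gx].
  by have := gen_act hw_vec_sum gx p q; rewrite rF_sum mulmx0.
have [c [bc dc]] := gen_graph gx.
rewrite col_mxKu sub0r in bc; rewrite col_mxKd in dc.
have ec : level_op r *m - (c *: v) = level mu *: - (c *: v).
  by rewrite mulmxN -scalemxAr (level_op_weight hv.1) scalerN !scalerA mulrC.
have /eqP := below_top bc ec; rewrite oppr_eq0 scaler_eq0 (negPf v0) orbF => /eqP c0.
by move: dc; rewrite c0 scale0r subr0.
Qed.

(** The graph projects onto a nonzero submodule of r, hence onto r, and by [gen_graph_fun] it is
    single-valued. The kernel of P is a submodule not containing v, hence 0. *)
Lemma intertwiner : exists P : 'M[C]_(rdim s, rdim r),
  [/\ intertwines P, P *m v = w, forall x : 'cV[C]_(rdim r), P *m x = 0 -> x = 0 &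
    forall x, gen w (P *m x)].
Proof.
have [G sG GP] := gen_vspace hw_vec_sum.
have tot x : exists z, gen vw (col_mx x z).
  have [||U UP] := @vspace_of_pred C 'cV[C]_(rdim r) (fun x => exists z, gen vw (col_mx x z)).
  - exists 0; rewrite col_mx0; exact: gen0.
  - move=> a y1 y2 [z1 g1] [z2 g2]; exists (a *: z1 + z2).
    by have := gen_lin a g1 g2; rewrite scale_col_mx add_col_mx.
  have sU : submodule U.
    apply/submoduleP => p q y /UP[z gz]; apply/UP; exists (rF s p q *m z).
    by rewrite -rF_sum; exact: (gen_act hw_vec_sum).
  have [_ _ /(_ U sU (subvf _))] := irr_r.
  have vU : v \in U by apply/UP; exists w; exact: gen_base.
  case=> [U0|Uf]; first by move: vU v0; rewrite U0 memv0 => ->.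
  by apply/UP; rewrite Uf memvf.
have [f fP] := fin_all_exists (fun j : 'I_(rdim r) => tot (delta_mx j 0)).
pose P : 'M[C]_(rdim s, rdim r) := \matrix_(i, j) f j i 0.
have PE x : P *m x = \sum_j x j 0 *: f j.
  apply/colP => i; rewrite mxE summxE; apply: eq_bigr => j _; by rewrite !mxE mulrC.
have gP x : gen vw (col_mx x (P *m x)).
  have {1}-> : x = \sum_j x j 0 *: delta_mx j 0.
    rewrite {1}[x]matrix_sum_delta; apply: eq_bigr => j _; by rewrite big_ord1.
  rewrite PE; apply: (big_rec2 (fun a b => gen vw (col_mx a b))).
    by rewrite col_mx0; exact: gen0.
  move=> j a b _ g; have := gen_lin (x j 0) (fP j) g.
  by rewrite scale_col_mx add_col_mx.
have fn x z1 z2 : gen vw (col_mx x z1) -> gen vw (col_mx x z2) -> z1 = z2.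
  move=> g1 g2; apply/eqP; rewrite -subr_eq0 addrC; apply/eqP/gen_graph_fun.
  have := gen_lin (-1) g2 g1; rewrite scale_col_mx add_col_mx !scaleN1r addNr; exact.
have Pv : P *m v = w by apply: fn (gP v) _; exact: gen_base.
have iP : intertwines P.
  move=> X sX; apply/matrixP => i j.
  suff e : ract s X *m P *m delta_mx j (0 : 'I_1) = P *m ract r X *m delta_mx j 0.
    by have := congr1 (fun M : 'cV_(rdim s) => M i 0) e; rewrite -!colE !mxE.
  rewrite -!mulmxA; apply: fn (gP _).
  have := sG X sX _ ((GP _).2 (gP (delta_mx j 0))).
  by rewrite mul_block_col !mul0mx addr0 add0r => /GP.
exists P; split=> //.
  have [||U UP] := @vspace_of_pred C 'cV[C]_(rdim r) (fun x => P *m x = 0).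
  - by rewrite mulmx0.
  - by move=> a x y ex ey; rewrite mulmxDr -scalemxAr ex ey scaler0 addr0.
  have sU : submodule U.
    by move=> X sX x /UP Px; apply/UP; rewrite mulmxA -iP // -mulmxA Px mulmx0.
  have [_ _ /(_ U sU (subvf _))] := irr_r.
  case=> [U0 x /UP|Uf x _]; first by rewrite U0 memv0 => /eqP.
  by case/eqP: w0; rewrite -Pv; apply/UP; rewrite Uf memvf.
by move=> x; have := gen_graph_snd (gP x); rewrite col_mxKd.
Qed.

End Intertwiner.

(** * The half-spin modules inside the Fock space *)

Section Dominance.
Variables (C : numClosedFieldType) (n : nat) (r : rep C n).
Implicit Types (p q : 'I_(n + n)) (mu : 'rV[C]_n).

Lemma rF_root_comm p q : p != q ->
  rF r p q *m rF r (dual q) (dual p) =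
  rF r (dual q) (dual p) *m rF r p q + (rF r p (dual p) + rF r q (dual q)).
Proof.
move=> pq; rewrite rF_comm !eqxx !scale1r !(inj_eq (can_inj (@dualK n))).
rewrite (eq_sym q) (negPf pq) !scale0r subr0 sub0r; congr (_ + (_ + _)).
by rewrite -rF_sym.
Qed.

Definition pairing mu p : C := \sum_i omega C p i * mu 0 i.

Lemma pairing_lshift mu i : pairing mu (lshift n i) = mu 0 i.
Proof.
rewrite /pairing (bigD1 i) //= big1 ?addr0 => [|j ji].
  by rewrite /omega eqxx eq_lrshift subr0 mul1r.
by rewrite /omega eq_lshift eq_lrshift [i == j]eq_sym (negPf ji) subrr mul0r.
Qed.

Lemma pairing_rshift mu i : pairing mu (rshift n i) = - mu 0 i.
Proof.
rewrite /pairing (bigD1 i) //= big1 ?addr0 => [|j ji].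
  by rewrite /omega eqxx eq_rlshift sub0r mulN1r.
by rewrite /omega eq_rlshift eq_rshift [i == j]eq_sym (negPf ji) subrr mul0r.
Qed.

Lemma rF_dual_weight mu (v : 'cV[C]_(rdim r)) p : weight_vec mu v -> rF r p (dual p) *m v = pairing mu p *: v.
Proof.
move=> wv; case: (split_ordP p) => i ->.
  by rewrite dual_lshift pairing_lshift wv.
by rewrite dual_rshift pairing_rshift rF_sym mulNmx wv scaleNr.
Qed.

Hypothesis unit_r : unitary_rep r.

(** For a root vector E with adjoint F, killing v by E gives |F v|^2 = (v, [E, F] v), and [E, F]
    multiplies v by the pairing of mu with the root. *)
Lemma hw_vec_dominant mu (v : 'cV[C]_(rdim r)) p q : v != 0 -> hw_vec mu v -> p != q ->
  0 < height p + height q -> 0 <= pairing mu p + pairing mu q.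
Proof.
move=> v0 [wv kv] pq h.
have dv : 0 < dot v v by rewrite Order.POrderTheory.lt_def dot_eq0 v0 dot_ge0.
rewrite -(pmulr_lge0 _ dv).
have <- : dot v (rF r p q *m (rF r (dual q) (dual p) *m v)) =
    (pairing mu p + pairing mu q) * dot v v.
  rewrite mulmxA rF_root_comm // !mulmxDl -mulmxA kv // mulmx0 add0r.
  rewrite !(rF_dual_weight _ wv) -scalerDl.
  by rewrite -[_ *: v]addr0 dotZDr dot0r addr0.
by rewrite dot_adjmx unit_r dot_ge0.
Qed.

End Dominance.

Section HalfSpin.
Variables (C : numClosedFieldType) (n : nat).
Hypothesis n0 : (0 < n)%N.
Implicit Types (p q : 'I_(n + n)) (x y : 'I_(fock_dim n)).

Definition spin_weight x : 'rV[C]_n := \row_i ((bit x i)%:R - 2%:R^-1).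

Lemma weight_vec_delta x :
  weight_vec (r := spin_rep C n) (spin_weight x) (delta_mx x 0).
Proof.
move=> i; rewrite spin_cartan mul_diag_mx; apply/colP => y; rewrite !mxE.
by case: eqP => [->|]; rewrite ?mulr0.
Qed.

Lemma weight_vec_entry mu (v : 'cV[C]_(fock_dim n)) y :
  weight_vec (r := spin_rep C n) mu v -> v y 0 != 0 -> mu = spin_weight y.
Proof.
move=> wv vy; apply/rowP => i; rewrite mxE; apply: (mulIf vy).
have := congr1 (fun M : 'cV_(fock_dim n) => M y 0) (wv i).
by rewrite spin_cartan mul_diag_mx !mxE.
Qed.

Lemma spin_weight_inj : injective spin_weight.
Proof.
move=> x y e; apply: (@bit_inj n) => i lt_i.
have := congr1 (fun M : 'rV_n => M 0 (Ordinal lt_i)) e; rewrite !mxE /= => /addIr /eqP.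
by rewrite eqr_nat => /eqP.
Qed.

Lemma weight_vec_line x (v : 'cV[C]_(fock_dim n)) :
  weight_vec (r := spin_rep C n) (spin_weight x) v -> v = v x 0 *: delta_mx x 0.
Proof.
move=> wv; apply/colP => y; rewrite !mxE eqxx andbT.
have [->|yx] := eqVneq y x; first by rewrite mulr1.
apply/eqP; rewrite mulr0; apply: contraNT yx => vy; apply/eqP/spin_weight_inj.
by rewrite (weight_vec_entry wv vy).
Qed.

(** A root vector shifts weights by its root. In the mode i of the hypothesis this would turn the
    occupation number 1 into 2, which no basis state has. *)
Lemma spin_killed x :
  (forall p q, 0 < height p + height q -> p != q ->
    exists i, omega C p i + omega C q i = 1 /\ bit x i = 1%N) ->
  killed (r := spin_rep C n) (delta_mx x 0).
Proof.
move=> H p q h; have [->|pq] := eqVneq p q.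
  have /eqP := rF_sym (spin_rep C n) q q; rewrite -addr_eq0 -mulr2n -scaler_nat scaler_eq0 pnatr_eq0 /=.
  by move=> /eqP ->; rewrite mul0mx.
have [i [wi bi]] := H p q h pq.
apply/eqP; apply: contraT => nz.
have /existsP[y vy] : [exists y, (rF (spin_rep C n) p q *m delta_mx x (0 : 'I_1)) y 0 != 0].
  apply: contraNT nz => /existsPn z; apply/eqP/colP => y; rewrite [RHS]mxE; apply/eqP.
  by have := z y; rewrite negbK.
have := weight_vec_entry (weight_vec_rF p q (weight_vec_delta x)) vy.
move/rowP/(_ i); rewrite !mxE wi bi addrAC => /addIr /eqP.
by rewrite -[1]/(1%:R) -natrD eqr_nat => /eqP e; have := bit_lt2 y i; rewrite -e.
Qed.

Lemma omega_lshift (i j : 'I_n) : omega C (lshift n i) j = (i == j)%:R.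
Proof. by rewrite /omega eq_lshift eq_lrshift subr0. Qed.

Lemma omega_rshift (i j : 'I_n) : omega C (rshift n i) j = - (i == j)%:R.
Proof. by rewrite /omega eq_rlshift eq_rshift sub0r. Qed.

Lemma spin_hw_vec x : (forall i, (i.+1 < n)%N -> bit x i = 1%N) ->
  hw_vec (r := spin_rep C n) (spin_weight x) (delta_mx x 0).
Proof.
move=> bx; split; [exact: weight_vec_delta | apply: spin_killed => p q].
case: (split_ordP p) => i ->; case: (split_ordP q) => j ->;
  rewrite ?height_lshift ?height_rshift ?(inj_eq (@lshift_inj _ _)) => h pq;
  have := ltn_ord i; have := ltn_ord j; move=> lt_j lt_i.
- have [lt_i1|] := ltnP i.+1 n.
    by exists i; rewrite !omega_lshift eqxx [j == i]eq_sym (negPf pq) addr0 bx.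
  move=> ge_i; exists j; rewrite !omega_lshift eqxx (negPf pq) add0r bx //.
  by move: pq; rewrite -val_eqE /=; lia.
- have ij : (i < j)%N by lia.
  exists i; rewrite omega_lshift omega_rshift eqxx bx; last by lia.
  by rewrite (_ : j == i = false) ?subr0 // -val_eqE /=; lia.
- have ij : (j < i)%N by lia.
  exists j; rewrite omega_lshift omega_rshift eqxx bx; last by lia.
  by rewrite (_ : i == j = false) ?oppr0 ?add0r // -val_eqE /=; lia.
- lia.
Qed.

(** If a mode i before the last were empty, then, the last coordinate being 1/2 or -1/2, the weight
    would pair to -1 with one of the positive roots e_i - e_n and e_i + e_n, against dominance. *)
Lemma spin_hw_bits mu (v : 'cV[C]_(fock_dim n)) :
  v != 0 -> hw_vec (r := spin_rep C n) mu v ->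
  exists x, [/\ mu = spin_weight x, v = v x 0 *: delta_mx x 0 &
                forall i, (i.+1 < n)%N -> bit x i = 1%N].
Proof.
move=> v0 hv; have /existsP[x vx] : [exists x, v x 0 != 0].
  apply: contraNT v0 => /existsPn z; apply/eqP/colP => y; rewrite [RHS]mxE; apply/eqP.
  by have := z y; rewrite negbK.
have e := weight_vec_entry hv.1 vx; exists x; split=> //.
  by apply: weight_vec_line; rewrite -e; exact: hv.1.
move=> i lt_i; have [i' [l' [ei lt_il]]] : exists (i' l' : 'I_n), (i' = i :> nat) /\ (i' < l')%N.
  have h1 : (i < n)%N by lia.
  have h2 : (n.-1 < n)%N by lia.
  by exists (Ordinal h1), (Ordinal h2); split=> //=; lia.
have := bit_lt2 x i; rewrite -ei.
case bi: (bit x i') => [|[|b]] // _.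
have neq : i' != l' by rewrite -val_eqE /=; lia.
have dom (q : 'I_(n + n)) : lshift n i' != q -> 0 < height (lshift n i') + height q ->
    0 <= - 2%:R^-1 + pairing mu q.
  move=> ne h; have := hw_vec_dominant (@spin_unitary C n) v0 hv ne h.
  by rewrite pairing_lshift e !mxE bi sub0r.
have hl := ltn_ord l'.
have h1 := dom (lshift n l'); have h2 := dom (rshift n l').
move: h1 h2; rewrite !height_lshift height_rshift eq_lrshift (inj_eq (@lshift_inj _ _)).
rewrite pairing_lshift pairing_rshift e !mxE => h1 h2.
have {h1} := h1 neq ltac:(lia); have {h2} := h2 isT ltac:(lia).
have := bit_lt2 x l'; case: (bit x l') => [|[|b]] // _.
  by move=> _; rewrite (_ : _ + _ = -1) ?oppr_ge0 ?ler10 //; field.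
by rewrite (_ : _ + _ = -1) ?oppr_ge0 ?ler10 //; field.
Qed.

(** The two intertwiners have orthogonal images, so together they are injective. If the image had a
    nonzero orthogonal complement, this would contain a highest weight vector; up to scalars the
    Fock space has only two, and both lie in the image. *)
Lemma half_spin_iso (Sprev Slast : rep C n) :
  is_irr_hw (Lambda_prev C n) Sprev -> is_irr_hw (Lambda_last C n) Slast ->
  rep_iso (rep_sum Sprev Slast) (spin_rep C n).
Proof.
move=> [irrp [vp _ /is_highest_weight_vectorP[vp0 hvp]]].
move=> [irrl [vl _ /is_highest_weight_vectorP[vl0 hvl]]].
have [xl xlP] := exists_bits n (fun=> true).
have [xp xpP] := exists_bits n (fun i => (i.+1 < n)%N).
have el : Lambda_last C n = spin_weight xl.
  by apply/rowP => i; rewrite !mxE xlP //=; field.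
have ep : Lambda_prev C n = spin_weight xp.
  apply/rowP => i; rewrite !mxE /neg_last xpP //.
  have [e|ne] := eqVneq i.+1 n; first by rewrite e ltnn sub0r.
  by rewrite ltn_neqAle ne ltn_ord /=; field.
have hwl : hw_vec (r := spin_rep C n) (Lambda_last C n) (delta_mx xl 0).
  by rewrite el; apply: spin_hw_vec => i lt_i; rewrite xlP //; lia.
have hwp : hw_vec (r := spin_rep C n) (Lambda_prev C n) (delta_mx xp 0).
  by rewrite ep; apply: spin_hw_vec => i lt_i; rewrite xpP ?lt_i //; lia.
have d0 x : (delta_mx x 0 : 'cV[C]_(fock_dim n)) != 0.
  by apply/eqP => /colP /(_ x) /eqP; rewrite !mxE !eqxx oner_eq0.
have us := @spin_unitary C n.
have [Pp [iPp Pvp injp genp]] := intertwiner (s := spin_rep C n) irrp vp0 (d0 xp) hvp hwp us.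
have [Pl [iPl Pvl injl genl]] := intertwiner (s := spin_rep C n) irrl vl0 (d0 xl) hvl hwl us.
have xpl : xp != xl.
  apply: contraTneq isT => e; have := xpP n.-1; rewrite e xlP; last by lia.
  by move=> /(_ ltac:(lia)); rewrite prednK // ltnn.
have orth u z : gen (delta_mx xp 0 : 'cV[C]_(rdim (spin_rep C n))) u ->
    gen (delta_mx xl 0 : 'cV[C]_(rdim (spin_rep C n))) z -> dot u z = 0.
  apply: (gen_orth_stable us (K := gen (delta_mx xl 0 : 'cV[C]_(rdim (spin_rep C n))))).
    by move=> p q x gx; exact: (gen_act hwl gx).
  move=> x; apply: (gen_orth us hwp.2); rewrite dotE big1 // => y _; rewrite !mxE.
  by case: (eqVneq y xp) => [->|]; rewrite ?(negPf xpl) ?mulr0 ?rmorph0 ?mul0r.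
pose M : 'M[C]_(rdim (spin_rep C n), rdim Sprev + rdim Slast) := row_mx Pp Pl.
have iM : @intertwines C n (rep_sum Sprev Slast) (spin_rep C n) M.
  by move=> X sX; rewrite /M mul_mx_row mul_row_block !mulmx0 addr0 add0r iPp // iPl.
have injM (z : 'cV[C]_(rdim Sprev + rdim Slast)) : M *m z = 0 -> z = 0.
  rewrite -[z]vsubmxK mul_row_col => /eqP; rewrite addr_eq0 => /eqP e.
  have zp : Pp *m usubmx z = 0.
    apply/eqP; rewrite -dot_eq0 {2}e -scaleN1r -[_ *: _]addr0 dotZDr dot0r addr0.
    by rewrite orth ?mulr0.
  have zl : Pl *m dsubmx z = 0 by apply/eqP; rewrite -oppr_eq0 -e zp.
  by rewrite (injp _ zp) (injl _ zl) col_mx0.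
have surM (y : 'cV[C]_(rdim (spin_rep C n))) : exists z, M *m z = y.
  pose U := image_vs M fullv.
  have sU : @submodule C n (spin_rep C n) U.
    apply: (@image_submodule C n (rep_sum Sprev Slast) (spin_rep C n)) iM _.
    by move=> X _ v _; exact: memvf.
  suff : y \in U by move=> /image_vsP[z _ ->]; exists z.
  have sF : @submodule C n (spin_rep C n) fullv by move=> X _ v _; exact: memvf.
  have [U' sU' U'P] := orth_submodule us sF sU.
  have [w wU wP] := orth_projection U y.
  have yw : y - w \in U' by apply/U'P; split=> //; exact: memvf.
  suff U'0 : U' = 0%VS.
    by move: yw; rewrite U'0 memv0 subr_eq0 => /eqP ->.
  apply: NNPP => U'0.
  have [mu [v [vU' v0 hv]]] := exists_hw_vec (@spin_cartan C n) sU' U'0.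
  have [x [_ vE bx]] := spin_hw_bits v0 hv.
  have vU : v \in U.
    rewrite vE rpredZ //; apply/image_vsP.
    have [bl|bl] := eqVneq (bit x n.-1) 1%N.
      exists (col_mx 0 vl); rewrite ?memvf // mul_row_col mulmx0 add0r Pvl.
      congr (delta_mx _ _); apply: (@bit_inj n) => i lt_i; rewrite xlP //.
      have [lt_i1|ge_i1] := ltnP i.+1 n; first by rewrite bx.
      by rewrite (_ : i = n.-1) ?bl //; lia.
    exists (col_mx vp 0); rewrite ?memvf // mul_row_col mulmx0 addr0 Pvp.
    congr (delta_mx _ _); apply: (@bit_inj n) => i lt_i; rewrite xpP //.
    have [lt_i1|ge_i1] := ltnP i.+1 n; first by rewrite bx.
    have := bit_lt2 x n.-1; rewrite (_ : i = n.-1); last by lia.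
    by case: (bit x n.-1) bl => [|[|b]].
  have [_ /(_ v vU) /eqP] := (U'P v).1 vU'.
  by rewrite dot_eq0 (negPf v0).
have [f fP] := fin_all_exists (fun j => surM (delta_mx j 0)).
pose Q : 'M[C]_(rdim Sprev + rdim Slast, rdim (spin_rep C n)) := \matrix_(i, j) f j i 0.
have Qf j : Q *m delta_mx j (0 : 'I_1) = f j by rewrite -colE; apply/colP => i; rewrite !mxE.
have MQ : M *m Q = 1%:M.
  apply/matrixP => i j; have := congr1 (fun N : 'cV_(fock_dim n) => N i 0) (fP j).
  by rewrite -Qf mulmxA -colE !mxE eqxx andbT.
exists M, Q; split=> //; apply/matrixP => i j.
have : M *m ((Q *m M - 1%:M) *m delta_mx j (0 : 'I_1)) = 0.
  by rewrite mulmxA mulmxBr mulmxA MQ mul1mx mulmx1 subrr mul0mx.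
move/injM; rewrite -colE => /colP /(_ i); rewrite !mxE => /eqP.
by rewrite subr_eq0 => /eqP.
Qed.

End HalfSpin.

(** * The Weyl denominator *)

Section Euler.
Variables (R : numFieldType) (n : nat).
Implicit Types (p q : {mpoly R[n]}) (i j k : 'I_n) (m : 'X_{1..n}).

(* The shift by c compensates the monomial by which all exponents are made
   nonnegative integers. *)
Definition euler (c : R) i p : {mpoly R[n]} := 'X_i * p^`M(i) - c *: p.

Lemma euler_is_linear c i : linear (euler c i).
Proof. by move=> a p q; rewrite /euler mderivD mderivZ -!mul_mpolyC; ring. Qed.

HB.instance Definition _ c i := GRing.isLinear.Build R {mpoly R[n]} {mpoly R[n]} _
  (euler c i) (euler_is_linear c i).

Lemma eulerD c i : {morph euler c i : p q / p + q}.
Proof. exact: linearD. Qed.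

Lemma eulerB c i : {morph euler c i : p q / p - q}.
Proof. exact: linearB. Qed.

Lemma eulerZ c i a : {morph euler c i : p / a *: p}.
Proof. exact: linearZ. Qed.

Lemma euler_sum c i (I : Type) (r : seq I) (P : pred I) (f : I -> {mpoly R[n]}) :
  euler c i (\sum_(a <- r | P a) f a) = \sum_(a <- r | P a) euler c i (f a).
Proof. exact: linear_sum. Qed.

Lemma eulerM a b i p q : euler (a + b) i (p * q) = euler a i p * q + p * euler b i q.
Proof. by rewrite /euler mderivM scalerDl -!mul_mpolyC; ring. Qed.

Lemma eulerX c i m : euler c i 'X_[m] = ((m i)%:R - c) *: 'X_[m].
Proof.
rewrite /euler mderivX scalerBl; congr (_ - _); rewrite -scalerAr -mpolyXD.
case E: (m i) => [|a]; first by rewrite !scale0r.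
congr (_ *: 'X_[_]); apply/mnmP => j; rewrite mnmDE mnmBE mnm1E.
by have [<-|] := eqVneq i j; rewrite ?E //=; lia.
Qed.

Lemma mcoeff_euler c i p m : (euler c i p)@_m = ((m i)%:R - c) * p@_m.
Proof.
rewrite [p in LHS]mpolyE [p in RHS]mpolyE linear_sum !raddf_sum mulr_sumr /=.
apply: eq_bigr => m' _; rewrite linearZ /= eulerX !mcoeffZ mcoeffX.
by have [->|_] := eqVneq m' m; rewrite ?mulr1 ?mulr0 // mulrC.
Qed.

Lemma euler1 i : euler 0 i 1 = 0.
Proof. by rewrite /euler scale0r subr0 -[1]/(1%:MP) mderivC mulr0. Qed.

Lemma euler_prod (I : eqType) (r : seq I) (c : I -> R) (g : I -> {mpoly R[n]}) i :
  uniq r ->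
  euler (\sum_(a <- r) c a) i (\prod_(a <- r) g a) =
  \sum_(a <- r) euler (c a) i (g a) * \prod_(b <- r | b != a) g b.
Proof.
elim: r => [|x r IH] /=; first by rewrite !big_nil euler1.
move=> /andP[xr ur]; rewrite !big_cons eulerM IH // eqxx /=; congr (_ * _ + _).
  rewrite [LHS]big_seq [RHS]big_seq_cond; apply: eq_bigl => y.
  case yr: (y \in r) => //=; apply/esym; apply: contraNneq xr => <-; exact: yr.
rewrite mulr_sumr; apply: eq_big_seq => a ar; rewrite big_cons ifT; last first.
  by apply: contraNneq xr => ->.
by rewrite mulrCA.
Qed.

End Euler.

Section WeylDenominator.
Variables (R : numFieldType) (n : nat).
Implicit Types (i j k : 'I_n) (m : 'X_{1..n}).

(* [(i, j, true)] and [(i, j, false)] with i < j index the positive roots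
   e_i + e_j and e_i - e_j. *)
Definition root_index := ('I_n * 'I_n * bool)%type.
Implicit Types (a b : root_index).

Definition root_lt a := (a.1.1 < a.1.2)%N.

Definition root_coord a k : R :=
  (a.1.1 == k)%:R + (if a.2 then 1 else -1) * (a.1.2 == k)%:R.

Definition root_factor a : {mpoly R[n]} :=
  if a.2 then 'X_a.1.1 * 'X_a.1.2 - 1 else 'X_a.1.1 - 'X_a.1.2.

(** For the root alpha, [root_factor] is e^(alpha/2) - e^(-alpha/2) times the square root of X_i
    X_j; this is e^(alpha/2) + e^(-alpha/2) times the same monomial. *)
Definition root_cofactor a : {mpoly R[n]} :=
  if a.2 then 'X_a.1.1 * 'X_a.1.2 + 1 else 'X_a.1.1 + 'X_a.1.2.

(* The Weyl denominator multiplied by the monomial prod_i X_i^(n-1), which clears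
   the negative and half-integral exponents. *)
Definition weyl_denominator : {mpoly R[n]} := \prod_(a : root_index | root_lt a) root_factor a.

Lemma euler_XU c i j : euler c i ('X_j : {mpoly R[n]}) = ((i == j)%:R - c) *: 'X_j.
Proof. by rewrite eulerX mnm1E eq_sym. Qed.

Lemma euler_cst c i : euler c i (1 : {mpoly R[n]}) = - c *: 1.
Proof. by rewrite -mpolyX0 eulerX mnm0E sub0r. Qed.

(** Differentiation of e^(alpha/2) - e^(-alpha/2) yields half the coordinate of alpha times the sum
    of the two exponentials. The subtracted term is the contribution of the square root of X_i
    X_j. *)
Lemma euler_root_factor a k : root_lt a ->
  2%:R *: euler 0 k (root_factor a) - ((a.1.1 == k)%:R + (a.1.2 == k)%:R) *: root_factor a =
  root_coord a k *: root_cofactor a.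
Proof.
case: a => [[i j] []] /=; rewrite /root_lt /root_coord /root_factor /root_cofactor /= => ij.
- rewrite eulerB euler1 subr0 mul1r.
  have -> : euler 0 k ('X_i * 'X_j) = ((i == k)%:R + (j == k)%:R) *: ('X_i * 'X_j) :> {mpoly R[n]}.
    rewrite -[X in euler X](addr0 0) eulerM !euler_XU !subr0 [j == k]eq_sym [i == k]eq_sym.
    by rewrite -!mul_mpolyC mpolyCD; ring.
  by rewrite -!mul_mpolyC !(mpolyCD, mpolyC_nat); ring.
- rewrite eulerB !euler_XU !subr0 [k == j]eq_sym [k == i]eq_sym -!mul_mpolyC.
  by rewrite !(mpolyCD, mpolyC_nat, mpolyCM, mpolyCN, mpolyC1); ring.
Qed.

Lemma big_root (T : Type) (idx : T) (op : Monoid.com_law idx) (f : root_index -> T) :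
  \big[op/idx]_(a | root_lt a) f a =
  \big[op/idx]_(i < n) \big[op/idx]_(j < n | (i < j)%N) op (f (i, j, true)) (f (i, j, false)).
Proof.
rewrite pair_big_dep /=.
transitivity (\big[op/idx]_(u : 'I_n * 'I_n | (u.1 < u.2)%N) \big[op/idx]_(c : bool) f (u, c)).
  by rewrite pair_big /=; apply: eq_big => [[u c]|[u c] _] //=; rewrite andbT.
by apply: eq_bigr => -[i j] _; rewrite big_bool.
Qed.

(** Each index occurs in 2(n - 1) positive roots, whence the shift n - 1 for the denominator. *)
Lemma sum_root_ends k :
  \sum_(a : root_index | root_lt a) ((a.1.1 == k)%:R + (a.1.2 == k)%:R) = 2%:R * n.-1%:R :> R.
Proof.
rewrite big_root /=; under eq_bigr do under eq_bigr do rewrite -mulr2n -[_ *+ 2]mulr_natl.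
under eq_bigr do rewrite -mulr_sumr.
rewrite -mulr_sumr; congr (_ * _).
under eq_bigr do rewrite big_split /=.
rewrite big_split /=.
have -> : \sum_(i < n) \sum_(j < n | (i < j)%N) (i == k)%:R = \sum_(j < n | (k < j)%N) 1 :> R.
  rewrite (bigD1 k) //= eqxx [X in _ + X]big1 ?addr0 // => i /negPf ->.
  by rewrite big1.
have -> : \sum_(i < n) \sum_(j < n | (i < j)%N) (j == k)%:R = \sum_(i < n | (i < k)%N) 1 :> R.
  rewrite (exchange_big_dep xpredT) //= (bigD1 k) //= eqxx [X in _ + X]big1 ?addr0 // => j /negPf ->.
  by rewrite big1.
have -> : \sum_(i < n | (k < i)%N) (1 : R) + \sum_(i < n | (i < k)%N) 1 = \sum_(i < n | i != k) 1.
  rewrite [RHS](bigID (fun i : 'I_n => k < i)%N) /=; congr (_ + _); apply: eq_bigl => i;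
    by rewrite -val_eqE /=; case: ltngtP.
by rewrite sumr_const cardC1 card_ord.
Qed.

Lemma euler_weyl_denominator k :
  2%:R *: euler n.-1%:R k weyl_denominator =
  \sum_(a : root_index | root_lt a) root_coord a k *:
     (root_cofactor a * \prod_(b : root_index | root_lt b && (b != a)) root_factor b).
Proof.
have two0 : 2%:R != 0 :> R by rewrite pnatr_eq0.
pose c a : R := 2%:R^-1 * ((a.1.1 == k)%:R + (a.1.2 == k)%:R).
have -> : n.-1%:R = \sum_(a : root_index | root_lt a) c a :> R.
  by rewrite -mulr_sumr sum_root_ends mulrA mulVf ?mul1r.
rewrite /weyl_denominator -big_filter -[X in euler _ _ X]big_filter.
rewrite euler_prod ?filter_uniq ?index_enum_uniq // scaler_sumr -[RHS]big_filter.
apply: eq_big_seq => a; rewrite mem_filter => /andP[ra _].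
rewrite big_filter_cond scalerAl [in RHS]scalerAl -euler_root_factor //; congr (_ * _).
by rewrite /euler scale0r subr0 scalerBr scalerA mulrA mulfV ?mul1r.
Qed.

Definition laplacian c (p : {mpoly R[n]}) : {mpoly R[n]} := \sum_i euler c i (euler c i p).

Lemma laplacianM c d p q : laplacian (c + d) (p * q) =
  laplacian c p * q + 2%:R *: (\sum_i euler c i p * euler d i q) + p * laplacian d q.
Proof.
rewrite /laplacian mulr_suml mulr_sumr scaler_sumr -!big_split /=.
apply: eq_bigr => i _; rewrite eulerM eulerD !eulerM.
by rewrite -mul_mpolyC mpolyC_nat; ring.
Qed.

Definition lift k : {poly R} -> {mpoly R[n]} := horner_alg ('X_k : {mpoly R[n]}).

HB.instance Definition _ k := GRing.LRMorphism.on (lift k).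

Lemma liftX k : lift k 'X = 'X_k.
Proof. exact: horner_algX. Qed.

Lemma liftC k c : lift k c%:P = c *: 1.
Proof. exact: horner_algC. Qed.

Lemma liftZ k c p : lift k (c *: p) = c *: lift k p.
Proof. by rewrite -mul_polyC rmorphM /= liftC mulr_algl. Qed.

Lemma euler_lift c i k p :
  euler c i (lift k p) = if i == k then lift k ('X * p^`() - c *: p) else - c *: lift k p.
Proof.
elim/poly_ind: p => [|p d IH].
  by rewrite deriv0 mulr0 scaler0 subr0 !rmorph0 scaler0 if_same; exact: linear0.
rewrite rmorphD rmorphM /= liftX liftC eulerD eulerZ euler_cst -[c in LHS]addr0 eulerM IH.
rewrite addr0 euler_XU subr0.
have [ik|_] := eqVneq i k; last by rewrite scale0r mulr0 addr0 -!mul_mpolyC; ring.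
rewrite derivD derivM derivX derivC addr0 mulr1 !(rmorphB, rmorphD, rmorphM) /=.
by rewrite !liftZ rmorphD rmorphM /= liftX liftC -!mul_mpolyC mpolyCN; ring.
Qed.

End WeylDenominator.

(** Dividing row i by [a i ^+ n.-1] leaves the transposed Vandermonde matrix of the quotients b_i /
    a_i. *)
Lemma det_homogeneous_vandermonde (F : fieldType) (n : nat) (a b : 'I_n -> F) :
  (forall i, a i != 0) ->
  \det (\matrix_(i < n, j < n) (a i ^+ (n.-1 - j) * b i ^+ j)) =
  \prod_(i < n) \prod_(j < n | (i < j)%N) (a i * b j - a j * b i).
Proof.
move=> a0.
have -> : \matrix_(i < n, j < n) (a i ^+ (n.-1 - j) * b i ^+ j) =
    (\matrix_(j < n, i < n) (1 * Vandermonde n (\row_l (b l / a l)) j i * a i ^+ n.-1))^T.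
  apply/matrixP => i j; rewrite !mxE mul1r expr_div_n.
  have [d e] : exists d, n.-1 = (d + j)%N.
    by exists (n.-1 - j)%N; have := ltn_ord j; lia.
  by rewrite e addnK exprD; field; rewrite expf_neq0.
rewrite det_tr det_scale_rows_cols big1 // mul1r det_Vandermonde.
transitivity (\prod_(i < n) \prod_(j < n | (i < j)%N) (b j / a j - b i / a i) *
              \prod_(i < n) \prod_(j < n | (i < j)%N) (a i * a j)); last first.
  rewrite -big_split; apply: eq_bigr => i _; rewrite -big_split; apply: eq_bigr => j _ /=.
  by field; rewrite !a0.
congr (_ * _).
  by apply: eq_bigr => i _; apply: eq_bigr => j _; rewrite !mxE.
under [RHS]eq_bigr do rewrite big_split /=.
rewrite big_split /= [X in _ * X](exchange_big_dep xpredT) //= -big_split /=.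
apply: eq_bigr => i _.
transitivity (\prod_(j < n | j != i) a i); first by rewrite prodr_const cardC1 card_ord.
rewrite (bigID (fun j : 'I_n => i < j)%N) /=; congr (_ * _); apply: eq_bigl => j;
  by rewrite -val_eqE /=; case: ltngtP.
Qed.

Lemma det_homogeneous_vandermonde_idomain (A : idomainType) (n : nat) (a b : 'I_n -> A) :
  (forall i, a i != 0) ->
  \det (\matrix_(i < n, j < n) (a i ^+ (n.-1 - j) * b i ^+ j)) =
  \prod_(i < n) \prod_(j < n | (i < j)%N) (a i * b j - a j * b i).
Proof.
move=> a0; apply/eqP; rewrite -tofrac_eq -det_map_mx rmorph_prod /=; apply/eqP.
under [RHS]eq_bigr => i _.
  rewrite rmorph_prod; under eq_bigr do rewrite rmorphB !rmorphM /=.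
  over.
rewrite -(@det_homogeneous_vandermonde _ _ (fun i => tofrac (a i)) (fun i => tofrac (b i))); last first.
  by move=> i; rewrite tofrac_eq0.
by congr (\det _); apply/matrixP => i j; rewrite !mxE rmorphM !rmorphXn.
Qed.

Section WeylDeterminant.
Variables (R : numFieldType) (n : nat).
Implicit Types (i j k : 'I_n).

Lemma lift_sum k (p : {poly R}) T : (size p <= T)%N ->
  lift k p = \sum_(t < T) p`_t *: 'X_k ^+ t :> {mpoly R[n]}.
Proof.
move=> szp; rewrite [p in LHS](_ : _ = \poly_(t < T) p`_t); last first.
  apply/polyP => t; rewrite coef_poly; case: ltnP => // /(leq_trans szp) le_t.
  by rewrite nth_default.
rewrite poly_def rmorph_sum; apply: eq_bigr => t _ /=.
by rewrite liftZ rmorphXn /= liftX.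
Qed.

Lemma mcoeff_prod_lift (p : 'I_n -> {poly R}) (m : 'X_{1..n}) :
  (\prod_k lift k (p k))@_m = \prod_k (p k)`_(m k).
Proof.
(* A common bound on all degrees and on the exponents of m, so that m is among the finite functions
   over which the expanded product is summed. *)
pose T := (\sum_k (size (p k) + m k)).+1.
have le_T k : (size (p k) + m k < T)%N by rewrite ltnS (bigD1 k) //= leq_addr.
have szp k : (size (p k) <= T)%N by have := le_T k; lia.
rewrite (eq_bigr _ (fun k _ => lift_sum k (szp k))) bigA_distr_bigA raddf_sum /=.
have m_lt k : (m k < T)%N by have := le_T k; lia.
transitivity (\sum_(f : {ffun 'I_n -> 'I_T})
    (\prod_k (p k)`_(f k)) * ([multinom f k : nat | k < n] == m)%:R).
  apply: eq_bigr => f _; rewrite scaler_prod mcoeffZ -mcoeffX; congr (_ * _@__).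
  by rewrite [RHS]mpolyXE_id; apply: eq_bigr => k _; rewrite mnmE.
pose fm := [ffun k => Ordinal (m_lt k)] : {ffun 'I_n -> 'I_T}.
rewrite [LHS](bigD1 fm) //= [X in _ + X]big1 ?addr0 => [|f ne].
  rewrite (_ : _ == m) ?mulr1; last by apply/eqP/mnmP => k; rewrite mnmE ffunE.
  by apply: eq_bigr => k _; rewrite ffunE.
case: eqP => [e|_]; last by rewrite mulr0.
case/eqP: ne; apply/ffunP => k; rewrite ffunE; apply: ord_inj => /=.
by rewrite -e mnmE.
Qed.

Lemma lift_neq0 k (p : {poly R}) : p`_0 != 0 -> lift k p != 0 :> {mpoly R[n]}.
Proof.
move=> p0; apply/eqP => e.
have := mcoeff_prod_lift (fun i => if i == k then p else 1) 0%MM.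
rewrite (bigD1 k) //= eqxx e mul0r mcoeff0 (bigD1 k) //= eqxx big1 => [|i ik].
  by rewrite mnm0E mulr1 => /esym/eqP; rewrite (negPf p0).
by rewrite (negPf ik) mnm0E coef1.
Qed.

(** Both 1 + X^2 and (1 + X)^2 satisfy the hypothesis: they differ by 2X, which cancels in the
    antisymmetric expression. *)
Lemma weyl_denominator_det (p : {poly R}) : p`_0 != 0 ->
  (forall i j, lift i p * lift j 'X - lift j p * lift i 'X =
     ('X_i - 'X_j) * ('X_i * 'X_j - 1) :> {mpoly R[n]}) ->
  weyl_denominator R n =
  \det (\matrix_(i < n, j < n) lift i (p ^+ (n.-1 - j) * 'X ^+ j)).
Proof.
move=> p0 pX; rewrite /weyl_denominator big_root.
transitivity (\prod_(i < n) \prod_(j < n | (i < j)%N)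
    (lift i p * lift j 'X - lift j p * lift i 'X : {mpoly R[n]})).
  by apply: eq_bigr => i _; apply: eq_bigr => j _; rewrite pX mulrC.
rewrite -det_homogeneous_vandermonde_idomain => [|i]; last exact: lift_neq0.
by congr (\det _); apply/matrixP => i j; rewrite !mxE rmorphM !rmorphXn.
Qed.

Lemma weyl_denominator_sqr : weyl_denominator R n =
  \det (\matrix_(i < n, j < n) lift i ((1 + 'X^2) ^+ (n.-1 - j) * 'X ^+ j)).
Proof.
apply: weyl_denominator_det.
  by rewrite coefD coef1 coefXn addr0 oner_eq0.
move=> i j; rewrite !rmorphD !rmorphXn rmorph1 /= !liftX; ring.
Qed.

Lemma weyl_denominator_bin : weyl_denominator R n =
  \det (\matrix_(i < n, j < n) lift i ((1 + 'X) ^+ (2 * (n.-1 - j)) * 'X ^+ j)).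
Proof.
rewrite (@weyl_denominator_det ((1 + 'X) ^+ 2)).
- by congr (\det _); apply/matrixP => i j; rewrite !mxE exprM.
- by rewrite expr2 coef0M coefD coef1 coefX addr0 mulr1 oner_eq0.
- by move=> i j; rewrite !rmorphXn !rmorphD !rmorph1 /= !liftX; ring.
Qed.

Lemma eulerM0 c i (p q : {mpoly R[n]}) :
  euler 0 i q = 0 -> euler c i (p * q) = euler c i p * q.
Proof. by move=> q0; rewrite -[X in euler X](addr0 c) eulerM q0 mulr0 !addr0. Qed.

Lemma euler0_prod i (P : pred 'I_n) (f : 'I_n -> {mpoly R[n]}) :
  (forall k, P k -> euler 0 i (f k) = 0) -> euler 0 i (\prod_(k | P k) f k) = 0.
Proof.
move=> f0; apply: (big_ind (fun p => euler 0 i p = 0)) => //; first exact: euler1.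
by move=> p q p0 q0; rewrite -[X in euler X](addr0 0) eulerM p0 q0 mul0r mulr0 addr0.
Qed.

(** The terms with [b j] add up to determinants in which column j has been replaced by a copy of
    another column, so they vanish. *)
Lemma laplacian_det c (f : 'I_n -> {poly R}) (a b : 'I_n -> R) (s : 'I_n -> 'I_n) :
  (forall i j, euler c i (euler c i (lift i (f j))) =
     a j *: lift i (f j) + b j *: lift i (f (s j)) :> {mpoly R[n]}) ->
  (forall j, b j != 0 -> s j != j) ->
  laplacian c (\det (\matrix_(i < n, j < n) lift i (f j))) =
  (\sum_j a j) *: \det (\matrix_(i < n, j < n) lift i (f j) : 'M[{mpoly R[n]}]_n).
Proof.
move=> eigen sj.
have prodE (i : 'I_n) (t : 'S_n) : euler c i (euler c i (\prod_k lift k (f (t k)))) =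
    a (t i) *: \prod_k lift k (f (t k)) +
    b (t i) *: \prod_k lift k (f (if t k == t i then s (t i) else t k)) :> {mpoly R[n]}.
  have others0 : euler 0 i (\prod_(k | k != i) lift k (f (t k))) = 0 :> {mpoly R[n]}.
    by apply: euler0_prod => k ki; rewrite euler_lift eq_sym (negPf ki) oppr0 scale0r.
  rewrite (bigD1 i) //= !(eulerM0 _ _ others0).
  rewrite eigen mulrDl -!scalerAl; congr (_ + _ *: _).
  rewrite [RHS](bigD1 i) //= eqxx; congr (_ * _); apply: eq_bigr => k ki.
  by rewrite (inj_eq perm_inj) (negPf ki).
have signE (t : 'S_n) (p : {mpoly R[n]}) : (-1) ^+ t * p = ((-1) ^+ t : R) *: p.
  by rewrite -mul_mpolyC rmorph_sign.
rewrite /laplacian /determinant.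
transitivity (\sum_i \sum_(t : 'S_n) ((-1) ^+ t : R) *:
   (a (t i) *: \prod_k lift k (f (t k)) +
    b (t i) *: \prod_k lift k (f (if t k == t i then s (t i) else t k)) : {mpoly R[n]})).
  apply: eq_bigr => i _; rewrite !euler_sum; apply: eq_bigr => t _.
  under eq_bigr do rewrite mxE.
  by rewrite signE !eulerZ prodE.
rewrite exchange_big /=.
under eq_bigr => t _.
  under eq_bigr do rewrite scalerDr.
  rewrite big_split /=.
  over.
rewrite big_split /= [X in _ + X](_ : _ = 0) ?addr0.
  rewrite scaler_sumr; apply: eq_bigr => t _.
  under [X in _ = _ *: (_ * X)]eq_bigr do rewrite mxE.
  rewrite -scaler_sumr -scaler_suml signE scalerA mulrC -scalerA; congr (_ *: (_ *: _)).
  by rewrite [RHS](reindex_inj (@perm_inj _ t)).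
transitivity (\sum_j b j *: \det (\matrix_(k < n, l < n) lift k (f (if l == j then s j else l)) : 'M[{mpoly R[n]}]_n)).
  under [RHS]eq_bigr do rewrite scaler_sumr.
  rewrite [RHS]exchange_big; apply: eq_bigr => t _.
  rewrite [RHS](reindex_inj (@perm_inj _ t)); apply: eq_bigr => i _ /=.
  rewrite signE !scalerA mulrC; congr (_ *: _).
  by apply: eq_bigr => k _; rewrite mxE.
rewrite big1 // => j _; have [->|bj] := eqVneq (b j) 0; first by rewrite scale0r.
rewrite -det_tr (determinant_alternate (sj j bj)) ?scaler0 // => k.
by rewrite !mxE eqxx (negPf (sj j bj)).
Qed.

(** With u = x + 1/x and t = x d/dx this is t^2 u^m = m^2 u^m - 4 m (m - 1) u^(m-2), multiplied by
    x^(m+l). *)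
Lemma euler2_quadratic i m l :
  euler (m%:R + l%:R) i (euler (m%:R + l%:R) i ((1 + 'X_i ^+ 2) ^+ m * 'X_i ^+ l)) =
  m%:R ^+ 2 *: ((1 + 'X_i ^+ 2) ^+ m * 'X_i ^+ l) +
  (- (4 * m * m.-1)%N%:R) *: ((1 + 'X_i ^+ 2) ^+ m.-2 * 'X_i ^+ l.+2) :> {mpoly R[n]}.
Proof.
set x : {mpoly R[n]} := 'X_i; set z := 1 + x ^+ 2; pose w := x ^+ 2 - 1.
have ex : euler 1 i x = 0 by rewrite euler_XU eqxx subrr scale0r.
have epow (p q : {mpoly R[n]}) t : euler 1 i p = q ->
    euler t%:R i (p ^+ t) = t%:R * (q * p ^+ t.-1).
  move=> e; elim: t => [|t IH]; first by rewrite mul0r euler1.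
  rewrite mulrSr exprSr eulerM IH e; case: t {IH} => [|t] /=; first by rewrite expr0; ring.
  by rewrite [(t.+2)%:R]mulrSr !exprSr; ring.
have ex2 : euler 2 i (x ^+ 2) = 0.
  by rewrite (epow _ 0) // mul0r mulr0.
have e2 : euler 1 i (x ^+ 2) = x ^+ 2.
  by move: ex2; rewrite /euler -[2]/(1 + 1) scalerDl opprD addrA scale1r => /eqP; rewrite subr_eq0 => /eqP.
have ez : euler 1 i z = w by rewrite eulerD e2 euler_cst scaleN1r addrC.
have ew : euler 1 i w = z by rewrite eulerB e2 euler_cst scaleN1r opprK addrC.
have exl : euler l%:R i (x ^+ l) = 0 by rewrite (epow _ 0) // mul0r mulr0.
rewrite eulerM (epow _ _ m ez) exl mulr0 addr0.
have natZ (t : nat) (p : {mpoly R[n]}) : t%:R * p = (t%:R : R) *: p.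
  by rewrite -mul_mpolyC mpolyC_nat.
case: m => [|m].
  by rewrite !mul0r linear0 muln0 mul0n expr2 mul0r oppr0 !scale0r addr0.
have em : m.+1%:R = 1 + m%:R :> R by rewrite mulrSr addrC.
rewrite natZ -scalerAl eulerZ [X in euler (X + _)]em.
rewrite eulerM eulerM ew (epow _ _ m ez) exl mulr0 addr0.
rewrite -!mul_mpolyC !(mpolyCD, mpolyC_nat, mpolyCN, mpolyCM).
case: m {em} => [|m] /=; first by rewrite /w /z !expr0; ring.
rewrite !exprSr !natrM !mulrSr /w /z; ring.
Qed.

(** The eigenvalue is |rho|^2, as rho_i = n - 1 - i counting from 0. *)
Lemma laplacian_weyl_denominator :
  laplacian n.-1%:R (weyl_denominator R n) =
  (\sum_(i < n) (n.-1 - i)%N%:R ^+ 2) *: weyl_denominator R n.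
Proof.
rewrite weyl_denominator_sqr.
pose f (j : 'I_n) : {poly R} := (1 + 'X^2) ^+ (n.-1 - j) * 'X ^+ j.
pose b (j : 'I_n) : R := - (4 * (n.-1 - j) * (n.-1 - j).-1)%N%:R.
(* Lowering the exponent n - 1 - j by 2 moves column j to column j + 2. If that is out of range, the
   default j is harmless because [b j] is 0. *)
apply: (@laplacian_det _ f _ b (fun j => insubd j j.+2)) => [i j|j]; last first.
  rewrite /b oppr_eq0 pnatr_eq0 => b0; rewrite -val_eqE val_insubd.
  by case: ifP => [_ /=|]; [lia | have := ltn_ord j; lia].
have fE (l : 'I_n) : lift i (f l) = (1 + 'X_i ^+ 2) ^+ (n.-1 - l) * 'X_i ^+ l :> {mpoly R[n]}.
  by rewrite rmorphM !rmorphXn rmorphD rmorph1 rmorphXn /= liftX.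
have [m em] : exists m, n.-1 = (m + j)%N by exists (n.-1 - j)%N; have := ltn_ord j; lia.
have mE : (n.-1 - j = m)%N by rewrite em addnK.
have e : n.-1%:R = m%:R + j%:R :> R by rewrite -natrD em.
rewrite !fE /b mE e euler2_quadratic; congr (_ + _).
have [m2|m2] := leqP m 1.
  by rewrite (_ : 4 * m * m.-1 = 0)%N ?oppr0 ?scale0r //; lia.
have lt_j2 : (j.+2 < n)%N by lia.
rewrite val_insubd lt_j2; congr (_ *: (_ ^+ _ * _)); lia.
Qed.

(** The eigenvalue term of the denominator cancels, and in the cross term of the product rule its
    derivative is expanded over the positive roots. *)
Lemma weyl_laplace s (f : {mpoly R[n]}) (D := weyl_denominator R n) :
  laplacian (n.-1%:R + s) (D * f) - (\sum_(i < n) (n.-1 - i)%N%:R ^+ 2) *: (D * f) =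
  D * laplacian s f +
  \sum_(a : root_index n | root_lt a)
     root_cofactor R a * (\prod_(b : root_index n | root_lt b && (b != a)) root_factor R b) *
     (\sum_k root_coord R a k *: euler s k f).
Proof.
rewrite laplacianM laplacian_weyl_denominator -/D -scalerAl -addrA addrAC addrCA subrr addr0; congr (_ + _).
rewrite scaler_sumr; under eq_bigr do rewrite scalerAl euler_weyl_denominator mulr_suml.
rewrite exchange_big; apply: eq_bigr => a _; rewrite mulr_sumr; apply: eq_bigr => k _ /=.
by rewrite -scalerAl -scalerAr.
Qed.

Lemma coef_1X_exp t l : ((1 + 'X) ^+ t : {poly R})`_l = 'C(t, l)%:R.
Proof.
elim: t l => [|t IH] l; first by rewrite expr0 coef1; case: l.
rewrite exprS mulrDl mul1r mulrC coefD coefMX !IH; case: l => [|l] /=.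
  by rewrite addr0 !bin0.
by rewrite binS natrD.
Qed.

(** The power of 1 + X_i is absorbed into row i, whose entries involve X_i alone; the coefficient is
    therefore taken row by row. *)
Lemma weyl_denominator_coeff N (m : 'X_{1..n}) :
  (weyl_denominator R n * \prod_k (1 + 'X_k) ^+ N)@_m =
  \det (\matrix_(i < n, j < n)
     (if (m i < j)%N then 0 else 'C(2 * (n.-1 - j) + N, m i - j)%:R : R)).
Proof.
have -> : weyl_denominator R n * \prod_k (1 + 'X_k) ^+ N =
    \det (\matrix_(i < n, j < n) lift i ((1 + 'X) ^+ (2 * (n.-1 - j) + N) * 'X ^+ j)).
  rewrite weyl_denominator_bin mulrC; set M := \matrix_(i, j) _.
  have := det_scale_rows_cols (fun k => (1 + 'X_k) ^+ N) (fun=> 1) M.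
  rewrite [X in _ = _ * X -> _]big1 // mulr1 => <-.
  congr (\det _); apply/matrixP => i j; rewrite !mxE mulr1 !rmorphM !rmorphXn !rmorphD rmorph1 /= liftX.
  by rewrite exprD; ring.
rewrite /determinant raddf_sum; apply: eq_bigr => t _ /=.
have -> p : (-1) ^+ t * p = ((-1) ^+ t : R) *: p :> {mpoly R[n]}.
  by rewrite -mul_mpolyC rmorph_sign.
under eq_bigr do rewrite mxE.
rewrite mcoeffZ mcoeff_prod_lift; congr (_ * _); apply: eq_bigr => i _; rewrite mxE.
by rewrite coefMXn coef_1X_exp.
Qed.

End WeylDeterminant.

(** * The leading term of the Weyl denominator *)

Section TopCoefficient.
Variables (R : numFieldType) (n : nat) (c : 'I_n -> int).
Implicit Types (p q : {mpoly R[n]}) (u v m : 'X_{1..n}).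

Definition mnm_pairing m : int := \sum_i c i * (m i)%:Z.

Lemma mnm_pairingD u v : mnm_pairing (u + v) = mnm_pairing u + mnm_pairing v.
Proof.
rewrite /mnm_pairing -big_split; apply: eq_bigr => i _ /=.
by rewrite mnmDE PoszD mulrDr.
Qed.

Lemma mnm_pairing1 i : mnm_pairing U_(i) = c i.
Proof.
rewrite /mnm_pairing (bigD1 i) //= mnm1E eqxx mulr1 big1 ?addr0 // => j ji.
by rewrite mnm1E eq_sym (negPf ji) mulr0.
Qed.

Definition mp_below (L : int) p := forall m, m \in msupp p -> mnm_pairing m < L.

Lemma mp_belowD L p q : mp_below L p -> mp_below L q -> mp_below L (p + q).
Proof. by move=> bp bq m /msuppD_le; rewrite mem_cat => /orP[/bp|/bq]. Qed.

(** The pairing is integral, so the bound M + 1 on q means at most M. *)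
Lemma mp_belowM L M p q : mp_below L p -> mp_below (M + 1) q -> mp_below (L + M) (p * q).
Proof.
move=> bp bq m /msuppM_le /allpairsP[[u v] /= [/bp bu /bq bv ->]].
by rewrite mnm_pairingD; lia.
Qed.

Lemma mp_belowX L u : mnm_pairing u < L -> mp_below L 'X_[u].
Proof. by move=> uL m; rewrite msuppX inE => /eqP ->. Qed.

Lemma mp_below_leq L M p : L <= M -> mp_below L p -> mp_below M p.
Proof. by move=> LM bp m /bp; lia. Qed.

Definition mp_leading u p := mp_below (mnm_pairing u) (p - 'X_[u]).

Lemma mp_leadingM u v p q : mp_leading u p -> mp_leading v q -> mp_leading (u + v) (p * q).
Proof.
move=> lp lq; rewrite /mp_leading mnm_pairingD mpolyXD.
rewrite (_ : _ - _ = (p - 'X_[u]) * q + (q - 'X_[v]) * 'X_[u]); last by ring.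
apply: mp_belowD; last by rewrite addrC; apply: mp_belowM => //; apply: mp_belowX; lia.
apply: mp_belowM => //; rewrite -[q](subrK 'X_[v]); apply: mp_belowD.
  by apply: mp_below_leq lq; lia.
by apply: mp_belowX; lia.
Qed.

(** This is rho + (n - 1, ..., n - 1), the exponent of e^rho after clearing denominators. *)
Definition weyl_top : 'X_{1..n} := [multinom (2 * n.-1 - i)%N | i < n].

Hypotheses (c_decr : forall i j : 'I_n, (i < j)%N -> c j < c i)
           (c_pos : forall i j : 'I_n, (i < j)%N -> 0 < c i + c j).

(** As c is positive on positive roots, the first monomial of each factor leads, and leading
    monomials multiply. Index k is the first index of 2(n - 1 - k) roots and the second index of k
    roots e_i + e_k. *)
Lemma weyl_denominator_leading : mp_leading weyl_top (weyl_denominator R n).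
Proof.
pose lead (a : root_index n) : 'X_{1..n} := if a.2 then (U_(a.1.1) + U_(a.1.2))%MM else U_(a.1.1)%MM.
have -> : weyl_top = (\big[mnm_add/mnm0]_(a : root_index n | root_lt a) lead a)%MM.
  apply/mnmP => k; rewrite mnmE big_root mnm_sumE.
  transitivity (\sum_(i < n) \sum_(j < n | (i < j)%N) (((i == k) + (j == k)) + (i == k)))%N; last first.
    apply: eq_bigr => i _; rewrite mnm_sumE; apply: eq_bigr => j _.
    by rewrite !mnmDE !mnm1E.
  under eq_bigr do rewrite !big_split /=.
  rewrite !big_split /=.
  have -> : (\sum_(i < n) \sum_(j < n | (i < j)%N) (i == k) = \sum_(j < n | (k < j)%N) 1)%N.
    rewrite (bigD1 k) //= eqxx [X in (_ + X)%N]big1 ?addn0 // => i /negPf ->.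
    by rewrite big1.
  have -> : (\sum_(i < n) \sum_(j < n | (i < j)%N) (j == k) = \sum_(i < n | (i < k)%N) 1)%N.
    rewrite (exchange_big_dep xpredT) //= (bigD1 k) //= eqxx [X in (_ + X)%N]big1 ?addn0 // => j /negPf ->.
    by rewrite big1.
  have lt_k t : (t <= n)%N -> (\sum_(i < n | (i < t)%N) 1 = t)%N.
    by move=> le_t; rewrite -(big_ord_widen n (fun=> 1%N)) // sum1_card card_ord.
  have : (\sum_(i < n | (k < i)%N) 1 + \sum_(i < n | (i < k.+1)%N) 1 = n)%N.
    rewrite -[RHS]card_ord -sum1_card [RHS](bigID (fun i : 'I_n => k < i)%N) /=; congr (_ + _)%N.
    by apply: eq_bigl => i; rewrite ltnS leqNgt.
  rewrite !lt_k //; last exact: ltnW.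
  by have := ltn_ord k; lia.
apply: (big_ind2 mp_leading) => [| u1 p1 u2 p2 | [[i j] b] ij].
- by rewrite /mp_leading mpolyX0 subrr => m; rewrite msupp0.
- exact: mp_leadingM.
rewrite /root_lt /= in ij; rewrite /mp_leading /lead /root_factor; case: b => /=.
  rewrite mpolyXD addrAC subrr add0r => m; rewrite (perm_mem (msuppN _)) msupp1 inE => /eqP ->.
  rewrite mnm_pairingD !mnm_pairing1 {1}/mnm_pairing big1 ?c_pos // => l _.
  by rewrite mnm0E mulr0.
rewrite addrAC subrr add0r => m; rewrite (perm_mem (msuppN _)) msuppX inE => /eqP ->.
by rewrite !mnm_pairing1 c_decr.
Qed.

End TopCoefficient.

(** * The Casimir operator *)

Section Casimir.
Variables (C : numClosedFieldType) (n : nat) (r : rep C n).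
Implicit Types (p q s t : 'I_(n + n)) (i j k : 'I_n) (a : root_index n).

Definition root_tail a : 'I_(n + n) := if a.2 then lshift n a.1.2 else rshift n a.1.2.

Definition raising a : 'M[C]_(rdim r) := rF r (lshift n a.1.1) (root_tail a).

Definition lowering a : 'M[C]_(rdim r) := rF r (dual (root_tail a)) (dual (lshift n a.1.1)).

Definition cartan_op i : 'M[C]_(rdim r) := rF r (lshift n i) (rshift n i).

Definition casimir : 'M[C]_(rdim r) :=
  \sum_i cartan_op i *m cartan_op i +
  \sum_(a | root_lt a) (raising a *m lowering a + lowering a *m raising a).

Lemma rF_diag p : rF r p p = 0.
Proof.
have /eqP := rF_sym r p p; rewrite -addr_eq0 -mulr2n -scaler_nat scaler_eq0 pnatr_eq0 /=.
by move/eqP.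
Qed.

(** The right side involves no choice of positive roots, and there the commutation with the action
    reduces to contracting indices. *)
Lemma casimir_double : 2%:R *: casimir = \sum_p \sum_q rF r p q *m rF r (dual q) (dual p).
Proof.
pose F := rF r; pose l i : 'I_(n + n) := lshift n i; pose m i : 'I_(n + n) := rshift n i.
pose G i j := F (l i) (l j) *m F (m j) (m i) + F (l i) (m j) *m F (l j) (m i)
  + (F (m i) (l j) *m F (m j) (l i) + F (m i) (m j) *m F (l j) (l i)).
transitivity (\sum_i \sum_j G i j); last first.
  rewrite [RHS]big_split_ord -[RHS]big_split /=; apply: eq_bigr => i _.
  rewrite !big_split_ord /= -!big_split /=; apply: eq_bigr => j _.
  by rewrite !dual_lshift !dual_rshift.
have -> : \sum_i \sum_j G i j =
    \sum_i G i i + \sum_(i < n) \sum_(j < n | (i < j)%N) (G i j + G j i).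
  have spl i : \sum_j G i j =
     G i i + (\sum_(j < n | (i < j)%N) G i j + \sum_(j < n | (j < i)%N) G i j).
    rewrite (bigD1 i) //= (bigID (fun j : 'I_n => i < j)%N) /=; congr (_ + (_ + _));
      by apply: eq_bigl => j; rewrite -val_eqE /=; case: ltngtP.
  rewrite (eq_bigr _ (fun i _ => spl i)) !big_split /=; congr (_ + _).
  rewrite [X in _ + X](exchange_big_dep xpredT) //= -big_split /=.
  apply: eq_bigr => i _. by rewrite -big_split.
rewrite /casimir scalerDr !scaler_sumr; congr (_ + _).
  apply: eq_bigr => i _; rewrite /G /F !rF_diag !mul0mx !(addr0, add0r).
  by rewrite [rF r (m i) (l i)]rF_sym mulNmx mulmxN opprK -mulr2n scaler_nat.
rewrite big_root /=; apply: eq_bigr => i _; apply: eq_bigr => j _.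
rewrite -scalerDr scaler_nat mulr2n /raising /lowering /root_tail /= !dual_lshift !dual_rshift /G /F.
rewrite (rF_sym r (l j) (m i)) (rF_sym r (l i) (m j)) (rF_sym r (m j) (m i)) (rF_sym r (l i) (l j)).
rewrite !mulNmx !mulmxN !opprK.
have ac (X Y Z W : 'M[C]_(rdim r)) :
    X + W + (Y + Z) + (X + W + (Y + Z)) = X + Y + (Z + W) + (X + Z + (Y + W)).
  by apply/matrixP => u v; rewrite !mxE; ring.
exact: ac.
Qed.

(** Moving [rF r s t] past the two factors of the double sum gives contracted sums [A] and [B], each
    once with either sign. *)
Lemma casimir_comm s t : rF r s t *m casimir = casimir *m rF r s t.
Proof.
suff H : rF r s t *m (2%:R *: casimir) = (2%:R *: casimir) *m rF r s t.
  move: H; rewrite -scalemxAr -scalemxAl => /(congr1 (fun M => 2%:R^-1 *: M)).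
  by rewrite !scalerA mulVf ?scale1r // pnatr_eq0.
pose F := rF r; pose A u v := \sum_q F u q *m F (dual q) v; pose B u v := \sum_p F p u *m F v (dual p).
pose T1 p q := (p == dual t)%:R *: F s q - (p == dual s)%:R *: F t q +
  ((q == dual t)%:R *: F p s - (q == dual s)%:R *: F p t).
have delta (f : 'I_(n + n) -> 'M[C]_(rdim r)) u : \sum_p (p == u)%:R *: f p = f u.
  rewrite (bigD1 u) //= eqxx scale1r big1 ?addr0 // => p /negPf ->.
  by rewrite scale0r.
have e1 : \sum_p \sum_q T1 p q *m F (dual q) (dual p) = A s t - A t s + (B s t - B t s).
  rewrite /T1; under eq_bigr => p _.
    under eq_bigr do rewrite !mulmxDl !mulNmx -!scalemxAl.
    rewrite !big_split /= !sumrN -!scaler_sumr.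
    over.
  rewrite !big_split /= !sumrN !delta !dualK; congr (_ + _).
  by rewrite -!sumrB; apply: eq_bigr => p _; rewrite !delta !dualK.
have e2 : \sum_p \sum_q F p q *m T1 (dual q) (dual p) = B t s - B s t + (A t s - A s t).
  rewrite /T1; under eq_bigr => p _.
    under eq_bigr do rewrite !mulmxDr !mulmxN -!scalemxAr !(inj_eq (can_inj (@dualK n))).
    rewrite !big_split /= !sumrN !delta -!scaler_sumr.
    over.
  by rewrite !big_split /= !sumrN !delta.
rewrite casimir_double mulmx_sumr mulmx_suml.
transitivity (\sum_p \sum_q (rF r p q *m rF r (dual q) (dual p) *m rF r s t +
   (F p q *m T1 (dual q) (dual p) + T1 p q *m F (dual q) (dual p)))).
  apply: eq_bigr => p _; rewrite mulmx_sumr; apply: eq_bigr => q _.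
  by rewrite mulmxA rF_comm -/(T1 p q) mulmxDl -mulmxA rF_comm -/(T1 _ _) mulmxDr mulmxA addrA.
under eq_bigr do rewrite !big_split /=.
rewrite !big_split /= e1 e2 [X in _ + X](_ : _ = 0) ?addr0.
  by apply: eq_bigr => p _; rewrite mulmx_suml.
by rewrite -(opprB (A t s)) -(opprB (B t s)) -opprD [A t s - _ + _]addrC subrr.
Qed.

Lemma raising_lowering a : root_lt a ->
  raising a *m lowering a = lowering a *m raising a + \sum_k root_coord C a k *: cartan_op k.
Proof.
case: a => [[i j] b]; rewrite /root_lt /= => ij.
have nij : i != j by rewrite -val_eqE /=; lia.
rewrite /raising /lowering rF_root_comm /root_tail /=; last first.
  by case: b; rewrite ?(inj_eq (@lshift_inj _ _)) ?eq_lrshift.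
congr (_ + _); rewrite dual_lshift (bigD1 i) //= (bigD1 j) 1?eq_sym //= big1 ?addr0.
  rewrite /root_coord /= eqxx [j == i]eq_sym (negPf nij) mulr0 addr0 scale1r; congr (_ + _).
  rewrite eqxx add0r mulr1; case: b; rewrite ?dual_lshift ?dual_rshift ?scale1r //.
  by rewrite scaleN1r -rF_sym.
move=> k /andP[ki kj].
by rewrite /root_coord /= [i == k]eq_sym (negPf ki) [j == k]eq_sym (negPf kj) mulr0 addr0 scale0r.
Qed.

Lemma omega_root a k : omega C (lshift n a.1.1) k + omega C (root_tail a) k = root_coord C a k.
Proof.
rewrite omega_lshift /root_tail /root_coord; case: a.2.
  by rewrite omega_lshift mul1r.
by rewrite omega_rshift mulN1r.
Qed.

Lemma height_root a : root_lt a -> 0 < height (lshift n a.1.1) + height (root_tail a).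
Proof.
case: a => [[i j] b]; rewrite /root_lt /root_tail /= height_lshift => ij.
by case: b; rewrite ?height_lshift ?height_rshift; have := ltn_ord i; have := ltn_ord j; lia.
Qed.

(** The positive roots add up to 2 rho, so rho_k = n - 1 - k. *)
Lemma sum_root_coord k :
  \sum_(a : root_index n | root_lt a) root_coord C a k = 2%:R * (n.-1 - k)%N%:R.
Proof.
rewrite big_root /root_coord /=.
transitivity (\sum_(i < n) \sum_(j < n | (i < j)%N) 2%:R * (i == k)%:R : C).
  by apply: eq_bigr => i _; apply: eq_bigr => j _; ring.
rewrite (bigD1 k) //= eqxx [X in _ + X]big1 ?addr0; last first.
  by move=> i /negPf ->; rewrite big1 // => j _; rewrite mulr0.
rewrite mulr1 sumr_const mulr_natr; congr (_ *+ _).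
have : (#|[pred j : 'I_n | (k < j)%N]| + k.+1 = n)%N.
  rewrite -[RHS]card_ord -(cardC [pred j : 'I_n | (k < j)%N]); congr (_ + _)%N.
  transitivity (\sum_(j < n | (j < k.+1)%N) 1)%N.
    by rewrite -(big_ord_widen n (fun=> 1%N)) // sum1_card card_ord.
  by rewrite -[RHS]sum1_card; apply: eq_bigl => j; rewrite !inE ltnS leqNgt.
rewrite (_ : #|_| = #|[pred j : 'I_n | (k < j)%N]|); last by apply: eq_card.
lia.
Qed.

End Casimir.

Section CasimirTrace.
Variables (C : numClosedFieldType) (n : nat) (r : rep C n).
Variables (wt : 'I_(rdim r) -> 'I_n -> nat) (sh : C).
Hypothesis cart_r : cartan_diagonal (r := r) (fun x i => (wt x i)%:R - sh).
Implicit Types (p q : 'I_(n + n)) (i j k : 'I_n) (a : root_index n) (x y : 'I_(rdim r)).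
Implicit Types Y : 'M[C]_(rdim r).

Definition wt_mnm x : 'X_{1..n} := [multinom wt x i | i < n].

Definition chi Y : {mpoly C[n]} := \sum_x Y x x *: 'X_[wt_mnm x].

Lemma chiD Y Y' : chi (Y + Y') = chi Y + chi Y'.
Proof. by rewrite -big_split; apply: eq_bigr => x _; rewrite mxE scalerDl. Qed.

Lemma chiZ c Y : chi (c *: Y) = c *: chi Y.
Proof. by rewrite scaler_sumr; apply: eq_bigr => x _; rewrite mxE scalerA. Qed.

Lemma chi_sum (I : finType) (P : pred I) (f : I -> 'M[C]_(rdim r)) :
  chi (\sum_(i | P i) f i) = \sum_(i | P i) chi (f i).
Proof.
apply: (big_morph chi) => [Y Y'|]; first exact: chiD.
by rewrite -[0](scale0r 0) chiZ scale0r.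
Qed.

Lemma rF_entry p q x y : rF r p q x y != 0 ->
  forall k, (wt x k)%:R = (wt y k)%:R + (omega C p k + omega C q k).
Proof.
move=> nz k; apply: (addIr (- sh)); apply: (mulIf nz).
have := congr1 (fun M : 'M_(rdim r) => M x y) (rF_cartan_comm r k p q).
rewrite cart_r mul_diag_mx mul_mx_diag !mxE => ->; ring.
Qed.

Definition root_head_mnm a : 'X_{1..n} := if a.2 then (U_(a.1.1) + U_(a.1.2))%MM else U_(a.1.1)%MM.

Definition root_tail_mnm a : 'X_{1..n} := if a.2 then 0%MM else U_(a.1.2)%MM.

Lemma root_factorE a : root_factor C a = 'X_[root_head_mnm a] - 'X_[root_tail_mnm a].
Proof.
by case: a => [[i j] []]; rewrite /root_factor /root_head_mnm /root_tail_mnm /= ?mpolyXD ?mpolyX0.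
Qed.

Lemma root_cofactorE a : root_cofactor C a = 'X_[root_head_mnm a] + 'X_[root_tail_mnm a].
Proof.
by case: a => [[i j] []]; rewrite /root_cofactor /root_head_mnm /root_tail_mnm /= ?mpolyXD ?mpolyX0.
Qed.

(* The weights of x and y differ by the root whenever the (x, y) entry of the
   raising operator is nonzero; the root is split as a difference of monomials. *)
Lemma chi_raising a Y :
  'X_[root_tail_mnm a] * chi (raising r a *m Y) = 'X_[root_head_mnm a] * chi (Y *m raising r a).
Proof.
rewrite /chi !mulr_sumr.
under eq_bigr do rewrite mxE scaler_suml mulr_sumr.
under [RHS]eq_bigr do rewrite mxE scaler_suml mulr_sumr.
rewrite [RHS]exchange_big; apply: eq_bigr => x _; apply: eq_bigr => y _ /=.
have [->|nz] := eqVneq (raising r a x y) 0; first by rewrite mul0r mulr0 !scale0r !mulr0.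
rewrite -!scalerAr -!mpolyXD mulrC; congr (_ *: 'X_[_]).
apply/mnmP => k; have := rF_entry nz k; rewrite omega_root !mnmDE !mnmE.
rewrite /root_coord /root_head_mnm /root_tail_mnm; case: a.2; rewrite ?mnmDE !mnm1E ?mnm0E => e.
  by apply/eqP; rewrite -(eqr_nat C) !natrD e; apply/eqP; ring.
by apply/eqP; rewrite -(eqr_nat C) !natrD e; apply/eqP; ring.
Qed.

Lemma chi_cartan k Y : chi (cartan_op r k *m Y) = euler sh k (chi Y).
Proof.
rewrite /chi euler_sum; apply: eq_bigr => x _; rewrite eulerZ eulerX scalerA mnmE.
by rewrite /cartan_op cart_r mul_diag_mx !mxE mulrC.
Qed.

(** Let t and t + d be the traces of FEY and EFY, where d comes from [E, F], and let u and v be the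
    tail and head monomials. Cyclicity says u (t + d) = v t, and this turns (v - u)(2t + d) into (v
    + u) d. *)
Lemma chi_root a Y : root_lt a -> (forall p q, rF r p q *m Y = Y *m rF r p q) ->
  root_factor C a * chi ((raising r a *m lowering r a + lowering r a *m raising r a) *m Y) =
  root_cofactor C a * (\sum_k root_coord C a k *: euler sh k (chi Y)).
Proof.
move=> ra comY; set d := \sum_k _.
have ed : chi (raising r a *m lowering r a *m Y) = chi (lowering r a *m raising r a *m Y) + d.
  rewrite raising_lowering // mulmxDl chiD; congr (_ + _).
  rewrite mulmx_suml chi_sum; apply: eq_bigr => k _.
  by rewrite -scalemxAl chiZ chi_cartan.
have := chi_raising a (lowering r a *m Y).
have -> : lowering r a *m Y *m raising r a = lowering r a *m raising r a *m Y.
  by rewrite -!mulmxA comY.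
rewrite mulmxA ed mulmxDl chiD ed root_factorE root_cofactorE.
move: (chi (lowering r a *m raising r a *m Y)) 'X_[root_tail_mnm a] 'X_[root_head_mnm a] => t u v e.
have -> : (v - u) * (t + d + t) = 2%:R * (v * t) - 2%:R * (u * t) + (v - u) * d by ring.
by rewrite -e; ring.
Qed.

(** The Cartan part of the Casimir operator gives the Laplacian of chi(Y), and [chi_root] gives the
    root terms of [weyl_laplace] one by one. *)
Lemma weyl_chi_casimir Y : (forall p q, rF r p q *m Y = Y *m rF r p q) ->
  weyl_denominator C n * chi (casimir r *m Y) =
  laplacian (n.-1%:R + sh) (weyl_denominator C n * chi Y) -
  (\sum_(i < n) (n.-1 - i)%N%:R ^+ 2) *: (weyl_denominator C n * chi Y).
Proof.
move=> comY; rewrite weyl_laplace /casimir mulmxDl !mulmx_suml chiD !chi_sum mulrDr.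
congr (_ * _ + _).
  by apply: eq_bigr => k _; rewrite -mulmxA !chi_cartan.
rewrite mulr_sumr; apply: eq_bigr => a ra.
by rewrite {1}/weyl_denominator (bigD1 a) //= [LHS]mulrAC chi_root // [RHS]mulrAC.
Qed.

Lemma mcoeff_chi_casimir Y m : (forall p q, rF r p q *m Y = Y *m rF r p q) ->
  (weyl_denominator C n * chi (casimir r *m Y))@_m =
  (\sum_i ((m i)%:R - (n.-1%:R + sh)) ^+ 2 - \sum_(i < n) (n.-1 - i)%N%:R ^+ 2) *
  (weyl_denominator C n * chi Y)@_m.
Proof.
move=> comY; rewrite weyl_chi_casimir // mcoeffB mcoeffZ mulrBl; congr (_ - _).
rewrite raddf_sum mulr_suml /=; apply: eq_bigr => i _.
by rewrite !mcoeff_euler mulrA.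
Qed.

End CasimirTrace.

(** * Kernel projections and their traces *)

Section HermitianProjection.
Variable C : numClosedFieldType.

(** For M self-adjoint, |M v|^2 = (v, M^2 v). *)
Lemma self_adjoint_ker d e (M : 'M[C]_d) (N : 'M[C]_(d, e)) :
  adjmx M = M -> M *m (M *m N) = 0 -> M *m N = 0.
Proof.
move=> sM MMN; apply/matrixP => i j; rewrite [RHS]mxE.
have e0 : M *m (M *m (N *m delta_mx j (0 : 'I_1))) = 0.
  by rewrite (mulmxA M N) (mulmxA M (M *m N)) MMN mul0mx.
have : M *m (N *m delta_mx j (0 : 'I_1)) = 0.
  by apply/eqP; rewrite -dot_eq0 dot_adjmx sM e0 dotC dot0r rmorph0.
by rewrite mulmxA -colE => /colP /(_ i); rewrite !mxE.
Qed.

(* P projects onto the kernel of M along its image, and Z inverts M on the image. *)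
Lemma hermitian_projection d (M : 'M[C]_d) : adjmx M = M ->
  exists P Z : 'M[C]_d, [/\ P + M *m Z = 1%:M, M *m P = 0 &
    forall A : 'M[C]_d, A *m M = M *m A -> A *m P = P *m A /\ A *m Z = Z *m A].
Proof.
case: d M => [|d] M sM.
  by exists 0, 0; split=> [||A _]; try split; apply/matrixP => -[].
have p0 : char_poly M != 0 by rewrite monic_neq0 ?char_poly_monic.
have [k [q q0 pE]] := multiplicity_XsubC (char_poly M) 0.
rewrite p0 /= subr0 in q0 pE.
have /factor_theorem[q1 q1E] : root (q - q.[0]%:P) 0 by rewrite rootE !hornerE subrr.
rewrite subr0 in q1E.
have MN : M *m horner_mx M q = 0.
  have : M ^+ k *m horner_mx M q = 0.
    have := Cayley_Hamilton M; rewrite pE rmorphM rmorphXn /= horner_mx_X => <-.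
    by rewrite -[RHS]/(horner_mx M q *m M ^+ k); apply: comm_mx_horner; exact: (commr_sym (commrX k (commr_refl M))).
  elim: k {pE} => [|[|k] IH] e; first by rewrite expr0 mul1mx in e; rewrite e mulmx0.
    by rewrite expr1 in e.
  apply: IH; move: e; rewrite !exprS -!mulmxE -!mulmxA; exact: self_adjoint_ker.
exists (q.[0]^-1 *: horner_mx M q), (- (q.[0]^-1 *: horner_mx M q1)); split.
- rewrite mulmxN -scalemxAr -scalerBr.
  rewrite (_ : M *m horner_mx M q1 = horner_mx M q - q.[0]%:M); last first.
    by rewrite -(horner_mx_C M) -rmorphB q1E rmorphM /= horner_mx_X; apply: comm_mx_horner.
  by rewrite opprB addrC subrK scale_scalar_mx mulVf // -rootE.
- by rewrite -scalemxAr MN scaler0.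
- move=> A AM; rewrite mulmxN mulNmx -!scalemxAl -!scalemxAr.
  by split; [congr (_ *: _) | congr (- (_ *: _))]; apply: comm_mx_horner.
Qed.

(** E is the coordinate map [G] to a basis of U followed by the inclusion [B], and the trace of B G
    is that of G B = 1. *)
Lemma idempotent_trace d (E : 'M[C]_d) (U : {vspace 'cV[C]_d}) :
  (forall v : 'cV[C]_d, E *m v \in U) -> (forall u, u \in U -> E *m u = u) ->
  \tr E = (\dim U)%:R.
Proof.
move=> EU Eid; pose b := vbasis U.
have bU i : b`_i \in U.
  have [lt_i|ge_i] := ltnP i (\dim U); last by rewrite nth_default ?size_tuple ?mem0v.
  by apply: vbasis_mem; rewrite mem_nth // size_tuple.
pose B : 'M[C]_(d, \dim U) := \matrix_(x, i) b`_i x 0.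
pose G : 'M[C]_(\dim U, d) := \matrix_(i, x) coord b i (E *m delta_mx x 0).
have GE (v : 'cV[C]_d) i : (G *m v) i 0 = coord b i (E *m v).
  rewrite [v in RHS]matrix_sum_delta mulmx_sumr linear_sum mxE; apply: eq_bigr => x _.
  by rewrite big_ord1 -scalemxAr linearZ /= mxE mulrC.
have BE i : B *m delta_mx i (0 : 'I_1) = b`_i by rewrite -colE; apply/colP => x; rewrite !mxE.
have -> : E = B *m G.
  apply/matrixP => x y.
  have /colP /(_ x) := coord_vbasis (EU (delta_mx y 0)).
  rewrite -[in X in X = _ -> _]colE mxE summxE => ->; rewrite [RHS]mxE; apply: eq_bigr => i _.
  by rewrite !mxE mulrC.
rewrite mxtrace_mulC (_ : G *m B = 1%:M) ?mxtrace1 //; apply/matrixP => i j.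
have := GE (B *m delta_mx j 0) i; rewrite mulmxA -colE mxE => ->.
rewrite BE Eid // coord_free ?mxE; first by rewrite eq_sym.
exact: basis_free (vbasisP U).
Qed.

End HermitianProjection.

Section CasimirBound.
Variables (C : numClosedFieldType) (n : nat) (r : rep C n).
Implicit Types (p q : 'I_(n + n)) (a : root_index n) (v : 'cV[C]_(rdim r)) (mu : 'rV[C]_n).

Definition casimir_value mu : C :=
  \sum_(i < n) (mu 0 i + (n.-1 - i)%N%:R) ^+ 2 - \sum_(i < n) (n.-1 - i)%N%:R ^+ 2.

(** For each positive root EF + FE = 2FE + [E, F]; the brackets add up to the pairing with 2 rho,
    which completes the squares. *)
Lemma casimir_weight mu v : weight_vec mu v ->
  casimir r *m v = casimir_value mu *: v +
    2%:R *: \sum_(a | root_lt a) lowering r a *m (raising r a *m v).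
Proof.
move=> wv; have hv k : cartan_op r k *m v = mu 0 k *: v by exact: wv.
rewrite /casimir mulmxDl !mulmx_suml.
rewrite (eq_bigr (fun k => mu 0 k ^+ 2 *: v)) => [|k _]; last first.
  by rewrite -mulmxA hv -scalemxAr hv scalerA expr2.
rewrite (eq_bigr (fun a => 2%:R *: (lowering r a *m (raising r a *m v)) +
    (\sum_k root_coord C a k * mu 0 k) *: v)) => [|a ra]; last first.
  rewrite raising_lowering // addrAC mulmxDl -mulr2n -scaler_nat -scalemxAl mulmxA.
  congr (_ + _); rewrite mulmx_suml scaler_suml; apply: eq_bigr => k _.
  by rewrite -scalemxAl hv scalerA.
rewrite big_split -scaler_sumr -!scaler_suml addrCA addrC -scalerDl; congr (_ *: _ + _).
rewrite exchange_big /=; under [X in _ + X]eq_bigr do rewrite -mulr_suml sum_root_coord.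
rewrite /casimir_value -sumrB -big_split; apply: eq_bigr => k _ /=; ring.
Qed.

Hypothesis unit_r : unitary_rep r.

Lemma adjmx_lowering a : adjmx (lowering r a) = raising r a.
Proof. by rewrite /lowering unit_r !dualK. Qed.

Lemma adjmx_raising a : adjmx (raising r a) = lowering r a.
Proof. by rewrite -adjmx_lowering adjmxK. Qed.

Lemma adjmx_sum (I : finType) (P : pred I) d e (f : I -> 'M[C]_(d, e)) :
  adjmx (\sum_(i | P i) f i) = \sum_(i | P i) adjmx (f i).
Proof.
apply: (big_morph (@adjmx C d e)) => [A B|]; first exact: adjmxD.
by rewrite /adjmx trmx0 map_mx0.
Qed.

Lemma adjmx_casimir : adjmx (casimir r) = casimir r.
Proof.
rewrite /casimir adjmxD !adjmx_sum; congr (_ + _).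
  by apply: eq_bigr => k _; rewrite adjmxM /cartan_op unit_r dual_lshift dual_rshift.
by apply: eq_bigr => a _; rewrite adjmxD !adjmxM adjmx_lowering adjmx_raising.
Qed.

Lemma killedP v : killed v <-> forall a, root_lt a -> raising r a *m v = 0.
Proof.
split=> [kv a ra|kv p q]; first exact/kv/height_root.
have swap s t : rF r s t *m v = 0 -> rF r t s *m v = 0.
  by move=> e; rewrite rF_sym mulNmx e oppr0.
case: (split_ordP p) => i ->; case: (split_ordP q) => j ->;
  rewrite ?height_lshift ?height_rshift => h; have := ltn_ord i; have := ltn_ord j; move=> lj li.
- have [ij|ij|ij] := ltngtP i j.
  + exact: (kv (i, j, true)).
  + by apply: swap; exact: (kv (j, i, true)).
  + by rewrite (ord_inj ij) rF_diag mul0mx.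
- by apply: (kv (i, j, false)); rewrite /root_lt /=; lia.
- by apply: swap; apply: (kv (j, i, false)); rewrite /root_lt /=; lia.
- lia.
Qed.

Lemma casimir_dot mu v : weight_vec mu v ->
  dot v (casimir r *m v) = casimir_value mu * dot v v +
    2%:R * \sum_(a | root_lt a) dot (raising r a *m v) (raising r a *m v).
Proof.
move=> wv; rewrite (casimir_weight wv) dotZDr; congr (_ + _).
rewrite -[_ *: _]addr0 dotZDr dot0r addr0; congr (_ * _).
rewrite /dot mulmx_sumr summxE; apply: eq_bigr => a _.
by rewrite -[LHS]/(dot v _) dot_adjmx adjmx_lowering.
Qed.

(** By unitarity (v, FE v) = |E v|^2, so the eigenvalue exceeds the value on the weight by a
    nonnegative amount. *)
Lemma casimir_eigen_bound mu v c : v != 0 -> weight_vec mu v -> casimir r *m v = c *: v ->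
  casimir_value mu <= c.
Proof.
move=> v0 wv ev; have dv : 0 < dot v v by rewrite Order.POrderTheory.lt_def dot_eq0 v0 dot_ge0.
rewrite -(ler_pM2r dv).
have -> : c * dot v v = dot v (casimir r *m v) by rewrite ev -[c *: v]addr0 dotZDr dot0r addr0.
rewrite (casimir_dot wv) lerDl mulr_ge0 ?ler0n // sumr_ge0 // => a _; exact: dot_ge0.
Qed.

(** The excess is a sum of norms |E v|^2, which vanishes only if every raising operator kills v. *)
Lemma casimir_hw_vec mu v : weight_vec mu v ->
  casimir r *m v = casimir_value mu *: v <-> hw_vec mu v.
Proof.
move=> wv; split=> [ev|[_ kv]]; last first.
  rewrite (casimir_weight wv) big1 ?scaler0 ?addr0 // => a ra.
  by rewrite ((killedP v).1 kv) // mulmx0.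
split=> //; apply/killedP => a ra.
have := casimir_dot wv; rewrite ev -[_ *: v]addr0 dotZDr dot0r addr0 => /eqP.
rewrite addrC -subr_eq subrr eq_sym mulf_eq0 pnatr_eq0 /= psumr_eq0 => [|b _]; last exact: dot_ge0.
by move=> /allP /(_ a (mem_index_enum _)); rewrite ra dot_eq0 => /eqP.
Qed.

End CasimirBound.

(** * Highest weight vectors counted by a coefficient *)

Section HighestWeightCount.
Variables (C : numClosedFieldType) (n : nat) (r : rep C n).
Variables (wt : 'I_(rdim r) -> 'I_n -> nat) (sh : C).
Hypothesis cart_r : cartan_diagonal (r := r) (fun x i => (wt x i)%:R - sh).
Hypothesis unit_r : unitary_rep r.
Variables (top : 'I_n -> nat) (c : 'I_n -> int).
Hypothesis cE : forall i : 'I_n, (c i)%:~R = 2%:R * ((top i)%:R - sh + (n.-1 - i)%N%:R) :> C.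
Hypotheses (c_decr : forall i j : 'I_n, (i < j)%N -> c j < c i)
           (c_pos : forall i j : 'I_n, (i < j)%N -> 0 < c i + c j).

Definition top_weight : 'rV[C]_n := \row_i ((top i)%:R - sh).

Definition basis_weight (x : 'I_(rdim r)) : 'rV[C]_n := \row_i ((wt x i)%:R - sh).

Definition top_exponent : 'X_{1..n} := (weyl_top n + [multinom top i | i < n])%MM.

(** Let beta be the weight of x and [g] the difference of [weyl_top] and v. Then beta + rho = mu +
    rho + g, so |beta + rho|^2 - |mu + rho|^2 = 2 (mu + rho, g) + |g|^2, and the pairing is positive
    by assumption. Here [c] is twice mu + rho, whence the factors 4. *)
Lemma casimir_value_le x (v : 'X_{1..n}) :
  (v + wt_mnm wt x)%MM = top_exponent -> mnm_pairing c v < mnm_pairing c (weyl_top n) ->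
  ~~ (casimir_value (basis_weight x) <= casimir_value top_weight).
Proof.
move=> e lt_v; pose g (i : 'I_n) : int := (weyl_top n i)%:Z - (v i)%:Z.
have wE i : (wt x i)%:R = (top i)%:R + (g i)%:~R :> C.
  have := congr1 (fun m : 'X_{1..n} => m i) e.
  rewrite /top_exponent !mnmDE [wt_mnm _ _ _]mnmE [[multinom top i | i < n]%MM i]mnmE => ei.
  by rewrite !pmulrn -intrD; congr (_%:~R); rewrite /g; lia.
have four0 : 0 < 4%:R :> C by rewrite ltr0n.
rewrite /casimir_value lerD2r -(ler_pM2l four0) !mulr_sumr.
have -> : \sum_(i < n) 4%:R * (basis_weight x 0 i + (n.-1 - i)%N%:R) ^+ 2 =
    (\sum_i (c i + 2 * g i) ^+ 2)%:~R.
  rewrite rmorph_sum; apply: eq_bigr => i _ /=; rewrite mxE wE rmorphXn /= intrD intrM cE; ring.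
have -> : \sum_(i < n) 4%:R * (top_weight 0 i + (n.-1 - i)%N%:R) ^+ 2 = (\sum_i (c i) ^+ 2)%:~R.
  rewrite rmorph_sum; apply: eq_bigr => i _ /=; rewrite mxE rmorphXn /= cE; ring.
rewrite ler_int -Order.TotalTheory.ltNge.
have -> : \sum_i (c i + 2 * g i) ^+ 2 = \sum_i c i ^+ 2 + (4 * \sum_i c i * g i + 4 * \sum_i g i ^+ 2).
  by rewrite !mulr_sumr -!big_split; apply: eq_bigr => i _ /=; ring.
have -> : \sum_i c i * g i = mnm_pairing c (weyl_top n) - mnm_pairing c v.
  by rewrite /mnm_pairing -sumrB; apply: eq_bigr => i _; rewrite /g mulrBr.
have : 0 <= \sum_i g i ^+ 2 by rewrite sumr_ge0 // => i _; rewrite sqr_ge0.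
lia.
Qed.

Theorem hw_space_dim (HW : {vspace 'cV[C]_(rdim r)}) :
  (forall u, u \in HW <-> hw_vec top_weight u) ->
  (\dim HW)%:R = (weyl_denominator C n * \sum_x 'X_[wt_mnm wt x])@_top_exponent.
Proof.
move=> HWP; pose M := casimir r - (casimir_value top_weight)%:M.
have sM : adjmx M = M.
  (* The value is real because mu + rho is half-integral. *)
  have cr : (casimir_value top_weight)^* = casimir_value top_weight.
    have e : casimir_value top_weight = (4%:R)^-1 * (\sum_i (c i) ^+ 2)%:~R - \sum_(i < n) (n.-1 - i)%N%:R ^+ 2.
      rewrite /casimir_value rmorph_sum mulr_sumr; congr (_ - _); apply: eq_bigr => i _ /=.
      by rewrite mxE rmorphXn /= cE; field.
    rewrite e rmorphB rmorphM fmorphV rmorph_int rmorph_nat; congr (_ - _).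
    by rewrite rmorph_sum; apply: eq_bigr => i _; rewrite rmorphXn rmorph_nat.
  by rewrite /M -scaleN1r adjmxD adjmx_casimir // /adjmx linearZ /= tr_scalar_mx map_mxZ map_scalar_mx /= cr rmorphN1.
have [P [Z [PZ MP com]]] := hermitian_projection sM.
have comF p q : rF r p q *m M = M *m rF r p q.
  by rewrite mulmxBr mulmxBl casimir_comm scalar_mxC.
have [comP comZ] : (forall p q, rF r p q *m P = P *m rF r p q) /\
                   (forall p q, rF r p q *m Z = Z *m rF r p q).
  by split=> p q; have [] := com _ (comF p q).
have PM : P *m M = 0 by rewrite -MP; apply/esym; have [] := com M erefl.
have chi1 : \sum_x 'X_[wt_mnm wt x] = chi wt P + chi wt (M *m Z).
  by rewrite -chiD PZ; apply: eq_bigr => x _; rewrite mxE eqxx scale1r.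
(* At this exponent the Casimir operator multiplies the coefficient by exactly its value on mu, so
   [M] multiplies it by 0. *)
have coefMZ : (weyl_denominator C n * chi wt (M *m Z))@_top_exponent = 0.
  rewrite mulmxBl mul_scalar_mx -scaleNr chiD chiZ mulrDr mcoeffD -scalerAr mcoeffZ.
  rewrite (mcoeff_chi_casimir cart_r) // mulNr -mulrBl (_ : _ - _ = 0) ?mul0r //.
  apply/eqP; rewrite subr_eq0 /casimir_value; apply/eqP; congr (_ - _); apply: eq_bigr => i _.
  congr (_ ^+ 2); rewrite /top_exponent mnmDE !mnmE mxE natrD.
  have lt_i := ltn_ord i.
  have -> : (2 * n.-1 - i = n.-1 + (n.-1 - i))%N by lia.
  by rewrite natrD; ring.
rewrite chi1 mulrDr mcoeffD coefMZ addr0.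
have casP x : casimir r *m (P *m delta_mx x (0 : 'I_1)) =
    casimir_value top_weight *: (P *m delta_mx x 0).
  apply/eqP; rewrite -subr_eq0 -mul_scalar_mx -mulmxBl mulmxA MP mul0mx //.
have wP x : weight_vec (basis_weight x) (P *m delta_mx x (0 : 'I_1)).
  move=> i; rewrite mulmxA comP -mulmxA scalemxAr; congr (_ *m _).
  rewrite cart_r mul_diag_mx; apply/matrixP => y z; rewrite !mxE.
  by case: eqP => [->|]; rewrite ?mulr0.
(* [Pi] selects the basis vectors of weight mu. Then [P *m Pi] maps onto [HW] and fixes it: a vector
   of weight mu with this Casimir eigenvalue is a highest weight vector. *)
transitivity (\sum_(x | wt_mnm wt x == [multinom top i | i < n]%MM) P x x).
  pose Pi : 'M[C]_(rdim r) := diag_mx (\row_x (wt_mnm wt x == [multinom top i | i < n]%MM)%:R).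
  have wPi (v : 'cV[C]_(rdim r)) : weight_vec top_weight (Pi *m v).
    move=> i; rewrite cart_r !mul_diag_mx; apply/matrixP => x y; rewrite !mxE.
    case: eqP => [e|_]; last by rewrite mul0r !mulr0.
    by have := congr1 (fun m : 'X_{1..n} => m i) e; rewrite !mnmE => ->.
  rewrite -(@idempotent_trace _ _ (P *m Pi)).
  - rewrite /mxtrace [RHS]big_mkcond; apply: eq_bigr => x _; rewrite mul_mx_diag !mxE.
    by case: ifP => _; rewrite ?mulr1 ?mulr0.
  - move=> v; apply/HWP; rewrite -mulmxA; apply/casimir_hw_vec => //.
      by move=> i; rewrite mulmxA comP -mulmxA wPi -scalemxAr.
    by apply/eqP; rewrite -subr_eq0 -mul_scalar_mx -mulmxBl (mulmxA _ P) MP mul0mx.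
  - move=> u /HWP hu; have [wu _] := hu; rewrite -mulmxA.
    have -> : Pi *m u = u.
      rewrite mul_diag_mx; apply/matrixP => x y; rewrite ord1 !mxE.
      have [->|ux] := eqVneq (u x 0) 0; first by rewrite mulr0.
      rewrite (_ : _ == _) ?mul1r //; apply/eqP/mnmP => i; rewrite !mnmE.
      have := congr1 (fun v : 'cV_(rdim r) => v x 0) (wu i).
      rewrite cart_r mul_diag_mx !mxE => /(mulIf ux) /addIr /eqP.
      by rewrite eqr_nat => /eqP.
    have Mu : M *m u = 0.
      by rewrite mulmxBl mul_scalar_mx ((casimir_hw_vec unit_r wu).2 hu) subrr.
    rewrite -[RHS]mul1mx -PZ mulmxDl (_ : M *m Z = Z *m M); last by have [] := com M erefl.
    by rewrite -(mulmxA Z) Mu mulmx0 addr0.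
(* If [P x x] is nonzero, [P] sends the basis vector x to an eigenvector of the same weight. By the
   two bounds on Casimir values only the leading monomial of the denominator can then lead from x to
   the top exponent, and it does so exactly when x has weight mu. *)
rewrite /chi mulr_sumr raddf_sum big_mkcond; apply: eq_bigr => x _ /=.
rewrite -scalerAr mcoeffZ.
have [->|Px] := eqVneq (P x x) 0; first by rewrite mul0r if_same.
have Pd : P *m delta_mx x (0 : 'I_1) != 0.
  by apply: contraNneq Px => e; have := congr1 (fun v : 'cV_(rdim r) => v x 0) e;
     rewrite -colE !mxE => ->.
have D' := @weyl_denominator_leading C n c c_decr c_pos.
rewrite -[weyl_denominator C n](subrK 'X_[weyl_top n]) mulrDl mcoeffD -mpolyXD mcoeffX.
rewrite (_ : (_ * _)@__ = 0) ?add0r.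
  rewrite /top_exponent eqm_add2l.
  by case: ifP => _; rewrite ?mulr1 ?mulr0.
apply/eqP; rewrite mcoeff_eq0; apply/negP; rewrite (perm_mem (msuppMX _ _)) => /mapP[v /D' lt_v e].
have ev : (v + wt_mnm wt x)%MM = top_exponent by rewrite e addmC.
apply: (negP (casimir_value_le ev lt_v)).
exact: casimir_eigen_bound Pd (wP x) (casP x).
Qed.

End HighestWeightCount.

Section SpinPower.
Variables (C : numClosedFieldType) (n N : nat).
Variables (top : 'I_n -> nat) (c : 'I_n -> int).
Let sh : C := 2%:R^-1 *+ N.
Hypothesis cE : forall i : 'I_n, (c i)%:~R = 2%:R * ((top i)%:R - sh + (n.-1 - i)%N%:R) :> C.
Hypotheses (c_decr : forall i j : 'I_n, (i < j)%N -> c j < c i)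
           (c_pos : forall i j : 'I_n, (i < j)%N -> 0 < c i + c j).

Lemma spin_pow_multiplicity : exists m : nat,
  has_multiplicity (top_weight sh top) (rep_pow (spin_rep C n) N) m /\
  m%:R = \det (\matrix_(i < n, j < n)
    (if (2 * n.-1 - i + top i < j)%N then 0
     else 'C(2 * (n.-1 - j) + N, 2 * n.-1 - i + top i - j)%:R : C)).
Proof.
have [b [carb genb]] := cartan_pow N (@spin_cartan C n).
have ub := unitary_pow N (@spin_unitary C n).
have [HW HWP] := hw_space (rep_pow (spin_rep C n) N) (top_weight sh top).
exists (\dim HW); split; first exact (unitary_multiplicity carb ub HWP).
rewrite (hw_space_dim carb ub cE c_decr c_pos HWP).
have -> : \sum_x 'X_[wt_mnm b x] = \prod_k (1 + 'X_k) ^+ N :> {mpoly C[n]}.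
  transitivity (\sum_x \prod_i ('X_i : {mpoly C[n]}) ^+ b x i).
    by apply: eq_bigr => x _; rewrite mpolyXE_id; apply: eq_bigr => i _; rewrite mnmE.
  apply: etrans (genb {mpoly C[n]} (fun i => 'X_i)) _; rewrite prodrXl; congr (_ ^+ _).
  (* The variables are extended by 0 to all natural indices, as [sum_bit] requires. *)
  pose f (i t : nat) : {mpoly C[n]} := oapp (fun k : 'I_n => 'X_k) 0 (insub i) ^+ t.
  transitivity (\sum_(x < fock_dim n) \prod_(i < n) f i (bit x i)).
    by apply: eq_bigr => x _; apply: eq_bigr => i _; rewrite /f valK.
  by rewrite sum_bit; apply: eq_bigr => i _; rewrite /f valK /= expr0 expr1.
rewrite weyl_denominator_coeff; congr (\det _); apply/matrixP => i j.
by rewrite !mxE /top_exponent mnmDE !mnmE.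
Qed.

End SpinPower.

(** * Binomial determinants and the theorem *)

Definition binz (a : nat) (b : int) : int :=
  match b with Posz l => 'C(a, l)%:Z | Negz _ => 0 end.

Lemma binz_sub a b : binz a (a%:Z - b) = binz a b.
Proof.
case: b => [b|b].
  have [le_b|lt_b] := leqP b a; last first.
    by rewrite (_ : a%:Z - b%:Z = Negz (b - a).-1) /= ?bin_small //; lia.
  by rewrite (_ : a%:Z - b%:Z = (a - b)%N%:Z) /= ?bin_sub //; lia.
by rewrite (_ : a%:Z - Negz b = (a + b.+1)%N%:Z) /= ?bin_small //; lia.
Qed.

Lemma qbinom1 a b : qbinom (1 : rat) a b = (binz a b)%:~R.
Proof.
have qf m : qfact (1 : rat) m = m`!%:R.
  rewrite /qfact fact_prod natr_prod big_add1 big_mkord; apply: eq_bigr => j _.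
  by rewrite /qnum (eq_bigr (fun=> 1)) ?sumr_const ?card_ord // => i _; rewrite expr1n.
case: b => [l|//] /=; case: leqP => [le_l|lt_l]; last by rewrite bin_small.
rewrite !qf -(bin_fact le_l) natrM natrM mulfK // -natrM pnatr_eq0 -lt0n muln_gt0 !fact_gt0 //.
Qed.

Definition binomial_matrix (k n : nat) (lam : 'I_n -> nat) : 'M[int]_n :=
  \matrix_(i < n, j < n) binz (2 * (k + i) + 1) (k%:Z + i%:Z - j%:Z - (lam (rev_ord j))%:Z).

Lemma MD1 k n (lam : 'I_n -> nat) :
  MD (1 : rat) k (fun i => (lam i)%:Z) = (\det (binomial_matrix k lam))%:~R.
Proof.
rewrite /MD -det_map_mx; congr (\det _); apply/matrixP => i j; rewrite !mxE qbinom1 //.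
Qed.

(** Reflection in the antidiagonal permutes rows and columns alike, so the sign occurs squared. *)
Lemma det_rev_tr (R : comNzRingType) n (A : 'M[R]_n) :
  \det (\matrix_(i, j) A (rev_ord j) (rev_ord i)) = \det A.
Proof.
pose s : 'S_n := perm rev_ord_inj.
have -> : \matrix_(i, j) A (rev_ord j) (rev_ord i) = (row_perm s (col_perm s A))^T.
  by apply/matrixP => i j; rewrite !mxE !permE.
rewrite det_tr row_permE col_permE !det_mulmx !det_perm odd_permV.
by rewrite mulrCA -expr2 sqrr_sign mulr1.
Qed.

(** The character determinant is the reflected matrix row by row. A row with top = lam + k + 1
    agrees by the symmetry of binomial coefficients; the last row with top = k - lam agrees
    directly. Thus both signs of the last coordinate give one determinant. *)
Lemma spin_multiplicity_MD (C : numClosedFieldType) k n (lam top : 'I_n -> nat) (c : 'I_n -> int) :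
  (forall i : 'I_n, (c i)%:~R =
     2%:R * ((top i)%:R - 2%:R^-1 *+ (2 * k + 1) + (n.-1 - i)%N%:R) :> C) ->
  (forall i j : 'I_n, (i < j)%N -> c j < c i) ->
  (forall i j : 'I_n, (i < j)%N -> 0 < c i + c j) ->
  (forall i : 'I_n, top i = (lam i + k + 1)%N \/ (i = n.-1 :> nat /\ (top i + lam i)%N = k)) ->
  exists2 m : nat, MD (1 : rat) k (fun i => (lam i)%:Z) = m%:R &
    has_multiplicity (top_weight (2%:R^-1 *+ (2 * k + 1) : C) top)
      (rep_pow (spin_rep C n) (2 * k + 1)) m.
Proof.
move=> cE c_decr c_pos topE.
have [m [mult me]] := spin_pow_multiplicity cE c_decr c_pos; exists m => //.
have : (m%:Z)%:~R = (\det (binomial_matrix k lam))%:~R :> C; last first.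
  by move=> /intr_inj e; rewrite MD1 -e.
rewrite -pmulrn me -(det_rev_tr (binomial_matrix k lam)) -det_map_mx; congr (\det _).
apply/matrixP => i j; rewrite !mxE.
have lt_i := ltn_ord i; have lt_j := ltn_ord j.
have rK : rev_ord (rev_ord i) = i := rev_ordK i.
rewrite rK /=.
have -> (t b : nat) : (if (b < j)%N then 0 else 'C(t, b - j)%:R) = (binz t (b%:Z - j%:Z))%:~R :> C.
  case: ltnP => h; first by rewrite (_ : b%:Z - j%:Z = Negz (j - b).-1) //; lia.
  by rewrite (_ : b%:Z - j%:Z = (b - j)%N%:Z) //; lia.
congr (_%:~R); have -> : (2 * (k + (n - j.+1)) + 1 = 2 * (n.-1 - j) + (2 * k + 1))%N by lia.
case: (topE i) => [te|[ie te]].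
  by rewrite -binz_sub; congr (binz _ _); lia.
by congr (binz _ _); lia.
Qed.

Theorem theorem4p17 (k n : nat) (hk : (0 < k)%N) (hn : (0 < n)%N)
  (lam : 'I_n -> nat) (hlam : is_partition_in k lam) :
  let lamZ := fun i : 'I_n => (lam i)%:Z in
  let lamc := compl_part k lam in
  (MD qvar k lamZ = qvar ^+ part_norm lamc * qdimB qvar (conj_part (k := k) lamc))
  /\
  (forall (C : numClosedFieldType) (Sprev Slast : rep C n),
     is_irr_hw (Lambda_prev C n) Sprev ->
     is_irr_hw (Lambda_last C n) Slast ->
     exists m : nat,
       [/\ MD (1 : rat) k lamZ = m%:R,
           has_multiplicity (weight_of C lamZ + Lambda_last C n)
             (rep_pow (rep_sum Sprev Slast) (2 * k + 1)) m &
           has_multiplicity (weight_of C (neg_last lamZ) + Lambda_prev C n)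
             (rep_pow (rep_sum Sprev Slast) (2 * k + 1)) m]).
Proof.
move=> lamZ lamc; split; first exact: (MD_qdimB qvar_neq0 qvarX_neq1 hlam).
move=> C Sprev Slast hp hl.
have iso := iso_sym (pow_iso (2 * k + 1) (half_spin_iso hn hp hl)).
have [lam_decr lam_le] := hlam.
have half : 2%:R^-1 *+ (2 * k + 1) = k%:R + 2%:R^-1 :> C.
  by rewrite -[LHS]mulr_natr natrD natrM; field.
(* [c] and [c'] are twice mu + rho for the two highest weights mu; [top] and [top'] are mu shifted
   by (2k + 1)/2 in every coordinate. *)
pose c (i : 'I_n) : int := (2 * lam i + 1 + 2 * (n.-1 - i))%N%:Z.
pose c' (i : 'I_n) : int := if i.+1 == n then - (2 * lam i + 1)%N%:Z else c i.
pose top (i : 'I_n) := (lam i + k + 1)%N.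
pose top' (i : 'I_n) := if i.+1 == n then (k - lam i)%N else top i.
have cE i : (c i)%:~R = 2%:R * ((top i)%:R - 2%:R^-1 *+ (2 * k + 1) + (n.-1 - i)%N%:R) :> C.
  by rewrite half /c /top -pmulrn !(natrD, natrM); field.
have [m mE mult] : exists2 m : nat, MD (1 : rat) k lamZ = m%:R &
    has_multiplicity (top_weight (2%:R^-1 *+ (2 * k + 1) : C) top)
      (rep_pow (spin_rep C n) (2 * k + 1)) m.
  apply: (spin_multiplicity_MD cE) => [i j ij|i j ij|i]; last by left.
    by have := lam_decr i j (ltnW ij); have := ltn_ord j; rewrite /c; lia.
  by rewrite /c; lia.
have [m' mE' mult'] : exists2 m : nat, MD (1 : rat) k lamZ = m%:R &
    has_multiplicity (top_weight (2%:R^-1 *+ (2 * k + 1) : C) top')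
      (rep_pow (spin_rep C n) (2 * k + 1)) m.
  apply: (@spin_multiplicity_MD C k n lam top' c') => [i|i j ij|i j ij|i].
  - rewrite /c' /top'; case: eqP => [ie|_]; last exact: cE.
    rewrite (_ : (n.-1 - i = 0)%N); last by lia.
    by rewrite half mulrNz -pmulrn natrB // natrD natrM; field.
  - have lam_ij := lam_decr i j (ltnW ij); have lt_j := ltn_ord j.
    by rewrite /c' (_ : (i.+1 == n) = false); [case: eqP; rewrite /c; lia | lia].
  - have lam_ij := lam_decr i j (ltnW ij); have lt_j := ltn_ord j.
    by rewrite /c' (_ : (i.+1 == n) = false); [case: eqP; rewrite /c; lia | lia].
  - rewrite /top'; case: eqP => [ie|_]; last by left.
    by right; rewrite subnK //; lia.
have mm : m' = m.
  by apply/eqP; rewrite -(eqr_nat rat) -mE' mE.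
exists m; split=> //.
- have -> : weight_of C lamZ + Lambda_last C n = top_weight (2%:R^-1 *+ (2 * k + 1)) top.
    by apply/rowP => i; rewrite !mxE half /top /lamZ -pmulrn !natrD; field.
  exact: iso_multiplicity iso mult.
- have -> : weight_of C (neg_last lamZ) + Lambda_prev C n =
      top_weight (2%:R^-1 *+ (2 * k + 1)) top'.
    apply/rowP => i; rewrite !mxE half /top' /neg_last /lamZ; case: eqP => _.
      by rewrite mulrNz -pmulrn natrB //; field.
    by rewrite /top -pmulrn !natrD; field.
  by rewrite -mm; exact: iso_multiplicity iso mult'.
Qed.
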